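(* Let $(M^n,\nu,H,g)$ be a closed oriented generalised Riemannian manifold. Let $\tau$ be a $d_\nu$-closed chiral $\mathbf{E}$-spinor field and let $\gamma$ be a chiral $\mathbf{E}$-spinor field such that $\widetilde{\mathcal{G}}\gamma$ has the same chirality as $\tau$. Then $\tau$ is a critical point in its $d_\nu$-cohomology class $\{\tau+d_\nu\sigma\}$ for the functional $\mathbf{Q}(\tau)=(\tau,\tau)$ subject to the constraint $\mathbf{C}_\gamma(\tau)=(\widetilde{\mathcal{G}}\gamma,\tau)=\mathrm{const}$ if and only if $$d_\nu\widetilde{\mathcal{G}}\tau=\lambda\,d_\nu\gamma\quad\text{for some }\lambda\in\mathbb{R}.$$
   Context: $M$ is a closed oriented $n$-manifold, $\nu$ a nowhere vanishing $n$-vector field (with dual volume form $\varpi_\nu$, compatible with the orientation), $H$ a closed $3$-form and $g$ a Riemannian metric; the pair $(H,g)$ is what a generalised metric amounts to (with its $B$-field absorbed in $H$). $\mathbf{E}=\mathbf{E}(H)$ is the generalised tangent bundle (isomorphic to $TM\oplus T^*M$, transition functions twisted by local potentials of $H$), with real chiral spinor bundles $\mathbf{S}_\pm$. The choice of $\nu$ gives isomorphisms $\rho\mapsto\rho^\nu$, $\Gamma(\mathbf{S}_\pm)\cong\Omega^{ev,od}(M)$; under them the differential $d_\nu:\Gamma(\mathbf{S}_\pm)\to\Gamma(\mathbf{S}_\mp)$ is $(d_\nu\rho)^\nu=d_H\rho^\nu$ with $d_H\alpha=d\alpha+H\wedge\alpha$. A spinor field is chiral if it is a section of $\mathbf{S}_+$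 or of $\mathbf{S}_-$. For a $p$-form put $\widehat\alpha=(-1)^{p(p+1)/2}\alpha$, $\widetilde\alpha=(-1)^p\alpha$. The operator $\widetilde{\mathcal{G}}$ is given by $(\widetilde{\mathcal{G}}\rho)^\nu=\star_g\widehat{\rho^\nu}$ if $n$ is even and $(\widetilde{\mathcal{G}}\rho)^\nu=\star_g\widehat{\widetilde{\rho^\nu}}$ if $n$ is odd, with $\star_g$ the Hodge operator. The $L^2$-type inner product on $\Gamma(\mathbf{S}_\pm)$ is $$(\sigma,\tau)=\tfrac12\int_M[\star_g\sigma^\nu\wedge\tau^\nu]^n,$$ where $[\cdot]^n$ is the degree $n$ component. ''Critical point subject to the constraint'' means constrained critical point: the first variation of $\mathbf{Q}$ at $\tau$ vanishes on all tangent directions $\dot\tau=d_\nu\sigma$ on which the first variation of $\mathbf{C}_\gamma$ vanishes. *)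

(* Defs.v *)
From HB Require Import structures.
From mathcomp Require Import all_boot all_order all_algebra.
From mathcomp Require Import all_classical all_reals all_analysis.

Set Implicit Arguments.
Unset Strict Implicit.
Unset Printing Implicit Defensive.

Import Order.TTheory GRing.Theory Num.Theory.
Import numFieldNormedType.Exports.

Local Open Scope classical_set_scope.
Local Open Scope ring_scope.

(* The exterior algebra of (R^n)^*: [alpha I] is the coefficient of
   dx^{i_1} /\ ... /\ dx^{i_p} for I = {i_1 < ... < i_p}; all degrees at once. *)
Definition ext (R : realType) (n : nat) := {ffun {set 'I_n} -> R^o}.

Section ExteriorAlgebra.
Variables (R : realType) (n : nat).
Implicit Types (alpha beta : ext R n) (I J K : {set 'I_n}).

(* dx^I /\ dx^J = shuffle_sign I J * dx^(I :|: J) for disjoint I and J. *)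
Definition shuffle_sign I J : R :=
  (-1) ^+ #|[pred p : 'I_n * 'I_n | [&& p.1 \in I, p.2 \in J & (p.2 < p.1)%N]]|.

Definition wedge alpha beta : ext R n :=
  [ffun K : {set 'I_n} => \sum_(I : {set 'I_n} | I \subset K)
     shuffle_sign I (K :\: I) * (alpha I * beta (K :\: I))].

Definition ext1 : ext R n := [ffun I : {set 'I_n} => (I == finset.set0)%:R].

(* The covector \sum_i w_i dx^i. *)
Definition covector (w : 'I_n -> R) : ext R n :=
  [ffun I : {set 'I_n} => \sum_i (I == [set i]%SET)%:R * w i].

(* The exponential of a form of positive even degree: higher powers vanish. *)
Definition wedge_exp alpha : ext R n :=
  \sum_(k < n.+1) (k`!%:R : R)^-1 *: iter k (wedge alpha) ext1.

(* The algebra morphism induced by dx^j |-> \sum_i (A i j) dx^i.  For A the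
   Jacobian (in the row-vector convention of [jacobian], A i j = d_i f_j) this
   is the pullback along f; its entry at (I, J) is the minor of A on the rows I
   and the columns J. *)
Definition ext_map (A : 'M[R]_n) alpha : ext R n :=
  \sum_(J : {set 'I_n})
    alpha J *: \big[wedge/ext1]_(j <- enum J) covector (fun i => A i j).

Definition has_degree (p : nat) alpha : Prop :=
  forall I, #|I| != p -> alpha I = 0.

(* [false] is even, [true] is odd. *)
Definition has_parity (c : bool) alpha : Prop :=
  forall I, odd #|I| != c -> alpha I = 0.

Definition hat alpha : ext R n :=
  [ffun I : {set 'I_n} => (-1) ^+ (#|I| * #|I|.+1)./2 * alpha I].

Definition tilde alpha : ext R n :=
  [ffun I : {set 'I_n} => (-1) ^+ #|I| * alpha I].

(* The metric induced on forms by the Gram matrix g of the coordinate basis: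
   <dx^I, dx^J> is the (I, J)-minor of g^-1. *)
Definition ext_inner (g : 'M[R]_n) alpha beta : R :=
  \sum_(I : {set 'I_n}) alpha I * ext_map (invmx g) beta I.

(* In the convention alpha /\ star beta = <alpha, beta> sqrt(det g) dx^1...dx^n,
   which determines star; see [wedge_hodge]. *)
Definition hodge (g : 'M[R]_n) beta : ext R n :=
  [ffun K : {set 'I_n} => Num.sqrt (\det g) *
     (shuffle_sign (~: K)%SET K * ext_map (invmx g) beta (~: K)%SET)].

Lemma wedge_hodge (g : 'M[R]_n) alpha beta :
  wedge alpha (hodge g beta) finset.setT
  = ext_inner g alpha beta * Num.sqrt (\det g).
Proof.
rewrite /wedge ffunE /ext_inner mulr_suml.
rewrite (eq_bigl xpredT); last by move=> I; rewrite finset.subsetT.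
apply: eq_bigr => I _; rewrite finset.setTD /hodge ffunE finset.setCK.
set s := shuffle_sign _ _.
have ss : s * s = 1 by rewrite /s /shuffle_sign -expr2 sqrr_sign.
set b := ext_map _ _ _; set q := Num.sqrt _.
rewrite [s * _]mulrC [q * _]mulrC -!mulrA [q * s]mulrC [s * (b * _)]mulrCA.
by rewrite [s * (s * q)]mulrA ss mul1r.
Qed.

End ExteriorAlgebra.

Arguments ext1 {R n}.

Section SmoothFunctions.
Variables (R : realType) (n : nat).

Definition partial (i : 'I_n) (f : 'rV[R]_n -> R) : 'rV[R]_n -> R :=
  fun y => 'D_(delta_mx 0 i) f y.

Fixpoint continuously_differentiable (k : nat) (U : set 'rV[R]_n)
    (f : 'rV[R]_n -> R) : Prop :=
  (forall y, U y -> {for y, continuous f}) /\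
  match k with
  | 0 => True
  | k'.+1 => forall i : 'I_n,
      (forall y, U y -> derivable f y (delta_mx 0 i)) /\
      continuously_differentiable k' U (partial i f)
  end.

(* To be used for an open set U. *)
Definition smooth_on (U : set 'rV[R]_n) (f : 'rV[R]_n -> R) : Prop :=
  forall k, continuously_differentiable k U f.

End SmoothFunctions.

(* The Lebesgue integral over R^n of a continuous function with compact
   support, as an iterated integral. *)
Fixpoint integral_rV (R : realType) (n : nat) : ('rV[R]_n -> R) -> R :=
  match n with
  | 0 => fun f => f 0
  | m.+1 => fun f => \int[@lebesgue_measure R]_(t in setT)
      integral_rV (fun y : 'rV[R]_m => f (row_mx (t%:M : 'rV[R]_1) y))
  end.

(* [chart_inv a] is the inverse of the chart [chart a]; both functions are total,
   and only their values on [chart_dom a] and on its image matter. *)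
Record oriented_atlas (R : realType) (n : nat) (M : topologicalType) :=
  OrientedAtlas {
  chart_index : Type;
  chart_dom : chart_index -> set M;
  chart : chart_index -> M -> 'rV[R]_n;
  chart_inv : chart_index -> 'rV[R]_n -> M;
  chart_dom_open : forall a, open (chart_dom a);
  chart_dom_cover : forall x, exists a, chart_dom a x;
  image_open : forall a, open (chart a @` chart_dom a);
  chartK : forall a x, chart_dom a x -> chart_inv a (chart a x) = x;
  chart_continuous : forall a x, chart_dom a x -> {for x, continuous (chart a)};
  chart_inv_continuous : forall a y, (chart a @` chart_dom a) y ->
    {for y, continuous (chart_inv a)};
  transition_smooth : forall a b (i : 'I_n),
    smooth_on (chart a @` (chart_dom a `&` chart_dom b))
      (fun y => chart b (chart_inv a y) 0 i);
  transition_oriented : forall a b x, chart_dom a x -> chart_dom b x ->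
    0 < \det (jacobian (fun y => chart b (chart_inv a y)) (chart a x)) }.

Section Fields.
Variables (R : realType) (n : nat) (M : topologicalType).
Variable A : oriented_atlas R n M.

(* Sections of bundles over M are families of local representatives, one for
   each chart, related on the overlaps by the transition functions.  The values
   of [s a] outside [chart_dom a] are irrelevant. *)
Definition local_field (V : Type) := chart_index A -> M -> V.

Definition field_eq (V : Type) (s t : local_field V) : Prop :=
  forall a x, chart_dom a x -> s a x = t a x.

Definition transition_jacobian (a b : chart_index A) (x : M) : 'M[R]_n :=
  jacobian (fun y => chart b (chart_inv a y)) (chart a x).

Definition smooth_field (f : local_field R) : Prop :=
  forall a, smooth_on (chart a @` chart_dom a) (fun y => f a (chart_inv a y)).

Definition smooth_ext (alpha : local_field (ext R n)) : Prop :=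
  forall I : {set 'I_n}, smooth_field (fun a x => alpha a x I).

Definition is_form (alpha : local_field (ext R n)) : Prop :=
  smooth_ext alpha /\
  (forall a b x, chart_dom a x -> chart_dom b x ->
     alpha a x = ext_map (transition_jacobian a b x) (alpha b x)).

(* d alpha = \sum_i dx^i /\ d_i alpha. *)
Definition ext_d (alpha : local_field (ext R n)) : local_field (ext R n) :=
  fun a x => \sum_i wedge (covector (fun j => (j == i)%:R))
    [ffun I : {set 'I_n} =>
       partial i (fun y => alpha a (chart_inv a y) I) (chart a x)].

Record partition_of_unity := PartitionOfUnity {
  pou_size : nat;
  pou_chart : 'I_pou_size -> chart_index A;
  pou_fun : 'I_pou_size -> M -> R;
  pou_smooth : forall k, smooth_field (fun _ x => pou_fun k x);
  pou_ge0 : forall k x, 0 <= pou_fun k x;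
  pou_support : forall k,
    closure [set x | pou_fun k x != 0] `<=` chart_dom (pou_chart k);
  pou_sum : forall x, \sum_k pou_fun k x = 1 }.

Arguments pou_chart : clear implicits.
Arguments pou_fun : clear implicits.

Definition pou_integral (P : partition_of_unity)
    (omega : local_field (ext R n)) : R :=
  \sum_k integral_rV
    ((fun y => let x := chart_inv (pou_chart P k) y in
        pou_fun P k x * omega (pou_chart P k) x finset.setT)
     \_ (chart (pou_chart P k) @` chart_dom (pou_chart P k))).

(* The integral over M of the component of degree n of omega.  On a compact
   Hausdorff M a partition of unity exists, and the value does not depend on
   the choice of one. *)
Definition integral_M (omega : local_field (ext R n)) : R :=
  match pselect (exists P : partition_of_unity, True) with
  | left exP => pou_integral (projT1 (cid exP)) omega
  | right _ => 0
  end.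

End Fields.

(* In the chart a, the n-vector field is nu = [nu a] d_1 /\ ... /\ d_n, and
   [gmetric a] is the Gram matrix of d_1, ..., d_n.  The local 2-forms [bpot a]
   are the local potentials of H that define the generalised tangent bundle
   E(H) and its spinor bundles: the transition functions are twisted by the
   closed 2-forms bpot a - bpot b. *)
Record generalised_riemannian (R : realType) (n : nat) (M : topologicalType)
    (A : oriented_atlas R n M) := GeneralisedRiemannian {
  nu : local_field A R;
  flux : local_field A (ext R n);
  bpot : local_field A (ext R n);
  gmetric : local_field A 'M[R]_n;
  nu_smooth : smooth_field nu;
  nu_gt0 : forall a x, chart_dom a x -> 0 < nu a x;
  nu_transition : forall a b x, chart_dom a x -> chart_dom b x ->
    nu b x = \det (transition_jacobian a b x) * nu a x;
  flux_form : is_form flux;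
  flux_degree : forall a x, chart_dom a x -> has_degree 3 (flux a x);
  flux_closed : field_eq (ext_d flux) (fun _ _ => 0);
  bpot_smooth : smooth_ext bpot;
  bpot_degree : forall a x, chart_dom a x -> has_degree 2 (bpot a x);
  bpot_potential : field_eq (ext_d bpot) flux;
  gmetric_smooth : forall i j, smooth_field (fun a x => gmetric a x i j);
  gmetric_sym : forall a x, chart_dom a x -> (gmetric a x)^T = gmetric a x;
  gmetric_pos : forall a x (v : 'rV[R]_n), chart_dom a x -> v != 0 ->
    0 < (v *m gmetric a x *m v^T) 0 0;
  gmetric_transition : forall a b x, chart_dom a x -> chart_dom b x ->
    gmetric a x = transition_jacobian a b x *m gmetric b x
                 *m (transition_jacobian a b x)^T }.

Section Spinors.
Variables (R : realType) (n : nat) (M : topologicalType).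
Variables (A : oriented_atlas R n M) (E : generalised_riemannian A).
Implicit Types rho sigma tau gamma : local_field A (ext R n).

(* Sections of S_+ (+) S_-, where S_+- is locally the even or odd part of
   Lambda T^*M (x) (Lambda^n TM)^(1/2), trivialised by
   dx^I (x) (d_1 /\ ... /\ d_n)^(1/2), with transition functions twisted by the
   exponentials of the differences of the potentials. *)
Definition is_spinor_field rho : Prop :=
  smooth_ext rho /\
  (forall a b x, chart_dom a x -> chart_dom b x ->
     let J := transition_jacobian a b x in
     rho a x = (Num.sqrt (\det J))^-1 *:
       wedge (wedge_exp (bpot E a x - ext_map J (bpot E b x)))
             (ext_map J (rho b x))).

Definition has_chirality (c : bool) rho : Prop :=
  forall a x, chart_dom a x -> has_parity c (rho a x).

(* Gamma(S_+) for c = false, Gamma(S_-) for c = true. *)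
Definition chiral_spinor_field (c : bool) rho : Prop :=
  is_spinor_field rho /\ has_chirality c rho.

(* rho |-> rho^nu: in each chart, rho = e^B /\ rho^nu (x) nu^(1/2). *)
Definition to_form rho : local_field A (ext R n) :=
  fun a x => (Num.sqrt (nu E a x))^-1 *:
    wedge (wedge_exp (- bpot E a x)) (rho a x).

(* The inverse of rho |-> rho^nu. *)
Definition of_form (alpha : local_field A (ext R n)) : local_field A (ext R n) :=
  fun a x => Num.sqrt (nu E a x) *: wedge (wedge_exp (bpot E a x)) (alpha a x).

Definition d_flux (alpha : local_field A (ext R n)) : local_field A (ext R n) :=
  fun a x => ext_d alpha a x + wedge (flux E a x) (alpha a x).

Definition d_nu rho : local_field A (ext R n) := of_form (d_flux (to_form rho)).

Definition gtilde rho : local_field A (ext R n) :=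
  of_form (fun a x =>
    let alpha := to_form rho a x in
    hodge (gmetric E a x) (hat (if odd n then tilde alpha else alpha))).

Definition spinor_inner sigma tau : R :=
  2^-1 * integral_M (fun a x =>
    wedge (hodge (gmetric E a x) (to_form sigma a x)) (to_form tau a x)).

Definition Q_functional tau : R := spinor_inner tau tau.

Definition C_functional gamma tau : R := spinor_inner (gtilde gamma) tau.

Definition shift_field tau (t : R) (v : local_field A (ext R n)) :
    local_field A (ext R n) :=
  fun a x => tau a x + t *: v a x.

Definition first_variation_vanishes (F : local_field A (ext R n) -> R)
    tau (v : local_field A (ext R n)) : Prop :=
  is_derive (0 : R) (1 : R) (fun t : R => F (shift_field tau t v)) (0 : R).

(* Here tau has chirality c, so that its d_nu-cohomology class consists of the
   tau + d_nu sigma with sigma of the opposite chirality. *)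
Definition constrained_critical (c : bool) gamma tau : Prop :=
  forall sigma, chiral_spinor_field (~~ c) sigma ->
    first_variation_vanishes (C_functional gamma) tau (d_nu sigma) ->
    first_variation_vanishes Q_functional tau (d_nu sigma).

End Spinors.

(* Main.v *)
Require Import Defs.
From HB Require Import structures.
From mathcomp Require Import all_boot all_order all_algebra.
From mathcomp Require Import all_classical all_reals all_analysis.
From mathcomp Require Import fingroup perm.
From mathcomp Require Import ring lra zify.
Set Implicit Arguments.
Unset Strict Implicit.
Unset Printing Implicit Defensive.
Import Order.TTheory GRing.Theory Num.Theory.
Import numFieldNormedType.Exports.
Local Open Scope classical_set_scope.
Local Open Scope ring_scope.

(* Let alpha^nu = to_form alpha, t = tau^nu, k = gamma^nu and G t = (G~ tau)^nu.  On
   forms of pure parity G is hat o star up to a sign, and star o star is a sign, so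
   the first variations of Q and C_gamma in the direction d_nu sigma are, up to
   nonzero constants,
     \int hat (G t) /\ d_H s   and   \int hat k /\ d_H s,   s = sigma^nu.
   By Stokes' theorem d_H is adjoint to hat o d_H o hat for \int top (_ /\ _), so these
   are L(X, s) and L(Y, s), where L(Z, s) = \int hat Z /\ s, X = d_H (G t) and
   Y = d_H k.  If X = lambda Y, then L(Y, s) = 0 implies L(X, s) = 0.  Conversely, take
   s = star (hat (X - lambda Y)) with lambda such that L(Y, s) = 0; then L(X, s) = 0,
   hence L(X - lambda Y, s), the squared L^2 norm of X - lambda Y, vanishes.

   Stokes' theorem for the integral defined by a partition of unity rests on the
   local change of variables formula.  A transition function is modified to be affine
   far from a point, and for such maps the formula follows from Lax's argument: the
   integral of the pullback of a compactly supported density only depends on the map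
   near infinity. *)

(** * The exterior algebra *)

(** The twist of the spinor bundles disappears under [to_form]: the factors e^B and nu^(1/2) cancel
    against the transition rule, so everything takes place among global forms. The obstacle is
    [integral_M]: it selects some partition of unity [P], of which only the defining properties are
    known. To prove Stokes' theorem for this [P], the form is cut up by a second partition [Q], so
    fine that on each piece all the integrals of [P] can be carried to one common chart. There the
    functions of [P] add up to 1, and what remains is that a partial derivative of a compactly
    supported function has integral 0. Carrying an integral from one chart to another is the only
    use of the change of variables formula. For the converse, L(Z, star (hat Z)) is the squared norm
    of Z, so lambda is the coefficient of the orthogonal projection of X on Y, or 0 if Y has norm 0.
    The direction star (hat (X - lambda Y)) is admissible only if it has the chirality opposite to
    tau; this requires X and Y to have the same parity, which is what the hypothesis on the
    chirality of G~ gamma provides. *)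

Lemma set_ind (T : finType) (P : {set T} -> Prop) :
  P finset.set0 -> (forall i (J : {set T}), i \notin J -> P J -> P (i |: J)%SET) ->
  forall J, P J.
Proof.
move=> P0 PS J; have [k] := ubnP #|J|; elim: k J => // k IH J Jk.
case: (finset.set_0Vmem J) => [->//|[i iJ]].
rewrite -(finset.setD1K iJ); apply: PS; first by rewrite !inE eqxx.
by apply: IH; move: Jk; rewrite (cardsD1 i) iJ.
Qed.

Section ExtAlg.
Variables (R : realType) (n : nat).
Implicit Types (alpha beta gamma : ext R n) (I J K : {set 'I_n}).
Local Notation sgn := (@shuffle_sign R n).

Definition ebase I : ext R n := [ffun J => (J == I)%:R].

Lemma extD alpha beta I : (alpha + beta) I = alpha I + beta I. Proof. by rewrite ffunE. Qed.
Lemma extN alpha I : (- alpha) I = - alpha I. Proof. by rewrite ffunE. Qed.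
Lemma ext0 I : (0 : ext R n) I = 0. Proof. by rewrite ffunE. Qed.
Lemma extZ (a : R) alpha I : (a *: alpha) I = a * alpha I. Proof. by rewrite ffunE. Qed.
Lemma ext_sum (T : Type) (r : seq T) (P : pred T) (F : T -> ext R n) I :
  (\sum_(t <- r | P t) F t) I = \sum_(t <- r | P t) F t I.
Proof. by rewrite sum_ffunE. Qed.
Definition extE := (extD, extN, ext0, extZ, ext_sum).

Lemma ebaseE I J : ebase I J = (J == I)%:R. Proof. by rewrite ffunE. Qed.

Lemma ext_expand alpha : alpha = \sum_I alpha I *: ebase I.
Proof.
apply/ffunP => J; rewrite extE (bigD1 J) //= extE ebaseE eqxx mulr1.
by rewrite big1 ?addr0 // => I IJ; rewrite extE ebaseE eq_sym (negbTE IJ) mulr0.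
Qed.

Lemma wedgeE alpha beta K : wedge alpha beta K =
  \sum_(I : {set 'I_n} | I \subset K) sgn I (K :\: I)%SET * (alpha I * beta (K :\: I)%SET).
Proof. by rewrite ffunE. Qed.

Lemma wedgeDl alpha beta gamma : wedge (alpha + beta) gamma = wedge alpha gamma + wedge beta gamma.
Proof.
apply/ffunP => K; rewrite extD !wedgeE -big_split /=; apply: eq_bigr => I _.
by rewrite extE; ring.
Qed.

Lemma wedgeDr alpha beta gamma : wedge gamma (alpha + beta) = wedge gamma alpha + wedge gamma beta.
Proof.
apply/ffunP => K; rewrite extD !wedgeE -big_split /=; apply: eq_bigr => I _.
by rewrite extE; ring.
Qed.

Lemma wedgeZl (a : R) alpha beta : wedge (a *: alpha) beta = a *: wedge alpha beta.
Proof.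
apply/ffunP => K; rewrite extZ !wedgeE mulr_sumr; apply: eq_bigr => I _.
by rewrite extE; ring.
Qed.

Lemma wedgeZr (a : R) alpha beta : wedge beta (a *: alpha) = a *: wedge beta alpha.
Proof.
apply/ffunP => K; rewrite extZ !wedgeE mulr_sumr; apply: eq_bigr => I _.
by rewrite extE; ring.
Qed.

Lemma wedge0l alpha : wedge 0 alpha = 0.
Proof. by have := wedgeZl 0 0 alpha; rewrite !scale0r. Qed.
Lemma wedge0r alpha : wedge alpha 0 = 0.
Proof. by have := wedgeZr 0 0 alpha; rewrite !scale0r. Qed.
Lemma wedgeNl alpha beta : wedge (- alpha) beta = - wedge alpha beta.
Proof. by rewrite -scaleN1r wedgeZl scaleN1r. Qed.
Lemma wedge_suml (T : Type) (r : seq T) (P : pred T) (F : T -> ext R n) beta :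
  wedge (\sum_(t <- r | P t) F t) beta = \sum_(t <- r | P t) wedge (F t) beta.
Proof.
by apply: (big_morph (fun a => wedge a beta)) => [a b|]; rewrite ?wedgeDl ?wedge0l.
Qed.
Lemma wedge_sumr (T : Type) (r : seq T) (P : pred T) (F : T -> ext R n) beta :
  wedge beta (\sum_(t <- r | P t) F t) = \sum_(t <- r | P t) wedge beta (F t).
Proof.
by apply: (big_morph (fun a => wedge beta a)) => [a b|]; rewrite ?wedgeDr ?wedge0r.
Qed.

(** As a double sum the exponent of the shuffle sign is additive in each argument, whence [sgnUl]
    and [sgnUr]. *)
Definition inversions I J : nat := \sum_(i in I) \sum_(j in J) (j < i)%N.

Lemma sgnE I J : sgn I J = (-1) ^+ inversions I J.
Proof.
rewrite /shuffle_sign /inversions; congr (_ ^+ _).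
rewrite -sum1_card pair_big_dep /= big_mkcond [RHS]big_mkcond /=.
apply: eq_bigr => -[i j] _ /=; rewrite !inE /=.
by case: (i \in I); case: (j \in J) => //=; case: (j < i)%N.
Qed.

Lemma sgn_sq I J : sgn I J * sgn I J = 1.
Proof. by rewrite sgnE -expr2 sqrr_sign. Qed.

Lemma big_disjU (V : nmodType) (F : 'I_n -> V) I J : [disjoint I & J]%B ->
  \sum_(i in (I :|: J)%SET) F i = \sum_(i in I) F i + \sum_(i in J) F i.
Proof.
by move=> IJ; rewrite -bigU //=; apply: eq_bigl => i; rewrite !inE.
Qed.

Lemma sgnUl I J K : [disjoint I & J]%B -> sgn (I :|: J)%SET K = sgn I K * sgn J K.
Proof. by move=> IJ; rewrite !sgnE -exprD /inversions (@big_disjU nat). Qed.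

Lemma sgnUr I J K : [disjoint J & K]%B -> sgn I (J :|: K)%SET = sgn I J * sgn I K.
Proof.
move=> IJ; rewrite !sgnE -exprD /inversions -big_split /=; congr (_ ^+ _).
by apply: eq_bigr => i _; rewrite (@big_disjU nat).
Qed.

(** Each pair in I x J is an inversion for exactly one of the two orders. *)
Lemma sgnC I J : [disjoint I & J]%B -> sgn I J * sgn J I = (-1) ^+ (#|I| * #|J|).
Proof.
move=> IJ; rewrite !sgnE -exprD /inversions; congr (_ ^+ _).
rewrite [X in (_ + X)%N]exchange_big /= -big_split /= -!sum1_card big_distrl /=.
apply: eq_bigr => i iI; rewrite mul1n -big_split /=; apply: eq_bigr => j jJ.
have : i != j by apply: contraTneq jJ => <-; rewrite (disjointFr IJ iI).
by rewrite -val_eqE /=; lia.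
Qed.

Lemma sgn0l J : sgn finset.set0 J = 1.
Proof. by rewrite sgnE /inversions big_set0. Qed.
Lemma sgn0r J : sgn J finset.set0 = 1.
Proof. by rewrite sgnE /inversions big1 // => i _; rewrite big_set0. Qed.

Lemma wedge_ebase I J : wedge (ebase I) (ebase J) =
  if [disjoint I & J]%B then sgn I J *: ebase (I :|: J)%SET else 0.
Proof.
apply/ffunP => K; rewrite wedgeE.
have [->|] := eqVneq K (I :|: J)%SET.
  rewrite (bigD1 I) ?finset.subsetUl //= big1 => [|A /andP[_ AI]]; last first.
    by rewrite !ebaseE (negbTE AI) mul0r mulr0.
  rewrite addr0 !ebaseE eqxx mul1r.
  have -> : ((I :|: J) :\: I = J :\: I)%SET by rewrite finset.setDUl finset.setDv finset.set0U.
  case: ifPn => IJ.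
    have -> : (J :\: I = J)%SET by apply/finset.setDidPl; rewrite disjoint_sym.
    by rewrite extE ebaseE !eqxx.
  rewrite extE; case: eqP => [E|]; last by rewrite mulr0.
  by move: IJ; rewrite disjoint_sym -E; move/negP; case; apply/finset.setDidPl; rewrite E.
move=> KIJ; rewrite big1 => [|A AK].
  by case: ifP => _; rewrite extE // ebaseE (negbTE KIJ) mulr0.
rewrite !ebaseE; case: eqP => [AI|]; last by rewrite mul0r mulr0.
case: eqP => [KA|]; last by rewrite !mulr0.
by case/eqP: KIJ; rewrite -KA -AI -{1}(finset.setID K A) (finset.setIidPr AK).
Qed.

Lemma ebase0 : ebase finset.set0 = ext1.
Proof. by apply/ffunP => I; rewrite !ffunE. Qed.

Lemma wedge1l : left_id ext1 (@wedge R n).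
Proof.
move=> a; rewrite [in LHS](ext_expand a) [in RHS](ext_expand a) wedge_sumr.
apply: eq_bigr => I _; rewrite wedgeZr -ebase0 wedge_ebase.
by rewrite -setI_eq0 finset.set0I eqxx sgn0l scale1r finset.set0U.
Qed.
Lemma wedge1r : right_id ext1 (@wedge R n).
Proof.
move=> a; rewrite [in LHS](ext_expand a) [in RHS](ext_expand a) wedge_suml.
apply: eq_bigr => I _; rewrite wedgeZl -ebase0 wedge_ebase.
by rewrite -setI_eq0 finset.setI0 eqxx sgn0r scale1r finset.setU0.
Qed.

(** Unless the three sets are pairwise disjoint both sides vanish; if they are, the sign on either
    side is the product of the three pairwise signs. *)
Lemma wedgeA_ebase I J K :
  wedge (ebase I) (wedge (ebase J) (ebase K)) = wedge (wedge (ebase I) (ebase J)) (ebase K).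
Proof.
rewrite (wedge_ebase J K) (wedge_ebase I J).
case: (boolP [disjoint J & K]%B) => JK; case: (boolP [disjoint I & J]%B) => IJ;
  rewrite ?wedge0l ?wedge0r ?wedgeZl ?wedgeZr ?wedge_ebase.
- have -> : [disjoint I & (J :|: K)%SET]%B = [disjoint I & K]%B.
    by rewrite -!setI_eq0 finset.setIUr finset.setU_eq0; move: IJ; rewrite -setI_eq0 => ->.
  have -> : [disjoint (I :|: J)%SET & K]%B = [disjoint I & K]%B.
    by rewrite -!setI_eq0 finset.setIUl finset.setU_eq0; move: JK; rewrite -setI_eq0 => ->; rewrite andbT.
  case: ifP => // IK; last by rewrite !scaler0.
  by rewrite sgnUl // sgnUr // !scalerA finset.setUA; congr (_ *: _); ring.
- have -> : [disjoint I & (J :|: K)%SET]%B = false.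
    by apply/negbTE; apply: contraNN IJ; rewrite -!setI_eq0 finset.setIUr finset.setU_eq0 => /andP[].
  by rewrite scaler0.
- have -> : [disjoint (I :|: J)%SET & K]%B = false.
    by apply/negbTE; apply: contraNN JK; rewrite -!setI_eq0 finset.setIUl finset.setU_eq0 => /andP[].
  by rewrite scaler0.
- by [].
Qed.

Lemma wedgeA : associative (@wedge R n).
Proof.
move=> a b c; rewrite (ext_expand a) !wedge_suml; apply: eq_bigr => I _.
rewrite !wedgeZl (ext_expand b) !(wedge_suml, wedge_sumr); congr (_ *: _).
apply: eq_bigr => J _.
rewrite !(wedgeZl, wedgeZr) (ext_expand c) !(wedge_suml, wedge_sumr); congr (_ *: _).
by apply: eq_bigr => K _; rewrite !wedgeZr wedgeA_ebase.
Qed.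

HB.instance Definition _ := Monoid.isLaw.Build (ext R n) ext1 (@wedge R n) wedgeA wedge1l wedge1r.

Lemma covectorE (w : 'I_n -> R) : covector w = \sum_i w i *: ebase [set i]%SET.
Proof.
apply/ffunP => J; rewrite extE ffunE; apply: eq_bigr => i _.
by rewrite extE ebaseE mulrC.
Qed.

Lemma covector1 i : covector (fun j => (j == i)%:R) = ebase [set i]%SET.
Proof.
rewrite covectorE (bigD1 i) //= eqxx scale1r big1 ?addr0 // => j ji.
by rewrite (negbTE ji) scale0r.
Qed.

Lemma sgn1 i J : sgn [set i]%SET J = (-1) ^+ (\sum_(j in J) (j < i)%N).
Proof. by rewrite sgnE /inversions big_set1. Qed.

Lemma wedge_ebase1 i J : wedge (ebase [set i]%SET) (ebase J) =
  if i \in J then 0 else sgn [set i]%SET J *: ebase (i |: J)%SET.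
Proof. by rewrite wedge_ebase disjoints1; case: (i \in J). Qed.

Lemma ebase1_sq i : wedge (ebase [set i]%SET) (ebase [set i]%SET) = 0.
Proof. by rewrite wedge_ebase1 inE eqxx. Qed.

Lemma ebase1C i j : wedge (ebase [set i]%SET) (ebase [set j]%SET) =
  - wedge (ebase [set j]%SET) (ebase [set i]%SET).
Proof.
have [->|ij] := eqVneq i j; first by rewrite ebase1_sq oppr0.
rewrite !wedge_ebase1 !inE [j == i]eq_sym (negbTE ij) finset.setUC.
have := @sgnC [set i]%SET [set j]%SET; rewrite disjoints1 inE ij => /(_ isT).
rewrite !cards1 expr1 => E; rewrite -scaleNr; congr (_ *: _).
by rewrite -[RHS]mul1r -(sgn_sq [set i]%SET [set j]%SET) mulrN -mulrA E mulrN1 opprK.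
Qed.

(** Anticommutativity makes the square equal to its opposite, and 2 is invertible. *)
Lemma covector_sq w : wedge (@covector R n w) (covector w) = 0.
Proof.
have : wedge (covector w) (covector w) = - wedge (covector w) (covector w).
  rewrite !covectorE [in LHS]wedge_suml [in RHS]wedge_sumr -sumrN.
  apply: eq_bigr => i _; rewrite !wedge_suml !wedge_sumr -sumrN; apply: eq_bigr => j _.
  by rewrite !(wedgeZl, wedgeZr) ebase1C !scalerN !scalerA mulrC.
move=> /eqP; rewrite -addr_eq0 -mulr2n => /eqP H; apply/ffunP => K.
move/ffunP: H => /(_ K); rewrite mulr2n !extE; lra.
Qed.

Lemma covectorC w u : wedge (@covector R n w) (covector u) = - wedge (covector u) (covector w).
Proof.
rewrite !covectorE [in LHS]wedge_suml [in RHS]wedge_sumr -sumrN.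
apply: eq_bigr => i _; rewrite !wedge_suml !wedge_sumr -sumrN; apply: eq_bigr => j _.
by rewrite !(wedgeZl, wedgeZr) ebase1C !scalerN !scalerA mulrC.
Qed.

Section Insertion.
Variable w : 'I_n -> 'I_n -> R.
Let W J : ext R n := \big[@wedge R n/ext1]_(j <- enum J) covector (w j).

(** The new factor has to pass the factors of smaller index, which gives the sign, and a repeated
    index kills the product. The covectors are arbitrary, so the rule covers both the monomials and
    their images under [ext_map]; comparing the two gives multiplicativity. *)
Lemma wedge_insert i J : wedge (covector (w i)) (W J) =
  if i \in J then 0 else sgn [set i]%SET J *: W (i |: J)%SET.
Proof.
have WE K : W K = \big[@wedge R n/ext1]_(j <- enum 'I_n | j \in K) covector (w j).
  by rewrite /W -[in RHS]big_filter enumT.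
rewrite !WE sgn1.
have -> : (\sum_(j in J) (j < i) = \sum_(j <- enum 'I_n | j \in J) (j < i))%N.
  by rewrite big_enum_cond.
have : i \in enum 'I_n by rewrite mem_enum.
have : sorted ltn (map val (enum 'I_n)) by rewrite val_enum_ord iota_ltn_sorted.
(* The induction follows the increasing list of all indices, filtered by membership in J: the
   covector stops at the head, skips it, or passes it with a change of sign. *)
elim: (enum 'I_n) => //= j r IH jr; rewrite inE.
have jlt k : k \in r -> (j < k)%N.
  move=> kr; move: jr; rewrite (path_sortedE ltn_trans) => /andP[/allP + _].
  by apply; exact: map_f.
have rs : sorted ltn (map val r) by exact: path_sorted jr.
rewrite !big_cons in_setU1; have [->|ij] /= := eqVneq i j.
  move=> _; rewrite ?eqxx /=; case: ifP => iJ; first by rewrite wedgeA covector_sq wedge0l.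
  rewrite [X in (-1) ^+ X]big1_seq => [|k /andP[_ kr]]; last by have := jlt k kr; lia.
  rewrite expr0 scale1r; congr wedge; rewrite big_seq_cond [RHS]big_seq_cond.
  apply: eq_bigl => k; rewrite in_setU1; case: eqP => // ->.
  by have [/jlt|//] := boolP (j \in r); rewrite ltnn.
move=> ir; case: ifP => jJ; last exact: IH.
have ->: (j < i)%N = true by exact: jlt.
rewrite wedgeA covectorC wedgeNl -wedgeA IH //.
by case: ifP => iJ; rewrite ?wedge0r ?oppr0 // wedgeZr exprD expr1 mulN1r scaleNr.
Qed.

End Insertion.

Lemma ext_mapD (A : 'M[R]_n) alpha beta : ext_map A (alpha + beta) = ext_map A alpha + ext_map A beta.
Proof. by rewrite /ext_map -big_split /=; apply: eq_bigr => J _; rewrite extE scalerDl. Qed.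
Lemma ext_mapZ (A : 'M[R]_n) a alpha : ext_map A (a *: alpha) = a *: ext_map A alpha.
Proof. by rewrite /ext_map scaler_sumr; apply: eq_bigr => J _; rewrite extE scalerA. Qed.
Lemma ext_map0 (A : 'M[R]_n) : ext_map A 0 = 0.
Proof. by have := ext_mapZ A 0 0; rewrite !scale0r. Qed.
Lemma ext_mapN (A : 'M[R]_n) alpha : ext_map A (- alpha) = - ext_map A alpha.
Proof. by rewrite -scaleN1r ext_mapZ scaleN1r. Qed.
Lemma ext_map_sum (A : 'M[R]_n) (T : Type) (r : seq T) (P : pred T) (F : T -> ext R n) :
  ext_map A (\sum_(t <- r | P t) F t) = \sum_(t <- r | P t) ext_map A (F t).
Proof. by apply: (big_morph (ext_map A)) => [a b|]; rewrite ?ext_mapD ?ext_map0. Qed.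

Lemma ext_map_ebase A J : ext_map A (ebase J) =
  \big[@wedge R n/ext1]_(j <- enum J) covector (fun i => A i j).
Proof.
rewrite /ext_map (bigD1 J) //= ebaseE eqxx scale1r [X in _ + X]big1 ?addr0 // => K KJ.
by rewrite ebaseE (negbTE KJ) scale0r.
Qed.

Lemma ext_map_ebase1 A i : ext_map A (ebase [set i]%SET) = covector (fun k => A k i).
Proof. by rewrite ext_map_ebase enum_set1 big_seq1. Qed.

Lemma ext_map_ext1 (A : 'M[R]_n) : ext_map A ext1 = ext1.
Proof. by rewrite -ebase0 ext_map_ebase enum_set0 big_nil ebase0. Qed.

Lemma ebaseU1 i J : i \notin J ->
  ebase (i |: J)%SET = sgn [set i]%SET J *: wedge (ebase [set i]%SET) (ebase J).
Proof. by move=> iJ; rewrite wedge_ebase1 (negbTE iJ) scalerA sgn_sq scale1r. Qed.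

(** Up to sign every monomial arises from [ext1] by wedging with one basis covector at a time, and
    the monomials span. *)
Lemma ext_ind (V : lmodType R) (F G : ext R n -> V)
  (FD : forall a b, F (a + b) = F a + F b) (FZ : forall c a, F (c *: a) = c *: F a)
  (GD : forall a b, G (a + b) = G a + G b) (GZ : forall c a, G (c *: a) = c *: G a) :
  F ext1 = G ext1 ->
  (forall i J, i \notin J -> F (ebase J) = G (ebase J) ->
     F (wedge (ebase [set i]%SET) (ebase J)) = G (wedge (ebase [set i]%SET) (ebase J))) ->
  forall alpha, F alpha = G alpha.
Proof.
move=> F1 FS alpha; have H J : F (ebase J) = G (ebase J).
  elim/set_ind: J => [|i J iJ IH]; first by rewrite ebase0.
  by rewrite ebaseU1 // FZ GZ FS.
have F0 : F 0 = 0 by have := FZ 0 0; rewrite !scale0r.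
have G0 : G 0 = 0 by have := GZ 0 0; rewrite !scale0r.
rewrite (ext_expand alpha) (big_morph F FD F0) (big_morph G GD G0).
by apply: eq_bigr => J _; rewrite FZ GZ H.
Qed.

Lemma ext_map_wedge1 A i beta : ext_map A (wedge (ebase [set i]%SET) beta) =
  wedge (ext_map A (ebase [set i]%SET)) (ext_map A beta).
Proof.
rewrite (ext_expand beta) wedge_sumr !ext_map_sum wedge_sumr; apply: eq_bigr => J _.
rewrite wedgeZr !ext_mapZ wedgeZr; congr (_ *: _).
rewrite ext_map_ebase1 [in RHS]ext_map_ebase (wedge_insert (fun j k => A k j)) wedge_ebase1.
by case: ifP => _; rewrite ?ext_map0 // ext_mapZ ext_map_ebase.
Qed.

Lemma ext_mapM A alpha beta : ext_map A (wedge alpha beta) = wedge (ext_map A alpha) (ext_map A beta).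
Proof.
apply: (@ext_ind _ (fun a => ext_map A (wedge a beta)) (fun a => wedge (ext_map A a) (ext_map A beta))).
- by move=> a b; rewrite wedgeDl ext_mapD.
- by move=> c a; rewrite wedgeZl ext_mapZ.
- by move=> a b; rewrite ext_mapD wedgeDl.
- by move=> c a; rewrite ext_mapZ wedgeZl.
- by rewrite ext_map_ext1 !wedge1l.
- by move=> i J iJ IH; rewrite -wedgeA (ext_map_wedge1 A i) IH (ext_map_wedge1 A i) wedgeA.
Qed.

Lemma ext_map_covector (A : 'M[R]_n) w : ext_map A (covector w) = covector (fun i => \sum_j A i j * w j).
Proof.
rewrite covectorE ext_map_sum; under eq_bigr do rewrite ext_mapZ ext_map_ebase1 covectorE scaler_sumr.
rewrite exchange_big covectorE /=; apply: eq_bigr => i _; rewrite scaler_suml.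
by apply: eq_bigr => j _; rewrite scalerA mulrC.
Qed.

Lemma ext_map_comp A B alpha : ext_map A (ext_map B alpha) = ext_map (A *m B) alpha.
Proof.
apply: (@ext_ind _ (fun a => ext_map A (ext_map B a)) (ext_map (A *m B))).
- by move=> a b; rewrite !ext_mapD.
- by move=> c a; rewrite !ext_mapZ.
- by move=> a b; rewrite !ext_mapD.
- by move=> c a; rewrite !ext_mapZ.
- by rewrite !ext_map_ext1.
- move=> i J iJ IH; rewrite !ext_mapM IH; congr wedge.
  rewrite !ext_map_ebase1 ext_map_covector; congr covector.
  by apply/funext => k; rewrite mxE.
Qed.

Lemma ext_map_id alpha : ext_map 1%:M alpha = alpha.
Proof.
apply: (@ext_ind _ (ext_map 1%:M) id) => //.
- by move=> a b; rewrite !ext_mapD.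
- by move=> c a; rewrite !ext_mapZ.
- exact: ext_map_ext1.
- move=> i J iJ IH; rewrite !ext_mapM IH; congr wedge.
  rewrite ext_map_ebase1 -covector1; congr covector.
  by apply/funext => k; rewrite mxE.
Qed.

Definition inner0 alpha beta : R := \sum_I alpha I * beta I.

Lemma inner0Dl a b c : inner0 (a + b) c = inner0 a c + inner0 b c.
Proof. by rewrite /inner0 -big_split /=; apply: eq_bigr => I _; rewrite extE mulrDl. Qed.
Lemma inner0Zl k a c : inner0 (k *: a) c = k * inner0 a c.
Proof. by rewrite /inner0 mulr_sumr; apply: eq_bigr => I _; rewrite extE mulrA. Qed.
Lemma inner0C a b : inner0 a b = inner0 b a.
Proof. by apply: eq_bigr => I _; rewrite mulrC. Qed.
Lemma inner0Zr k a c : inner0 c (k *: a) = k * inner0 c a.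
Proof. by rewrite inner0C inner0Zl inner0C. Qed.
Lemma inner0Dr a b c : inner0 c (a + b) = inner0 c a + inner0 c b.
Proof. by rewrite inner0C inner0Dl !(inner0C c). Qed.
Lemma inner0_sumr (T : Type) (r : seq T) (P : pred T) (F : T -> ext R n) a :
  inner0 a (\sum_(t <- r | P t) F t) = \sum_(t <- r | P t) inner0 a (F t).
Proof.
apply: (big_morph (inner0 a)) => [x y|]; first by rewrite inner0Dr.
by rewrite /inner0 big1 // => I _; rewrite extE mulr0.
Qed.
Lemma inner0_sum (T : Type) (r : seq T) (P : pred T) (F : T -> ext R n) a :
  inner0 (\sum_(t <- r | P t) F t) a = \sum_(t <- r | P t) inner0 (F t) a.
Proof. by rewrite inner0C inner0_sumr; apply: eq_bigr => i _; rewrite inner0C. Qed.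
Lemma inner0_ebase I b : inner0 (ebase I) b = b I.
Proof.
rewrite /inner0 (bigD1 I) //= ebaseE eqxx mul1r big1 ?addr0 // => J JI.
by rewrite ebaseE (negbTE JI) mul0r.
Qed.

(** The interior product with the i-th basis vector, in the form that makes it the adjoint of
    wedging with dx^i for [inner0]; see [inner0_contr]. *)
Definition contr (i : 'I_n) beta : ext R n :=
  [ffun I : {set 'I_n} => if i \in I then 0 else sgn [set i]%SET I * beta (i |: I)%SET].

Lemma contrD i a b : contr i (a + b) = contr i a + contr i b.
Proof. by apply/ffunP => I; rewrite !ffunE; case: ifP => _; rewrite ?addr0 ?mulrDr. Qed.
Lemma contrZ i c a : contr i (c *: a) = c *: contr i a.
Proof.
by apply/ffunP => I; rewrite extE !ffunE; case: ifP => _; rewrite ?mulr0 // mulrCA.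
Qed.
Lemma contr0 i : contr i 0 = 0.
Proof. by have := contrZ i 0 0; rewrite !scale0r. Qed.
Lemma contr_sum i (T : Type) (r : seq T) (P : pred T) (F : T -> ext R n) :
  contr i (\sum_(t <- r | P t) F t) = \sum_(t <- r | P t) contr i (F t).
Proof. by apply: (big_morph (contr i)) => [a b|]; rewrite ?contrD ?contr0. Qed.

Lemma inner0_contr i a b : inner0 (wedge (ebase [set i]%SET) a) b = inner0 a (contr i b).
Proof.
rewrite (ext_expand a) wedge_sumr !inner0_sum; apply: eq_bigr => I _.
rewrite wedgeZr !inner0Zl inner0_ebase wedge_ebase1 ffunE; congr (_ * _).
case: ifP => _; last by rewrite inner0Zl inner0_ebase.
by have := inner0Zl 0 0 b; rewrite scale0r mul0r.
Qed.

Lemma contr_ebase i K : contr i (ebase K) =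
  if i \in K then sgn [set i]%SET (K :\ i)%SET *: ebase (K :\ i)%SET else 0.
Proof.
apply/ffunP => I; rewrite ffunE ebaseE.
have [iI|iI] := boolP (i \in I).
  case: ifP => iK; rewrite extE // ebaseE; case: eqP => [E|_]; last by rewrite mulr0.
  by move: iI; rewrite E !inE eqxx.
case: ifP => iK; rewrite extE ?ebaseE; last first.
  by case: eqP => [E|_]; rewrite ?mulr0 //; move: iK; rewrite -E !inE eqxx.
have -> : (i |: I == K)%SET = (I == K :\ i)%SET.
  apply/eqP/eqP => [<-|->]; last exact: finset.setD1K.
  by rewrite setU1K.
by case: eqP => [->|]; rewrite ?mulr0.
Qed.

(** The antiderivation rule of the interior product, for a basis covector as first factor. *)
Lemma contr_wedge1 i j b : contr i (wedge (ebase [set j]%SET) b) =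
  (i == j)%:R *: b - wedge (ebase [set j]%SET) (contr i b).
Proof.
rewrite (ext_expand b) !(wedge_sumr, contr_sum) scaler_sumr -sumrB.
apply: eq_bigr => K _.
rewrite !(wedgeZr, contrZ) scalerA [_%:R * _]mulrC -scalerA -scalerBr; congr (_ *: _).
rewrite wedge_ebase1 contr_ebase.
have [<-|ij] := eqVneq i j.
  rewrite scale1r; have [iK|iK] := boolP (i \in K).
    rewrite contr0 wedgeZr wedge_ebase1 !inE eqxx /= scalerA sgn_sq scale1r.
    by rewrite finset.setD1K // subrr.
  by rewrite contrZ contr_ebase !inE eqxx /= setU1K // scalerA sgn_sq scale1r wedge0r subr0.
rewrite scale0r sub0r.
have [iK|iK] := boolP (i \in K); have [jK|jK] := boolP (j \in K).
- by rewrite contr0 wedgeZr wedge_ebase1 !inE eq_sym ij jK /= scaler0 oppr0.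
- rewrite contrZ contr_ebase !inE (negbTE ij) iK /= wedgeZr wedge_ebase1 !inE (negbTE jK) andbF.
  have E : ((j |: K) :\ i = j |: (K :\ i))%SET.
    apply/setP => k; rewrite !inE; have [->|] //= := eqVneq k j; by rewrite eq_sym ij.
  rewrite E !scalerA -scaleNr; congr (_ *: _).
  rewrite -{1}(finset.setD1K iK) !sgnUr ?disjoints1 ?inE ?eqxx ?(negbTE jK) ?andbF //.
  have := @sgnC [set i]%SET [set j]%SET; rewrite disjoints1 inE ij => /(_ isT).
  rewrite !cards1 expr1 => S.
  transitivity (sgn [set i]%SET [set j]%SET * sgn [set j]%SET [set i]%SET *
     (sgn [set i]%SET (K :\ i)%SET * sgn [set j]%SET (K :\ i)%SET)); first by ring.
  by rewrite S mulN1r.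
- by rewrite contr0 wedge0r oppr0.
- by rewrite contrZ contr_ebase !inE (negbTE ij) (negbTE iK) /= scaler0 wedge0r oppr0.
Qed.

Lemma contr_covector i u b : contr i (wedge (covector u) b) = u i *: b - wedge (covector u) (contr i b).
Proof.
rewrite !covectorE !wedge_suml contr_sum.
under eq_bigr do rewrite wedgeZl contrZ contr_wedge1 scalerBr scalerA.
rewrite sumrB (bigD1 i) //= eqxx mulr1 big1 ?addr0 => [|j ji]; last first.
  by rewrite eq_sym (negbTE ji) mulr0 scale0r.
by congr (_ - _); apply: eq_bigr => j _; rewrite wedgeZl.
Qed.

(** Naturality: contracting a pullback with a vector amounts to contracting with the image vector
    before pulling back. *)
Lemma contr_ext_map (A : 'M[R]_n) i b :
  contr i (ext_map A^T b) = ext_map A^T (\sum_k A k i *: contr k b).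
Proof.
have c1 k : contr k ext1 = 0 by rewrite -ebase0 contr_ebase inE.
pose D x := \sum_k A k i *: contr k x.
have DD a c : D (a + c) = D a + D c.
  by rewrite /D -big_split /=; apply: eq_bigr => k _; rewrite contrD scalerDr.
have DZ k a : D (k *: a) = k *: D a.
  by rewrite /D scaler_sumr; apply: eq_bigr => j _; rewrite contrZ !scalerA mulrC.
apply: (@ext_ind _ (fun b => contr i (ext_map A^T b)) (fun b => ext_map A^T (D b))).
- by move=> x y; rewrite ext_mapD contrD.
- by move=> c x; rewrite ext_mapZ contrZ.
- by move=> x y; rewrite DD ext_mapD.
- by move=> c x; rewrite DZ ext_mapZ.
- by rewrite /D big1 ?ext_map0 ?ext_map_ext1 // => k _; rewrite c1 scaler0.
- move=> j J jJ IH; rewrite ext_mapM ext_map_ebase1 contr_covector mxE IH.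
  rewrite {2}/D; under eq_bigr do rewrite contr_wedge1 scalerBr scalerA.
  rewrite sumrB (bigD1 j) //= eqxx mulr1 big1 ?addr0 => [|k kj]; last first.
    by rewrite (negbTE kj) mulr0 scale0r.
  rewrite ext_mapD ext_mapN ext_mapZ; congr (_ - _).
  rewrite -ext_map_ebase1 -ext_mapM /D wedge_sumr; congr ext_map.
  by apply: eq_bigr => k _; rewrite wedgeZr.
Qed.

Lemma wedge_set0 a b : (wedge a b : ext R n) finset.set0 = a finset.set0 * b finset.set0.
Proof.
rewrite wedgeE (bigD1 finset.set0) ?finset.sub0set //= big1 ?addr0 => [|I /andP[]].
  by rewrite finset.setD0 sgn0l mul1r.
by rewrite finset.subset0 => ->.
Qed.

Lemma covector_set0 w : (covector w : ext R n) finset.set0 = 0.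
Proof.
rewrite covectorE extE big1 // => i _; rewrite extE ebaseE.
case: eqP => [E|]; last by rewrite mulr0.
by have := finset.set11 i; rewrite -E inE.
Qed.

Lemma ext_map_set0 (A : 'M[R]_n) b : (ext_map A b) finset.set0 = b finset.set0.
Proof.
apply: (@ext_ind R^o (fun b => ext_map A b finset.set0) (fun b => b finset.set0)).
- by move=> x y; rewrite ext_mapD extE.
- by move=> c x; rewrite ext_mapZ extE.
- by move=> x y; rewrite extE.
- by move=> c x; rewrite extE.
- by rewrite ext_map_ext1.
- move=> i J iJ IH; rewrite ext_mapM !wedge_set0 IH ext_map_ebase1 covector_set0.
  by rewrite -covector1 covector_set0.
Qed.

(** In coordinates this says that the minors of the transpose are the transposed minors.
    Determinants are not expanded: one covector at a time crosses to the other side as a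
    contraction, where naturality applies. *)
Lemma ext_map_adj (A : 'M[R]_n) a b : inner0 (ext_map A a) b = inner0 a (ext_map A^T b).
Proof.
have H J : forall b, inner0 (ext_map A (ebase J)) b = inner0 (ebase J) (ext_map A^T b).
  elim/set_ind: J => [|i J iJ IH] c.
    by rewrite ebase0 ext_map_ext1 -ebase0 !inner0_ebase ext_map_set0.
  rewrite ebaseU1 // ext_mapZ !inner0Zl; congr (_ * _).
  rewrite ext_mapM ext_map_ebase1 covectorE wedge_suml inner0_sum.
  rewrite inner0_contr contr_ext_map ext_map_sum inner0_sumr; apply: eq_bigr => k _.
  by rewrite wedgeZl inner0Zl inner0_contr IH ext_mapZ inner0Zr.
rewrite (ext_expand a) ext_map_sum !inner0_sum; apply: eq_bigr => J _.
by rewrite ext_mapZ !inner0Zl H.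
Qed.

Lemma degree_ebase I : has_degree #|I| (ebase I).
Proof. by move=> J Jp; rewrite ebaseE; case: eqP => // JI; move: Jp; rewrite JI eqxx. Qed.

Lemma degreeZ p c a : has_degree p a -> has_degree p (c *: a : ext R n).
Proof. by move=> pa I /pa aI; rewrite extE aI mulr0. Qed.

Lemma degreeD p a b : has_degree p a -> has_degree p b -> has_degree p (a + b : ext R n).
Proof. by move=> pa pb I Ip; rewrite extE pa // pb // addr0. Qed.

Lemma degree_sum p (T : Type) (r : seq T) (P : pred T) (F : T -> ext R n) :
  (forall t, P t -> has_degree p (F t)) -> has_degree p (\sum_(t <- r | P t) F t).
Proof. by move=> pF I Ip; rewrite extE big1 // => t Pt; rewrite pF. Qed.

Lemma degree_covector w : has_degree 1 (covector w : ext R n).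
Proof.
rewrite covectorE; apply: degree_sum => i _; apply: degreeZ.
by rewrite -(cards1 i); exact: degree_ebase.
Qed.

Lemma degree_wedge p q a b : has_degree p a -> has_degree q b ->
  has_degree (p + q) (wedge a b : ext R n).
Proof.
move=> pa qb K Kpq; rewrite wedgeE big1 // => I IK.
have [Ip|/pa->] := eqVneq #|I| p; last by rewrite mul0r mulr0.
have [Jq|/qb->] := eqVneq #|(K :\: I)%SET| q; last by rewrite !mulr0.
by move: Kpq; rewrite -Ip -Jq -(cardsID I K) (finset.setIidPr IK) eqxx.
Qed.

Lemma degree_map p (A : 'M[R]_n) a : has_degree p a -> has_degree p (ext_map A a).
Proof.
move=> pa; rewrite (ext_expand a) ext_map_sum; apply: degree_sum => J _.
rewrite ext_mapZ; have [<-|/pa->] := eqVneq #|J| p; last by rewrite scale0r => I _; rewrite extE.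
apply: degreeZ; elim/set_ind: J => [|i J iJ IH].
  by rewrite ebase0 ext_map_ext1 -ebase0; exact: degree_ebase.
rewrite ebaseU1 // ext_mapZ ext_mapM cardsU1 iJ ext_map_ebase1; apply: degreeZ.
by apply: degree_wedge => //; exact: degree_covector.
Qed.

Lemma card_neq_top I : I != finset.setT -> #|I| != n.
Proof.
by apply: contraNN => /eqP In; rewrite eqEcard finset.subsetT cardsT card_ord In leqnn.
Qed.

Lemma ext_top a : has_degree n a -> a = a finset.setT *: ebase finset.setT.
Proof.
move=> na; apply/ffunP => I; rewrite extE ebaseE; case: eqP => [->|/eqP In]; first by rewrite mulr1.
by rewrite mulr0 na // card_neq_top.
Qed.

Lemma degree_top : has_degree n (ebase finset.setT).
Proof. by move=> I Ip; rewrite ebaseE; case: eqP => // E; move: Ip; rewrite E cardsT card_ord eqxx. Qed.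

(** The determinant as the factor by which the top degree is scaled, so that multiplicativity is the
    functoriality of [ext_map]. It is matched with [\det] only on triangular and permutation
    matrices. *)
Definition edet (A : 'M[R]_n) : R := ext_map A (ebase finset.setT) finset.setT.

Lemma ext_map_top A : ext_map A (ebase finset.setT) = edet A *: ebase finset.setT.
Proof. by apply: ext_top; apply: degree_map; exact: degree_top. Qed.

Lemma edetM A B : edet (A *m B) = edet A * edet B.
Proof. by rewrite {1}/edet -ext_map_comp ext_map_top ext_mapZ extE mulrC. Qed.

Lemma edetT A : edet A^T = edet A.
Proof. by rewrite /edet -[RHS]inner0_ebase inner0C ext_map_adj inner0_ebase. Qed.

Lemma edet_trig (A : 'M[R]_n) : (forall i j : 'I_n, (i < j)%N -> A i j = 0) -> edet A = \prod_i A i i.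
Proof.
move=> A0; rewrite /edet ext_map_ebase.
have -> : enum (finset.setT : {set 'I_n}) = enum 'I_n by apply: eq_enum => i; rewrite inE.
(* Here r is a final segment of the indices. The covector of its head j has only terms dx^i with i
   >= j, and those with i > j already occur in the wedge over the tail, so the diagonal entry alone
   survives. *)
have H (r : seq 'I_n) : sorted ltn (map val r) ->
    (forall j i : 'I_n, j \in r -> (j < i)%N -> i \in r) ->
    \big[@wedge R n/ext1]_(j <- r) covector (fun i => A i j) =
    (\prod_(j <- r) A j j) *: ebase [set j in r]%SET.
  elim: r => [|j r IH] jr up.
    rewrite !big_nil scale1r -ebase0; congr ebase; apply/setP => i; by rewrite !inE.
  have jlt k : k \in r -> (j < k)%N.
    move=> kr; move: jr => /=; rewrite (path_sortedE ltn_trans) => /andP[/allP + _].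
    by apply; exact: map_f.
  rewrite !big_cons IH; last 2 first.
  - exact: path_sorted jr.
  - move=> k i kr ki; have := up k i; rewrite !inE kr orbT => /(_ isT ki).
    by case: eqP => // ij; have := jlt k kr; rewrite -ij; lia.
  rewrite wedgeZr covectorE wedge_suml (bigD1 j) //= [X in _ + X]big1 ?addr0 => [|i ij]; last first.
    rewrite wedgeZl wedge_ebase1 inE; have [ji|ij'] := ltnP j i.
      by have := up j i; rewrite !inE eqxx (negbTE ij) /= => ->; rewrite ?scaler0.
    by rewrite A0 ?scale0r // ltn_neqAle ij' andbT.
  rewrite wedgeZl wedge_ebase1 inE ifF; last by apply: contraFF (ltnn j) => /jlt.
  rewrite sgn1 [X in (-1) ^+ X]big1 ?expr0 ?scale1r => [|k]; last by rewrite inE => /jlt; lia.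
  rewrite scalerA mulrC; congr (_ *: ebase _); apply/setP => k; by rewrite !inE.
rewrite H.
- rewrite big_enum extE ebaseE; case: eqP => [_|]; first by rewrite mulr1.
  by case; apply/setP => k; rewrite !inE mem_enum.
- by rewrite val_enum_ord iota_ltn_sorted.
- by move=> j i; rewrite !mem_enum.
Qed.

Lemma edet1 : edet 1%:M = 1.
Proof. by rewrite /edet ext_map_id ebaseE eqxx. Qed.

Lemma edet_tperm i j : i != j -> edet (perm_mx (tperm i j)) = -1.
Proof.
move=> ij; pose J : {set 'I_n} := (~: [set i; j])%SET.
have jJ : j \notin J by rewrite !inE eqxx orbT.
have iJ : i \notin (j |: J)%SET by rewrite !inE eqxx (negbTE ij).
have ET : finset.setT = (i |: (j |: J))%SET.
  by apply/setP => k; rewrite !inE; case: (k == i); case: (k == j).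
have P1 k : ext_map (perm_mx (tperm i j)) (ebase [set k]%SET) = ebase [set (tperm i j k)]%SET.
  rewrite ext_map_ebase1 -covector1; congr covector; apply/funext => l; rewrite !mxE.
  by congr (_%:R); rewrite -[k in LHS](tpermK i j) (inj_eq perm_inj).
have PJ : ext_map (perm_mx (tperm i j)) (ebase J) = ebase J.
  rewrite -[RHS]ext_map_id !ext_map_ebase; apply: eq_big_seq => k.
  rewrite mem_enum !inE negb_or => /andP[ki kj].
  by rewrite -!ext_map_ebase1 P1 ext_map_id tpermD // eq_sym.
have E : ext_map (perm_mx (tperm i j)) (ebase finset.setT) = - ebase finset.setT.
  rewrite ET !ebaseU1 // wedgeZr !ext_mapZ !ext_mapM PJ !P1 tpermL tpermR.
  by rewrite wedgeA ebase1C wedgeNl wedgeA !scalerN.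
by rewrite /edet E extE ebaseE eqxx.
Qed.

Lemma edet_perm s : edet (perm_mx s) = (-1) ^+ s.
Proof.
have [ts -> ] := prod_tpermP s => /allP dts.
elim: ts dts => [|t ts IH] dts; first by rewrite big_nil perm_mx1 edet1 odd_perm1.
rewrite big_cons perm_mxM edetM IH => [|u ut]; last by apply: dts; rewrite inE ut orbT.
have tt : t.1 != t.2 by apply: dts; rewrite inE eqxx.
by rewrite edet_tperm // odd_mul_tperm tt signr_addb expr1.
Qed.

End ExtAlg.

(** An LUP factorisation reduces the comparison to the factors; dimension 0, where the factorisation
    is not defined, is checked by hand. *)
Lemma edetE (R : realType) n (A : 'M[R]_n) : edet A = \det A.
Proof.
case: n A => [|n] A.
  rewrite det_mx00 /edet; have -> : (finset.setT : {set 'I_0}) = finset.set0.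
    by apply/setP => -[].
  by rewrite ebase0 ext_map_ext1 -ebase0 ebaseE eqxx.
have := cormen_lup_correct A; have := cormen_lup_perm A.
have := cormen_lup_lower A; have := cormen_lup_upper A.
case: (cormen_lup A) => [[P L] U] /= Uu Ll /is_perm_mxP[s ->] PA.
have edU : edet U = \det U.
  rewrite -edetT -det_tr det_trig; last by apply/is_trig_mxP => i j ij; rewrite mxE Uu.
  by apply: edet_trig => i j ij; rewrite mxE Uu.
have edL : edet L = \det L.
  have L0 (i j : 'I_n.+1) : (i < j)%N -> L i j = 0.
    by move=> ij; rewrite Ll ?(ltnW ij) // -val_eqE /= ltn_eqF.
  by rewrite det_trig ?edet_trig //; apply/is_trig_mxP.
have := congr1 (@edet R n.+1) PA; have := congr1 determinant PA.
rewrite !edetM !det_mulmx edU edL edet_perm det_perm => <- /eqP.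
by rewrite (inj_eq (mulfI _)) ?signr_eq0 // => /eqP.
Qed.

(** * The Hodge operator and signs *)

Section Star.
Variables (R : realType) (n : nat).
Implicit Types (a b x y : ext R n) (I J K : {set 'I_n}).
Local Notation sgn := (@shuffle_sign R n).

(** [hat], [tilde] and the sign of star o star are all of this kind, so that identities between them
    become identities between functions of the degree. *)
Definition dscale (f : nat -> R) a : ext R n := [ffun K : {set 'I_n} => f #|K| * a K].

Lemma dscaleE f a K : dscale f a K = f #|K| * a K. Proof. by rewrite ffunE. Qed.
Opaque dscale.
Lemma dscaleD f a b : dscale f (a + b) = dscale f a + dscale f b.
Proof. by apply/ffunP => K; rewrite extE !dscaleE extE mulrDr. Qed.
Lemma dscaleZ f c a : dscale f (c *: a) = c *: dscale f a.
Proof. by apply/ffunP => K; rewrite [in RHS]extZ !dscaleE mulrCA. Qed.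
Lemma dscale_sum f (T : Type) (r : seq T) (P : pred T) (F : T -> ext R n) :
  dscale f (\sum_(t <- r | P t) F t) = \sum_(t <- r | P t) dscale f (F t).
Proof.
apply: (big_morph (dscale f)) => [x y|]; first exact: dscaleD.
by apply/ffunP => K; rewrite dscaleE !extE mulr0.
Qed.
Lemma dscale_comp f g a : dscale f (dscale g a) = dscale (fun p => f p * g p) a.
Proof. by apply/ffunP => K; rewrite !dscaleE mulrA. Qed.
Lemma dscale1 a : dscale (fun=> 1) a = a.
Proof. by apply/ffunP => K; rewrite !dscaleE mul1r. Qed.
Lemma dscale_cst c a : dscale (fun=> c) a = c *: a.
Proof. by apply/ffunP => K; rewrite [in RHS]extZ dscaleE. Qed.
Lemma dscale_degree f p a : has_degree p a -> dscale f a = f p *: a.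
Proof.
move=> pa; apply/ffunP => K; rewrite extE dscaleE.
by have [->//|/pa->] := eqVneq #|K| p; rewrite !mulr0.
Qed.
Lemma eq_dscale f g a : (forall p, (p <= n)%N -> f p = g p) -> dscale f a = dscale g a.
Proof.
by move=> fg; apply/ffunP => K; rewrite !dscaleE fg // -[X in (_ <= X)%N]card_ord max_card.
Qed.
Lemma eq_dscale_parity f g c a : has_parity c a ->
  (forall p, (p <= n)%N -> odd p = c -> f p = g p) -> dscale f a = dscale g a.
Proof.
move=> ca fg; apply/ffunP => K; rewrite !dscaleE.
have [Kc|/ca->] := eqVneq (odd #|K|) c; last by rewrite !mulr0.
by rewrite fg // -[X in (_ <= X)%N]card_ord max_card.
Qed.

Lemma ext_map_dscale f (A : 'M[R]_n) a : ext_map A (dscale f a) = dscale f (ext_map A a).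
Proof.
rewrite (ext_expand a) dscale_sum !ext_map_sum dscale_sum; apply: eq_bigr => J _.
rewrite dscaleZ !ext_mapZ dscaleZ (dscale_degree f (@degree_ebase R n J)).
by rewrite ext_mapZ (dscale_degree f (degree_map A (@degree_ebase R n J))).
Qed.

Lemma hatE a : hat a = dscale (fun p => (-1) ^+ (p * p.+1)./2) a.
Proof. by apply/ffunP => K; rewrite !ffunE. Qed.
Lemma tildeE a : tilde a = dscale (fun p => (-1) ^+ p) a.
Proof. by apply/ffunP => K; rewrite !ffunE. Qed.

Lemma hatK a : hat (hat a) = a.
Proof.
rewrite !hatE dscale_comp -[RHS]dscale1; apply: eq_dscale => p _.
by rewrite -expr2 sqrr_sign.
Qed.
Lemma tildeK a : tilde (tilde a) = a.
Proof.
rewrite !tildeE dscale_comp -[RHS]dscale1; apply: eq_dscale => p _.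
by rewrite -expr2 sqrr_sign.
Qed.

Lemma dscale_wedge f p u a : has_degree p u ->
  dscale f (wedge u a) = wedge u (dscale (fun q => f (p + q)%N) a).
Proof.
move=> pu; apply/ffunP => K; rewrite dscaleE !wedgeE mulr_sumr; apply: eq_bigr => I IK.
rewrite dscaleE; have [<-|/pu->] := eqVneq #|I| p; last by rewrite !mul0r !mulr0.
by rewrite -{1}(cardsID I K) (finset.setIidPr IK); ring.
Qed.

Lemma wedgeC p u a : has_degree p u ->
  wedge a u = wedge u (dscale (fun q => (-1) ^+ (p * q)) a).
Proof.
move=> pu; rewrite (ext_expand a) dscale_sum wedge_suml wedge_sumr; apply: eq_bigr => I _.
rewrite dscaleZ wedgeZl wedgeZr (dscale_degree _ (@degree_ebase R n I)) wedgeZr.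
congr (_ *: _); rewrite (ext_expand u) wedge_sumr wedge_suml scaler_sumr.
apply: eq_bigr => J _; rewrite wedgeZl wedgeZr.
have [<-|/pu->] := eqVneq #|J| p; last by rewrite !scale0r scaler0.
rewrite !wedge_ebase [[disjoint J & I]%B]disjoint_sym; case: ifP => IJ; last by rewrite !scaler0.
rewrite !scalerA finset.setUC; congr (_ *: _).
rewrite -(@sgnC R n J I) 1?disjoint_sym //.
transitivity (u J * sgn I J * (sgn J I * sgn J I)); first by rewrite sgn_sq mulr1.
by ring.
Qed.

Lemma top_map (A : 'M[R]_n) a : ext_map A a finset.setT = \det A * a finset.setT.
Proof.
have aT : a finset.setT = \sum_J a J * ebase R J finset.setT.
  by rewrite {1}(ext_expand a) ext_sum; apply: eq_bigr => J _; rewrite extZ.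
rewrite aT {1}(ext_expand a) ext_map_sum ext_sum mulr_sumr; apply: eq_bigr => J _.
rewrite ext_mapZ extZ mulrCA; congr (_ * _).
have [->|JT] := eqVneq J finset.setT.
  by rewrite ext_map_top extZ ebaseE eqxx mulr1 edetE mulr1.
rewrite ebaseE eq_sym (negbTE JT) mulr0.
by rewrite (degree_map A (@degree_ebase R n J)) // cardsT card_ord eq_sym card_neq_top.
Qed.

(** The Hodge operator of the Euclidean metric, to which [hodgeE] reduces the general one. *)
Definition star b : ext R n := [ffun K : {set 'I_n} => sgn (~: K)%SET K * b (~: K)%SET].

Lemma starE b K : star b K = sgn (~: K)%SET K * b (~: K)%SET.
Proof. by rewrite ffunE. Qed.
Lemma starZ c b : star (c *: b) = c *: star b.
Proof. by apply/ffunP => K; rewrite extE !starE extE mulrCA. Qed.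

Lemma hodgeE (g : 'M[R]_n) b : hodge g b = Num.sqrt (\det g) *: star (ext_map (invmx g) b).
Proof. by apply/ffunP => K; rewrite extE !ffunE. Qed.

Lemma wedge_top a b : wedge a b finset.setT = \sum_I sgn I (~: I)%SET * (a I * b (~: I)%SET).
Proof.
rewrite wedgeE (eq_bigl xpredT) => [|I]; last by rewrite finset.subsetT.
by apply: eq_bigr => I _; rewrite finset.setTD.
Qed.

Lemma wedge_star_top a b : wedge a (star b) finset.setT = inner0 a b.
Proof.
rewrite wedge_top; apply: eq_bigr => I _.
rewrite starE finset.setCK; transitivity (sgn I (~: I)%SET * sgn I (~: I)%SET * (a I * b I)).
  by ring.
by rewrite sgn_sq mul1r.
Qed.

Lemma wedge_top_nondeg x y :
  (forall a, wedge a x finset.setT = wedge a y finset.setT) -> x = y.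
Proof.
move=> xy; apply/ffunP => K; have := xy (ebase R (~: K)%SET).
have H z : wedge (ebase R (~: K)%SET) z finset.setT = sgn (~: K)%SET K * z K.
  rewrite wedge_top (bigD1 (~: K)%SET) //= big1 ?addr0 => [|J JK].
    by rewrite ebaseE eqxx finset.setCK mul1r.
  by rewrite ebaseE (negbTE JK) mul0r mulr0.
rewrite !H => /(congr1 (fun z => sgn (~: K)%SET K * z)).
by rewrite !mulrA sgn_sq !mul1r.
Qed.

(** Tested against a form, [star] becomes [inner0], where A can be moved to the other argument; a
    top form pulled back by A then produces the determinant. *)
Lemma star_map (A : 'M[R]_n) b : A \in unitmx ->
  star (ext_map A^T b) = \det A *: ext_map (invmx A) (star b).
Proof.
move=> uA; apply: wedge_top_nondeg => a.
rewrite wedge_star_top -ext_map_adj -wedge_star_top wedgeZr extE.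
by rewrite -{1}[star b](ext_map_id) -(mulmxV uA) -ext_map_comp -ext_mapM top_map.
Qed.

(** The volume factor contributes the absolute value of det J, while [star_map] contributes the
    inverse of det J. They cancel because det J is positive: this is how the orientation makes the
    Hodge operator global. *)
Lemma hodge_map (J g g' : 'M[R]_n) b : 0 < \det J -> g' \in unitmx ->
  g = J *m g' *m J^T ->
  hodge g (ext_map J b) = ext_map J (hodge g' b).
Proof.
move=> J0 ug' gE.
have uJ : J \in unitmx by rewrite unitmxE unitfE gt_eqF.
have uJi : invmx J \in unitmx by rewrite unitmx_inv.
have iE : invmx g = (invmx J)^T *m (invmx g' *m invmx J).
  have ug : g \in unitmx by rewrite gE !unitmx_mul uJ ug' unitmx_tr uJ.
  apply: (can_inj (mulKmx ug)); rewrite mulmxV // gE trmx_inv !mulmxA mulmxK ?unitmx_tr //.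
  by rewrite mulmxK // mulmxV.
have E : ext_map (invmx g) (ext_map J b) = ext_map (invmx J)^T (ext_map (invmx g') b).
  by rewrite iE !ext_map_comp -!mulmxA mulVmx // mulmx1.
rewrite !hodgeE E star_map // invmxK det_inv.
rewrite ext_mapZ scalerA; congr (_ *: _).
rewrite gE !det_mulmx det_tr mulrAC -expr2 sqrtrM ?sqr_ge0 // sqrtr_sqr gtr0_norm //.
by rewrite mulrAC divff ?mul1r // gt_eqF.
Qed.

Definition star_sign p : R := (-1) ^+ (p * (n - p)).

Lemma cardsC_ord K : #|(~: K)%SET| = (n - #|K|)%N.
Proof. by rewrite cardsCs finset.setCK card_ord. Qed.

Lemma sgnCK K : sgn (~: K)%SET K * sgn K (~: K)%SET = star_sign #|K|.
Proof.
rewrite mulrC sgnC ?cardsC_ord // -setI_eq0 finset.setICr //.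
Qed.

Lemma starK b : star (star b) = dscale star_sign b.
Proof.
by apply/ffunP => K; rewrite dscaleE !starE finset.setCK mulrA sgnCK.
Qed.

Lemma hodgeK (g : 'M[R]_n) b : g^T = g -> 0 < \det g ->
  hodge g (hodge g b) = dscale star_sign b.
Proof.
move=> gT g0; have ug : g \in unitmx by rewrite unitmxE unitfE gt_eqF.
rewrite !hodgeE ext_mapZ starZ scalerA -expr2 sqr_sqrtr ?(ltW g0) //.
have E : invmx g = (invmx g)^T by rewrite trmx_inv gT.
rewrite {1}E star_map ?unitmx_inv // invmxK starK scalerA det_inv divff ?gt_eqF // scale1r.
by rewrite ext_map_dscale ext_map_comp mulmxV // ext_map_id.
Qed.

Lemma hodge_dscale f (g : 'M[R]_n) b :
  hodge g (dscale f b) = dscale (fun p => f (n - p)%N) (hodge g b).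
Proof.
rewrite !hodgeE ext_map_dscale dscaleZ; congr (_ *: _).
by apply/ffunP => K; rewrite dscaleE !starE dscaleE cardsC_ord mulrCA.
Qed.

Lemma hodgeD (g : 'M[R]_n) a b : hodge g (a + b) = hodge g a + hodge g b.
Proof.
rewrite !hodgeE ext_mapD -scalerDr; congr (_ *: _).
by apply/ffunP => K; rewrite extE !starE extE mulrDr.
Qed.
Lemma hodgeZ (g : 'M[R]_n) c a : hodge g (c *: a) = c *: hodge g a.
Proof. by rewrite !hodgeE ext_mapZ starZ !scalerA mulrC. Qed.

(** Apart from a sign depending only on the degree this is the metric induced on forms, whose
    symmetry yields that of the inner product on spinors in [hodge_wedge_sym]. *)
Lemma hodge_wedge_top (g : 'M[R]_n) a b :
  wedge (hodge g a) b finset.setT =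
  Num.sqrt (\det g) * inner0 (ext_map (invmx g) a) (dscale star_sign b).
Proof.
rewrite hodgeE wedgeZl extE; congr (_ * _).
rewrite wedge_top (reindex_inj (can_inj (@finset.setCK _))) /=; apply: eq_bigr => K _.
rewrite starE !finset.setCK dscaleE -sgnCK.
by ring.
Qed.

Lemma hodge_wedge_sym (g : 'M[R]_n) a b : g^T = g ->
  wedge (hodge g a) b finset.setT = wedge (hodge g b) a finset.setT.
Proof.
move=> gT; rewrite !hodge_wedge_top; congr (_ * _).
rewrite ext_map_adj trmx_inv gT ext_map_dscale inner0C.
by rewrite /inner0; apply: eq_bigr => K _; rewrite !dscaleE; ring.
Qed.

Lemma inner0_ge0 a : 0 <= inner0 a a.
Proof. by apply: sumr_ge0 => I _; rewrite -expr2 sqr_ge0. Qed.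
Lemma inner0_eq0 a : inner0 a a = 0 -> a = 0.
Proof.
move=> H; apply/ffunP => I; rewrite extE; apply/eqP; rewrite -sqrf_eq0 expr2.
move/eqP: H; rewrite psumr_eq0 => [/allP/(_ I)|J _]; last by rewrite -expr2 sqr_ge0.
by rewrite mem_index_enum => /(_ isT).
Qed.

Definition posdef m (g : 'M[R]_m) : Prop :=
  forall v : 'rV[R]_m, v != 0 -> 0 < (v *m g *m v^T) 0 0.

End Star.

(** The factorisation turns the metric induced on forms into a sum of squares. Induction on the
    size: with the first diagonal entry a split off, the Schur complement h - v v^T / a is again
    positive definite. *)
Lemma cholesky (R : realType) n (g : 'M[R]_n) : g^T = g -> posdef g ->
  exists2 B : 'M[R]_n, B \in unitmx & g = B *m B^T.
Proof.
elim: n g => [|n IH] g gT gp.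
  by exists 1%:M; [exact: unitmx1|apply/matrixP => -[]].
pose g' : 'M[R]_(1 + n) := g.
pose a := g' 0 0; pose v : 'cV[R]_n := dlsubmx g'; pose h : 'M[R]_n := drsubmx g'.
have gb : g' = block_mx (a%:M : 'M[R]_1) v^T v h.
  rewrite -[LHS]submxK; congr block_mx.
    by apply/matrixP => i j; rewrite !ord1 !mxE /= mulr1n; congr (g' _ _); apply/val_inj.
  by rewrite trmx_dlsub /g' gT.
have quad (x : R) (w : 'rV[R]_n) :
    (row_mx (x%:M : 'M[R]_1) w *m g' *m (row_mx (x%:M : 'M[R]_1) w)^T) 0 0 =
    a * x ^+ 2 + 2 * x * (w *m v) 0 0 + (w *m h *m w^T) 0 0.
  rewrite gb mul_row_block tr_row_mx mul_row_col tr_scalar_mx !mulmxDl.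
  have E1 : v^T *m w^T = (w *m v)^T by rewrite trmx_mul.
  rewrite -!mulmxA E1 !mul_scalar_mx !mul_mx_scalar !mxE eqxx !mulr1n.
  have -> : \sum_j w 0 j * (x *: v) j 0 = x * \sum_j w 0 j * v j 0.
    by rewrite mulr_sumr; apply: eq_bigr => j _; rewrite mxE mulrCA.
  by ring.
have gp' : posdef g' by exact: gp.
have a0 : 0 < a.
  have := gp' (row_mx (1%:M : 'M[R]_1) (0 : 'rV[R]_n)); rewrite quad !mul0mx !mxE; rewrite expr1n mulr1 !mulr0 !addr0; apply.
  apply/eqP => /(congr1 (fun M : 'rV[R]_(1 + n) => M 0 (lshift n 0))).
  by rewrite row_mxEl !mxE eqxx => /eqP; rewrite oner_eq0.
have hT : h^T = h by rewrite trmx_drsub /g' gT.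
have a_neq0 : a != 0 by rewrite gt_eqF.
have [|w w0|B' uB' hE] := IH (h - a^-1 *: (v *m v^T)).
- by rewrite linearB /= linearZ /= trmx_mul trmxK hT.
(* For fixed w the quadratic form is minimal at the first coordinate -(w v) / a, and its value there
   is that of the Schur complement at w. *)
- have := gp' (row_mx ((- (w *m v) 0 0 / a)%:M : 'M[R]_1) w); rewrite quad.
  rewrite (_ : _ + _ = (w *m (h - a^-1 *: (v *m v^T)) *m w^T) 0 0).
    apply; apply: contraNneq w0 => /(congr1 (fun M : 'rV[R]_(1 + n) => rsubmx M)).
    by rewrite row_mxKr => ->; rewrite linear0.
  rewrite mulmxBr mulmxBl -scalemxAr -scalemxAl.
  have E1 : v^T *m w^T = (w *m v)^T by rewrite trmx_mul.
  rewrite -!mulmxA E1 !mulmxA [in RHS]mxE [(- _ : 'M[R]_1) 0 0]mxE [(a^-1 *: _ : 'M[R]_1) 0 0]mxE.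
  have -> : ((w *m v) *m (w *m v)^T) 0 0 = (w *m v) 0 0 ^+ 2.
    by move: (w *m v) => M; rewrite mxE big_ord1 mxE expr2.
  by field.
- pose s := Num.sqrt a; have s0 : s != 0 by rewrite sqrtr_eq0 -ltNge.
  have ss : s * s = a by rewrite -expr2 sqr_sqrtr // ltW.
  pose B : 'M[R]_(1 + n) := block_mx (s%:M : 'M[R]_1) 0 (s^-1 *: v) B'.
  exists B.
    have dB : \det B = s * \det B' by rewrite /B det_lblock det_scalar1.
    by rewrite unitmxE dB unitrM unitfE s0 -unitmxE.
  suff E : g' = B *m B^T by exact: E.
  rewrite gb /B tr_block_mx mulmx_block tr_scalar_mx trmx0 !mul0mx !mulmx0 !addr0.
  rewrite linearZ /= !mul_scalar_mx !mul_mx_scalar scale_scalar_mx ss !scalerA mulfV // !scale1r.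
  rewrite -scalemxAl -scalemxAr scalerA -hE.
  by rewrite -invfM ss addrC subrK.
Qed.

Lemma gram_inv (R : realType) n (B : 'M[R]_n) : B \in unitmx ->
  invmx (B *m B^T) = (invmx B)^T *m invmx B.
Proof.
move=> uB; have uBB : B *m B^T \in unitmx by rewrite unitmx_mul unitmx_tr uB.
apply: (can_inj (mulKmx uBB)); rewrite mulmxV // !mulmxA trmx_inv.
by rewrite mulmxK ?unitmx_tr // mulmxV.
Qed.

(** * Positivity of the metric induced on forms *)

Section Positivity.
Variables (R : realType) (n : nat) (g : 'M[R]_n).
Hypotheses (gT : g^T = g) (gp : posdef g).

Lemma posdef_det : 0 < \det g.
Proof.
have [B uB ->] := cholesky gT gp; rewrite det_mulmx det_tr -expr2 exprn_even_gt0 //=.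
by rewrite -unitfE -unitmxE.
Qed.

(** With g = B B^T the top coefficient is the volume factor times the sum of the squared
    coefficients of the image of a under [ext_map (invmx B)]. *)
Lemma wedge_hodge_ge0 (a : ext R n) : 0 <= wedge a (hodge g a) finset.setT.
Proof.
rewrite hodgeE wedgeZr extE wedge_star_top mulr_ge0 ?sqrtr_ge0 //.
have [B uB gE] := cholesky gT gp.
by rewrite gE gram_inv // -ext_map_comp -ext_map_adj inner0_ge0.
Qed.

Lemma wedge_hodge_eq0 (a : ext R n) : wedge a (hodge g a) finset.setT = 0 -> a = 0.
Proof.
rewrite hodgeE wedgeZr extE wedge_star_top => /eqP.
rewrite mulf_eq0 sqrtr_eq0 leNgt posdef_det /=.
have [B uB gE] := cholesky gT gp.
rewrite gE gram_inv // -ext_map_comp -ext_map_adj => /eqP/inner0_eq0 E.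
by rewrite -[a]ext_map_id -(mulmxV uB) -ext_map_comp E ext_map0.
Qed.

End Positivity.

(** * Parity, and the sign of [hat] against forms of degree 1 and 3 *)

Section Parity.
Variables (R : realType) (n : nat).
Implicit Types (a b x y : ext R n) (I J K : {set 'I_n}) (c : bool).

Lemma parityD c a b : has_parity c a -> has_parity c b -> has_parity c (a + b).
Proof. by move=> ca cb I Ic; rewrite extD ca // cb // addr0. Qed.
Lemma parityZ c k a : has_parity c a -> has_parity c (k *: a).
Proof. by move=> ca I Ic; rewrite extZ ca // mulr0. Qed.
Lemma parity_dscale f c a : has_parity c a -> has_parity c (dscale f a).
Proof. by move=> ca I Ic; rewrite dscaleE ca // mulr0. Qed.
Lemma parity_sum c (T : Type) (r : seq T) (P : pred T) (F : T -> ext R n) :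
  (forall t, P t -> has_parity c (F t)) -> has_parity c (\sum_(t <- r | P t) F t).
Proof. by move=> cF I Ic; rewrite ext_sum big1 // => t Pt; rewrite cF. Qed.
Lemma parity_degree p a : has_degree p a -> has_parity (odd p) a.
Proof. by move=> pa I Ic; apply: pa; apply: contraNneq Ic => ->. Qed.
Lemma parity_wedge c c' a b : has_parity c a -> has_parity c' b ->
  has_parity (c (+) c') (wedge a b).
Proof.
move=> ca cb K Kc; rewrite wedgeE big1 // => I IK.
have [Ic|/ca->] := eqVneq (odd #|I|) c; last by rewrite mul0r mulr0.
have [Jc|/cb->] := eqVneq (odd #|(K :\: I)%SET|) c'; last by rewrite !mulr0.
by move: Kc; rewrite -Ic -Jc -oddD -(cardsID I K) (finset.setIidPr IK) eqxx.
Qed.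
Lemma parity_map c (A : 'M[R]_n) a : has_parity c a -> has_parity c (ext_map A a).
Proof.
move=> ca; rewrite (ext_expand a) ext_map_sum; apply: parity_sum => J _.
rewrite ext_mapZ; have [<-|/ca->] := eqVneq (odd #|J|) c; last first.
  by rewrite scale0r => I _; rewrite ext0.
by apply: parityZ; apply: parity_degree; apply: degree_map; exact: degree_ebase.
Qed.
Lemma parity_hodge c (g : 'M[R]_n) a : has_parity c a -> has_parity (c (+) odd n) (hodge g a).
Proof.
move=> ca; rewrite hodgeE; apply: parityZ => K Kc; rewrite starE (parity_map _ ca) ?mulr0 //.
apply: contraNneq Kc; rewrite cardsC_ord oddB => [<-|]; last by rewrite -[X in (_ <= X)%N]card_ord max_card.
by rewrite addbC addbA addbb.
Qed.
Lemma parity_both c a : has_parity c a -> has_parity (~~ c) a -> a = 0.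
Proof.
move=> ca nca; apply/ffunP => I; rewrite ext0.
by have [/eqP Ic|Ic] := boolP (odd #|I| == c); [rewrite nca // Ic; case: (c)|rewrite ca].
Qed.

Lemma wedge_even_comm a b : has_degree 2 a -> wedge a b = wedge b a.
Proof.
move=> da; rewrite (wedgeC b da) -{1}[b]dscale1; congr wedge.
by apply: eq_dscale => p _; rewrite mul2n -signr_odd odd_double.
Qed.

Lemma wedge_degree3 a b : has_degree 3 a -> wedge b a = wedge a (tilde b).
Proof.
move=> da; rewrite (wedgeC b da) tildeE; congr wedge.
by apply: eq_dscale => p _; rewrite -signr_odd oddM signr_odd.
Qed.

Lemma wedge_degree1 a b : has_degree 1 a -> wedge b a = wedge a (tilde b).
Proof.
move=> da; rewrite (wedgeC b da) tildeE; congr wedge.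
by apply: eq_dscale => p _; rewrite mul1n.
Qed.

Lemma hat_step p : (-1) ^+ (p.+1 * p.+2)./2 = - (-1) ^+ p * (-1) ^+ (p * p.+1)./2 :> R.
Proof.
have -> : ((p.+1 * p.+2)./2 = p.+1 + (p * p.+1)./2)%N.
  have -> : (p.+1 * p.+2 = p.+1.*2 + p * p.+1)%N by rewrite -mul2n; lia.
  by rewrite halfD odd_double doubleK.
by rewrite exprD exprS mulN1r.
Qed.

(** The opposite signs here and in [hat_wedge3] are those of integration by parts: the derivative
    crosses the integral with a minus sign, the multiplication by H with a plus sign. Conjugating by
    [hat] reproduces both at once. *)
Lemma hat_wedge1 a b : has_degree 1 a -> hat (wedge a (hat b)) = - wedge a (tilde b).
Proof.
move=> da; rewrite !hatE (dscale_wedge _ _ da) dscale_comp.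
have -> : - wedge a (tilde b) = wedge a (dscale (fun p => -1 * (-1) ^+ p) b).
  by rewrite -(dscale_comp (fun=> -1)) dscale_cst wedgeZr scaleN1r tildeE.
congr wedge; apply: eq_dscale => p _.
by rewrite add1n hat_step -mulrA -expr2 sqrr_sign mulr1 mulN1r.
Qed.

Lemma hat_wedge3 a b : has_degree 3 a -> hat (wedge a (hat b)) = wedge a (tilde b).
Proof.
move=> da; rewrite !hatE (dscale_wedge _ _ da) dscale_comp tildeE.
congr wedge; apply: eq_dscale => p _.
rewrite !addSn add0n !hat_step !exprS; set s := (-1) ^+ p; set h := (-1) ^+ _.
have ss : s * s = 1 by rewrite /s -expr2 sqrr_sign.
have hh : h * h = 1 by rewrite /h -expr2 sqrr_sign.
transitivity (s * (s * s) * (h * h)); last by rewrite ss hh !mulr1.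
by ring.
Qed.

End Parity.

(* The exterior algebra as a ring, for the binomial formula; [ext R n] itself
   already carries the pointwise product of finite functions. *)
Definition ext_ring (R : realType) (n : nat) : Type := ext R n.
HB.instance Definition _ (R : realType) n := GRing.Zmodule.on (ext_ring R n).
HB.instance Definition _ (R : realType) n :=
  GRing.Zmodule_isPzRing.Build (ext_ring R n) (@wedgeA R n) (@wedge1l R n) (@wedge1r R n)
    (fun a b c => @wedgeDl R n a b c) (fun a b c => @wedgeDr R n b c a).

(** * The exponential of a form of degree 2 *)

Section Exp.
Variables (R : realType) (n : nat).
Implicit Types (a b : ext R n).

Definition wpow a k : ext R n := iter k (wedge a) ext1.

Lemma wpowE a k : wpow a k = (a : ext_ring R n) ^+ k :> ext_ring R n.
Proof. by elim: k => [//|k IH]; rewrite exprS -IH. Qed.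

Lemma wedge_expE a : wedge_exp a = \sum_(k < n.+1) (k`!%:R : R)^-1 *: wpow a k.
Proof. by []. Qed.

Lemma degree_wpow a k : has_degree 2 a -> has_degree k.*2 (wpow a k).
Proof.
move=> da; elim: k => [|k IH]; first by have := @degree_ebase R n finset.set0; rewrite cards0 ebase0.
by rewrite doubleS /wpow iterS; exact: (degree_wedge da IH).
Qed.

Lemma degree_gt p a : has_degree p a -> (n < p)%N -> a = 0.
Proof.
move=> pa np; apply/ffunP => I; rewrite ext0 pa // neq_ltn.
by rewrite (leq_ltn_trans _ np) // -[X in (_ <= X)%N]card_ord max_card.
Qed.

(** The binomial formula, valid since forms of degree 2 commute with everything, yields the terms
    with i + j <= n, whereas the product of the truncated series runs over all i, j <= n. The
    surplus terms have degree 2 (i + j) > n and vanish. *)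
Lemma wedge_expD a b : has_degree 2 a -> has_degree 2 b ->
  wedge_exp (a + b) = wedge (wedge_exp a) (wedge_exp b).
Proof.
move=> da db; rewrite !wedge_expE wedge_suml.
under [RHS]eq_bigr do rewrite wedge_sumr.
pose F i j : ext R n := (i`!%:R : R)^-1 *: ((j`!%:R : R)^-1 *: wedge (wpow a i) (wpow b j)).
have F0 i j : (n < i + j)%N -> F i j = 0.
  move=> nij; rewrite /F.
  rewrite (degree_gt (degree_wedge (@degree_wpow a i da) (@degree_wpow b j db))) ?scaler0 //.
  by rewrite -doubleD -addnn (leq_trans nij) // leq_addr.
rewrite [RHS](eq_bigr (fun i : 'I_n.+1 => \sum_(j < n.+1) F i j)) => [|i _]; last first.
  by apply: eq_bigr => j _; rewrite wedgeZl wedgeZr.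
transitivity (\sum_(k < n.+1) \sum_(i < k.+1) F (k - i)%N i).
  apply: eq_bigr => k _.
  have ab : GRing.comm (a : ext_ring R n) b by exact: wedge_even_comm.
  rewrite wpowE (exprDn_comm k ab) (_ : \sum_(i < k.+1) _ =
    \sum_(i < k.+1) wedge (wpow a (k - i)) (wpow b i) *+ 'C(k, i)); last first.
    by apply: eq_bigr => i _; rewrite !wpowE.
  rewrite scaler_sumr; apply: eq_bigr => i _.
  have ik : (i <= k)%N by rewrite -ltnS.
  rewrite /F -[wedge _ _ *+ _]scaler_nat !scalerA; congr (_ *: _).
  rewrite -(bin_fact ik) !natrM !invfM.
  have := fact_gt0 i; have := fact_gt0 (k - i); have : (0 < 'C(k, i))%N by rewrite bin_gt0.
  rewrite -!(ltr_nat R) => c0 f0 g0; field.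
  by rewrite !gt_eqF.
pose G k i : ext R n := if (i <= k)%N then F (k - i)%N i else 0.
transitivity (\sum_(k < n.+1) \sum_(i < n.+1) G k i).
  apply: eq_bigr => k _.
  rewrite (big_ord_widen_cond n.+1 xpredT (fun i => F (k - i)%N i)) //.
  by rewrite big_mkcond; apply: eq_bigr => i _; rewrite /G /= ltnS.
rewrite exchange_big [RHS]exchange_big /=; apply: eq_bigr => j _.
pose G' i : ext R n := if (i + j < n.+1)%N then F i j else 0.
transitivity (\sum_(0 <= i < n.+1 - j) F i j).
  rewrite -(big_mkord xpredT (fun k => G k j)) (big_cat_nat (n := j)) //=; last exact: ltnW.
  rewrite big_nat_cond big1 ?add0r => [|k]; last by rewrite /G andbT => /andP[_]; rewrite ltnNge => /negbTE->.
  rewrite -{1}[nat_of_ord j]add0n big_addn; apply: eq_bigr => k _.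
  by rewrite /G leq_addl addnK.
rewrite -[RHS](big_mkord xpredT (fun i => F i j)) [RHS](big_cat_nat (n := (n.+1 - j)%N)) ?leq_subr //=.
rewrite [X in _ = _ + X]big_nat_cond [X in _ = _ + X]big1 ?addr0 // => k /andP[/andP[nk _] _].
by apply: F0; have := ltn_ord j; lia.
Qed.

Lemma wedge_exp0 : wedge_exp (0 : ext R n) = ext1.
Proof.
rewrite wedge_expE big_ord_recl big1 ?addr0 => [|i _]; first by rewrite fact0 invr1 scale1r.
by rewrite /wpow /= wedge0l scaler0.
Qed.

Lemma degreeN p a : has_degree p a -> has_degree p (- a).
Proof. by move=> pa; rewrite -scaleN1r; exact: degreeZ. Qed.

Lemma wedge_expNl a : has_degree 2 a -> wedge (wedge_exp (- a)) (wedge_exp a) = ext1.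
Proof. by move=> da; rewrite -wedge_expD ?addNr ?wedge_exp0 //; exact: degreeN. Qed.

Lemma ext_map_exp (A : 'M[R]_n) a : ext_map A (wedge_exp a) = wedge_exp (ext_map A a).
Proof.
rewrite !wedge_expE ext_map_sum; apply: eq_bigr => k _; rewrite ext_mapZ; congr (_ *: _).
rewrite /wpow; elim: (nat_of_ord k) => [|j IH] /=; first exact: ext_map_ext1.
by rewrite ext_mapM IH.
Qed.

Lemma parity_exp a : has_degree 2 a -> has_parity false (wedge_exp a).
Proof.
move=> da; apply: parity_sum => k _; apply: parityZ.
by rewrite -(odd_double k); apply: parity_degree; exact: degree_wpow.
Qed.

End Exp.

(** * Signs on forms of pure parity *)

Section Signs.
Variable (R : realType) (n : nat).

(** This is how a degree-dependent sign becomes one global sign on forms of pure parity. [hsign] and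
    [gsign] both change when the degree grows by 2, so a product of the two is constant on each
    parity. On the right [c] is read as a number, the least degree of its parity. *)
Lemma parity_const (F : nat -> R) (c : bool) :
  (forall p, (p.+2 <= n)%N -> F p.+2 = F p) ->
  forall p, (p <= n)%N -> odd p = c -> F p = F c.
Proof.
move=> FS; elim/ltn_ind => -[|[|p]] IH pn pc; try by rewrite -pc.
by rewrite FS // IH //; [exact: ltnW (ltnW pn)|rewrite -pc /= negbK].
Qed.

Definition hsign p : R := (-1) ^+ (p * p.+1)./2.

Lemma hsignSS p : hsign p.+2 = - hsign p.
Proof.
rewrite /hsign !hat_step exprS.
transitivity (- ((-1) ^+ p * (-1) ^+ p) * (-1) ^+ (p * p.+1)./2 : R); first by ring.
by rewrite -expr2 sqrr_sign mulN1r.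
Qed.

Definition gsign p : R := hsign p * (if odd n then (-1) ^+ p else 1).

Lemma gsignSS p : gsign p.+2 = - gsign p.
Proof. by rewrite /gsign hsignSS mulNr !exprS !mulN1r opprK. Qed.

Lemma hsign_sq p : hsign p * hsign p = 1. Proof. by rewrite /hsign -expr2 sqrr_sign. Qed.
Lemma sq1M (x y : R) : x * x = 1 -> y * y = 1 -> (x * y) * (x * y) = 1.
Proof. by move=> xx yy; rewrite mulrACA xx yy mulr1. Qed.
Lemma gsign_sq p : gsign p * gsign p = 1.
Proof.
apply: sq1M; first exact: hsign_sq.
by case: ifP => _; rewrite ?mulr1 // -expr2 sqrr_sign.
Qed.

Lemma hat_tilde_gsign (a : ext R n) : hat (if odd n then tilde a else a) = dscale gsign a.
Proof.
rewrite hatE; case: ifP => on; rewrite ?tildeE ?dscale_comp; apply: eq_dscale => p _;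
  by rewrite /gsign on ?mulr1.
Qed.

(* dscale gsign is the sign hat, or hat o tilde, in the definition of G~. *)
Lemma hodge_gsign c : exists2 e : R, e * e = 1 &
  forall (g : 'M[R]_n) a, has_parity c a -> hodge g (dscale gsign a) = e *: hat (hodge g a).
Proof.
pose d := c (+) odd n.
exists (gsign (n - d)%N * hsign d).
  by apply: sq1M; [exact: gsign_sq|exact: hsign_sq].
move=> g a ca; rewrite hodge_dscale hatE -dscaleZ -dscale_cst dscale_comp.
apply: (eq_dscale_parity (parity_hodge g ca)) => p pn pd.
have FS q : (q.+2 <= n)%N -> gsign (n - q.+2) * hsign q.+2 = gsign (n - q) * hsign q.
  move=> qn; have -> : (n - q = (n - q.+2).+2)%N by lia.
  by rewrite gsignSS hsignSS mulrN mulNr.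
have := @parity_const (fun p => gsign (n - p) * hsign p) d FS p pn pd => <-.
by rewrite -/(hsign p) mulrCA hsign_sq mulr1.
Qed.

(** Made for the constraint: in (G~ gamma, _) the Hodge operator of G~ and that of the inner product
    compose to [star_sign], and the remaining sign is [hat] up to the constant e. *)
Lemma star_sign_gsign c : exists2 e : R, e * e = 1 &
  forall a : ext R n, has_parity c a -> dscale (@star_sign R n) (dscale gsign a) = e *: hat a.
Proof.
exists (star_sign R n c * gsign c * hsign c).
  by apply: sq1M; [apply: sq1M; [rewrite /star_sign -expr2 sqrr_sign|exact: gsign_sq]|exact: hsign_sq].
move=> a ca; rewrite dscale_comp hatE -dscaleZ -dscale_cst dscale_comp.
apply: (eq_dscale_parity ca) => p pn pc.
have FS q : (q.+2 <= n)%N -> star_sign R n q.+2 * gsign q.+2 * hsign q.+2 = star_sign R n q * gsign q * hsign q.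
  move=> qn; rewrite gsignSS hsignSS /star_sign -signr_odd -[in RHS]signr_odd.
  have -> : odd (q.+2 * (n - q.+2)) = odd (q * (n - q)).
    by rewrite !oddM !oddB // 1?(ltnW (ltnW qn)) //= !negbK.
  by ring.
have := @parity_const (fun p => star_sign R n p * gsign p * hsign p) c FS p pn pc => <-.
rewrite -[LHS]mulr1 -[X in _ * X = _](hsign_sq p) /hsign.
by rewrite mulrA [RHS]mulrC.
Qed.

End Signs.

(** * Smooth functions and forms on R^n *)

Section CD.
Variables (R : realType) (n : nat).
Implicit Types (U V : set 'rV[R]_n) (f g : 'rV[R]_n -> R) (k : nat) (y : 'rV[R]_n).
Local Notation e i := (delta_mx 0 i : 'rV[R]_n).
Local Notation CD := (@continuously_differentiable R n).

Lemma CD_cont k U f y : CD k U f -> U y -> {for y, continuous f}.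
Proof. by case: k => [|k] [+ _] Uy => /(_ y Uy). Qed.

Lemma CDS k U f : CD k.+1 U f -> CD k U f.
Proof.
elim: k f => [|k IH] f [cf fd]; split=> // i.
by have [df cdf] := fd i; split=> //; exact: IH.
Qed.

Lemma CD_le k m U f : (m <= k)%N -> CD k U f -> CD m U f.
Proof.
move=> /subnK <-; elim: (k - m)%N => // l IH H; apply: IH; exact: CDS.
Qed.

Lemma CD_sub k U V f : V `<=` U -> CD k U f -> CD k V f.
Proof.
move=> VU; elim: k f => [|k IH] f [cf fd]; split=> //; try by move=> y /VU; exact: cf.
by move=> i; have [df cdf] := fd i; split=> [y /VU|]; [exact: df|exact: IH].
Qed.

(** The set in [CD] merely lists the points at which conditions are imposed on the total function f,
    so V may be any set containing y. Comparing two functions on U, as in [CD_eq], is different: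
    there U has to be open. *)
Lemma CD_local k U f : (forall y, U y -> exists2 V, V y & CD k V f) -> CD k U f.
Proof.
elim: k f => [|k IH] f H; split=> //.
- by move=> y Uy; have [V Vy [+ _]] := H y Uy; apply.
- by move=> y Uy; have [V Vy [+ _]] := H y Uy; apply.
- move=> i; split; first by move=> y Uy; have [V Vy [_ /(_ i)[+ _]]] := H y Uy; apply.
  by apply: IH => y Uy; have [V Vy [_ /(_ i)[_ ?]]] := H y Uy; exists V.
Qed.

Lemma near_open U (P : set 'rV[R]_n) y : open U -> U y -> (forall z, U z -> P z) ->
  \forall z \near y, P z.
Proof. by move=> oU Uy UP; apply: filterS UP _; exact: open_nbhs_nbhs. Qed.

Lemma near_eq_on U f g y : open U -> (forall z, U z -> f z = g z) -> U y ->
  \forall z \near y, f z = g z.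
Proof. by move=> oU fg Uy; apply: (@near_open U (fun z => f z = g z)). Qed.

Lemma cont_eq U f g y : open U -> (forall z, U z -> f z = g z) -> U y ->
  {for y, continuous f} -> {for y, continuous g}.
Proof.
move=> oU fg Uy cf; rewrite /prop_for /continuous_at -(fg y Uy).
apply: cvg_trans cf; apply: (@near_eq_cvg _ _ (nbhs y) _ f g).
exact: (near_eq_on oU fg Uy).
Qed.

Lemma CD_eq k U f g : open U -> (forall y, U y -> f y = g y) -> CD k U f -> CD k U g.
Proof.
move=> oU; elim: k f g => [|k IH] f g fg [cf fd].
  by split=> // y Uy; apply: cont_eq fg Uy (cf y Uy).
split=> [y Uy|i]; first exact: cont_eq fg Uy (cf y Uy).
have [df cdf] := fd i; split.
  by move=> y Uy; apply: near_eq_derivable (df y Uy); exact: near_eq_on fg Uy.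
by apply: IH cdf => y Uy; apply: near_eq_derive; exact: near_eq_on fg Uy.
Qed.

Lemma partial_cst i (c : R) : partial i (fun _ : 'rV[R]_n => c) = fun=> 0.
Proof. by apply/funext => y; rewrite /partial; exact: derive_cst. Qed.

Lemma CD_cst k U (c : R) : CD k U (fun=> c).
Proof.
elim: k c => [|k IH] c; split=> //; try by move=> y _; exact: cst_continuous.
by move=> i; split=> [y _|]; [exact: derivable_cst|rewrite partial_cst; exact: IH].
Qed.

Lemma derivable_coord j y v : derivable (fun z : 'rV[R]_n => z 0 j) y v.
Proof.
have /derivable_mxP H := @derivable_id _ 'rV[R]_n y v.
exact: (H 0 j).
Qed.

Lemma derive_coord j y v : 'D_v (fun z : 'rV[R]_n => z 0 j) y = v 0 j.
Proof.
have := derive_mx (@derivable_id _ 'rV[R]_n y v); rewrite derive_id => /rowP/(_ j).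
by rewrite mxE.
Qed.

Lemma partial_coord i j : partial i (fun z : 'rV[R]_n => z 0 j) = fun=> (i == j)%:R.
Proof.
apply/funext => y; rewrite /partial derive_coord mxE eqxx /=.
by rewrite eq_sym.
Qed.

Lemma CD_coord k U j : CD k U (fun z => z 0 j).
Proof.
case: k => [|k]; split=> //; try by move=> y _; exact: coord_continuous.
by move=> i; split=> [y _|]; [exact: derivable_coord|rewrite partial_coord; exact: CD_cst].
Qed.

Lemma CDD k U f g : open U -> CD k U f -> CD k U g -> CD k U (fun y => f y + g y).
Proof.
move=> oU; elim: k f g => [|k IH] f g [cf fd] [cg gd]; split=> //.
- by move=> y Uy; apply: continuousD; [exact: cf|exact: cg].
- by move=> y Uy; apply: continuousD; [exact: cf|exact: cg].
move=> i; have [df cdf] := fd i; have [dg cdg] := gd i; split.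
  by move=> y Uy; apply: derivableD; [exact: df|exact: dg].
apply: (CD_eq oU _ (IH _ _ cdf cdg)) => y Uy.
by rewrite /partial deriveD //; [exact: df|exact: dg].
Qed.

Lemma CDM k U f g : open U -> CD k U f -> CD k U g -> CD k U (fun y => f y * g y).
Proof.
move=> oU; elim: k f g => [|k IH] f g Hf Hg.
  by split=> // y Uy; apply: continuousM; [exact: CD_cont Hf Uy|exact: CD_cont Hg Uy].
split; first by move=> y Uy; apply: continuousM; [exact: CD_cont Hf Uy|exact: CD_cont Hg Uy].
move=> i; have [_ /(_ i)[df cdf]] := Hf; have [_ /(_ i)[dg cdg]] := Hg; split.
  by move=> y Uy; apply: derivableM; [exact: df|exact: dg].
have := CDD oU (IH _ _ (CDS Hf) cdg) (IH _ _ (CDS Hg) cdf).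
apply: CD_eq => // y Uy; rewrite /partial deriveM //; [exact: df|exact: dg].
Qed.

Lemma CDZ k U (c : R) f : open U -> CD k U f -> CD k U (fun y => c * f y).
Proof. by move=> oU; apply: CDM => //; exact: CD_cst. Qed.

Lemma CDN k U f : open U -> CD k U f -> CD k U (fun y => - f y).
Proof.
move=> oU Hf; apply: (CD_eq oU _ (CDZ (-1) oU Hf)) => y _; by rewrite mulN1r.
Qed.

Lemma CDB k U f g : open U -> CD k U f -> CD k U g -> CD k U (fun y => f y - g y).
Proof. by move=> oU Hf Hg; apply: CDD => //; exact: CDN. Qed.

Lemma CD_sum k U (T : Type) (r : seq T) (P : pred T) (F : T -> 'rV[R]_n -> R) : open U ->
  (forall t, P t -> CD k U (F t)) -> CD k U (fun y => \sum_(t <- r | P t) F t y).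
Proof.
move=> oU HF; elim: r => [|t r IH].
  by apply: (CD_eq oU _ (CD_cst k U 0)) => y _; rewrite big_nil.
case Pt: (P t).
  by apply: (CD_eq oU _ (CDD oU (HF t Pt) IH)) => y _; rewrite big_cons Pt.
by apply: (CD_eq oU _ IH) => y _; rewrite big_cons Pt.
Qed.

Lemma CD_prod k U (T : Type) (r : seq T) (P : pred T) (F : T -> 'rV[R]_n -> R) : open U ->
  (forall t, P t -> CD k U (F t)) -> CD k U (fun y => \prod_(t <- r | P t) F t y).
Proof.
move=> oU HF; elim: r => [|t r IH].
  by apply: (CD_eq oU _ (CD_cst k U 1)) => y _; rewrite big_nil.
case Pt: (P t).
  by apply: (CD_eq oU _ (CDM oU (HF t Pt) IH)) => y _; rewrite big_cons Pt.
by apply: (CD_eq oU _ IH) => y _; rewrite big_cons Pt.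
Qed.

Lemma CDV k U f : open U -> (forall y, U y -> f y != 0) -> CD k U f ->
  CD k U (fun y => (f y)^-1).
Proof.
move=> oU f0; elim: k => [|k IH] Hf.
  by split=> // y Uy; apply: continuousV; [exact: f0|exact: CD_cont Hf Uy].
split; first by move=> y Uy; apply: continuousV; [exact: f0|exact: CD_cont Hf Uy].
move=> i; have [_ /(_ i)[df cdf]] := Hf; split.
  by move=> y Uy; apply: derivableV; [exact: f0|exact: df].
have Hi := IH (CDS Hf).
have := CDN oU (CDM oU (CDM oU Hi Hi) cdf).
apply: CD_eq => // y Uy; rewrite /partial deriveV ?f0 //; last exact: df.
by rewrite scaleNr -invfM expr2.
Qed.

(** Restricting f to the line t v + y turns this into the chain rule in one variable. *)
Lemma is_derive_comp1 (h : R -> R) f y v (a b : R) :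
  is_derive (f y) 1 h a -> is_derive y v f b -> is_derive y v (fun z => h (f z)) (a * b).
Proof.
move=> hd fd.
have L (F : 'rV[R]_n -> R) (c : R) : is_derive y v F c <->
    is_derive (0 : R) 1 (fun t : R => F (t *: v + y)) c.
  have E : (fun t : R => t^-1 *: (F (t *: v + y) - F y)) =
           (fun t : R => t^-1 *: (F ((t *: (1 : R) + 0) *: v + y) - F (0 *: v + y))).
    by apply/funext => t; rewrite addr0 scale0r add0r [t *: 1]mulr1.
  split=> -[d <-]; split.
  - by rewrite /derivable -E.
  - by rewrite /derive -E.
  - by rewrite /derivable E.
  - by rewrite /derive E.
apply/L; apply: (@is_derive1_comp _ h (fun t : R => f (t *: v + y))).
  by rewrite scale0r add0r.
exact/L.
Qed.

Lemma CD_sqrt k U f : open U -> (forall y, U y -> 0 < f y) -> CD k U f ->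
  CD k U (fun y => Num.sqrt (f y)).
Proof.
move=> oU f0; elim: k => [|k IH] Hf.
  by split=> // y Uy; apply: continuous_comp; [exact: CD_cont Hf Uy|exact: sqrt_continuous].
have [_ fd] := Hf.
have D y i : U y -> is_derive y (e i) (fun y => Num.sqrt (f y))
    ((2 * Num.sqrt (f y))^-1 * partial i f y).
  move=> Uy; apply: is_derive_comp1; first exact: is_derive1_sqrt (f0 y Uy).
  by apply: derivableP; exact: (fd i).1.
split; first by move=> y Uy; apply: continuous_comp; [exact: CD_cont Hf Uy|exact: sqrt_continuous].
move=> i; have [df cdf] := fd i; split; first by move=> y Uy; case: (D y i Uy).
have H0 y : U y -> 2 * Num.sqrt (f y) != 0.
  by move=> Uy; rewrite mulf_neq0 // gt_eqF // sqrtr_gt0 f0.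
have := CDM oU (CDV oU H0 (CDZ 2 oU (IH (CDS Hf)))) cdf.
by apply: CD_eq => // y Uy; rewrite /partial; case: (D y i Uy).
Qed.

Lemma CD_partial k U f i : CD k.+1 U f -> CD k U (partial i f).
Proof. by move=> [_ /(_ i)[]]. Qed.

Lemma CD_derivable k U f i y : CD k.+1 U f -> U y -> derivable f y (e i).
Proof. by move=> [_ /(_ i)[+ _]] Uy; apply. Qed.

Lemma rV_norm_le (v : 'rV[R]_n) r : 0 <= r -> (forall j, `|v 0 j| <= r) -> `|v| <= r.
Proof.
move=> r0 H; rewrite [leLHS]/Num.Def.normr /= mx_normrE.
by apply: bigmax_le => // -[i j] _ /=; rewrite ord1.
Qed.

Lemma coord_norm_le (v : 'rV[R]_n) j : `|v 0 j| <= `|v|.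
Proof.
rewrite [leRHS]/Num.Def.normr /= mx_normrE.
exact: (le_bigmax _ (fun ij : 'I_1 * 'I_n => `|v ij.1 ij.2|) (0, j)).
Qed.

Lemma line_derive f (z v : 'rV[R]_n) (t : R) : derivable f (t *: v + z) v ->
  is_derive t 1 (fun s : R => f (s *: v + z)) ('D_v f (t *: v + z)).
Proof.
have E : (fun h : R => h^-1 *: (f (h *: v + (t *: v + z)) - f (t *: v + z))) =
         (fun h : R => h^-1 *: (f ((h *: (1 : R) + t) *: v + z) - f (t *: v + z))).
  by apply/funext => h; rewrite [h *: 1]mulr1 scalerDl addrA.
by move=> d; split; rewrite /derivable /derive -E.
Qed.

Lemma mvt_line f (z v : 'rV[R]_n) (s : R) :
  (forall t, `|t| <= `|s| -> derivable f (t *: v + z) v) ->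
  exists2 t, `|t| <= `|s| & f (s *: v + z) - f z = s * 'D_v f (t *: v + z).
Proof.
move=> df; pose phi (t : R) := f (t *: v + z).
have dphi (t : R) : `|t| <= `|s| -> is_derive t (1 : R) phi ('D_v f (t *: v + z)).
  by move=> /df; exact: line_derive.
have cphi (t : R) : `|t| <= `|s| -> {for t, continuous phi}.
  by move=> /dphi[dt _]; apply: differentiable_continuous; exact/derivable1_diffP.
have f0 : f z = phi 0 by rewrite /phi scale0r add0r.
have [s0|s0] := leP 0 s.
  have H (t : R) : 0 <= t <= s -> `|t| <= `|s| by move=> /andP[t0 ts]; rewrite !ger0_norm.
  have [t||t tI E] := @MVT_segment _ phi (fun t => 'D_v f (t *: v + z)) 0 s s0.
  - by rewrite in_itv /= => /andP[/ltW t0 /ltW ts]; apply: dphi; apply: H; rewrite t0.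
  - apply: continuous_in_subspaceT => t /set_mem /=; rewrite in_itv /= => /H; exact: cphi.
  - exists t; first by apply: H; move: tI; rewrite in_itv.
    by rewrite f0 -/(phi s) E subr0 mulrC.
have H (t : R) : s <= t <= 0 -> `|t| <= `|s|.
  by move=> /andP[st t0]; rewrite !ler0_norm ?lerN2 // ltW.
have [t||t tI E] := @MVT_segment _ phi (fun t => 'D_v f (t *: v + z)) s 0 (ltW s0).
- by rewrite in_itv /= => /andP[/ltW t0 /ltW ts]; apply: dphi; apply: H; rewrite t0.
- apply: continuous_in_subspaceT => t /set_mem /=; rewrite in_itv /= => /H; exact: cphi.
- exists t; first by apply: H; move: tI; rewrite in_itv.
  by rewrite f0 -/(phi s) -opprB E sub0r mulrN opprK mulrC.
Qed.

(** The passage from y to h + y changes one coordinate at a time; on each edge the mean value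
    theorem gives a partial derivative at a nearby point, close to its value at y by continuity. *)
Lemma C1_differentiable U f y : open U -> CD 1 U f -> U y -> differentiable f y.
Proof.
move=> oU Hf Uy.
pose D (v : 'rV[R]_n) : R := \sum_i v 0 i * partial i f y.
have linD : linear D.
  move=> a u v; rewrite /D scaler_sumr -big_split /=; apply: eq_bigr => i _.
  by rewrite !mxE mulrDl [in RHS]/GRing.scale /= mulrA.
pose LD : {linear 'rV[R]_n -> R} := HB.pack D (GRing.isLinear.Build _ _ _ _ D linD).
have cD : continuous LD.
  move=> v; suff cD : CD 0 setT D by exact: CD_cont cD I.
  apply: CD_sum => [|i _]; first exact: openT.
  by apply: CDM; [exact: openT|exact: CD_coord|exact: CD_cst].
suff FD : (f : 'rV[R]_n -> R^o) \o shift y = cst (f y) + (LD : 'rV[R]_n -> R^o) +o_ (0 : 'rV[R]_n) id.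
  by apply/diff_locallyP; rewrite (diff_unique cD FD).
apply/eqaddoP => _/posnumP[eps].
have n0 : 0 < n%:R + 1 :> R by rewrite ltr_wpDl.
(* Each of the n edges will contribute an error of at most ep |h|; the summand 1 covers n = 0. *)
pose ep := eps%:num / (n%:R + 1).
have ep0 : 0 < ep by rewrite divr_gt0.
have H1 : \forall z \near y, forall i, `|partial i f y - partial i f z| <= ep.
  apply: (@filter_forall _ _ (fun i : 'I_n => [set z | `|partial i f y - partial i f z| <= ep]) (nbhs y) _) => i.
  have := CD_cont (CD_partial i Hf) Uy.
  by rewrite /prop_for /continuous_at => /cvgrPdist_le/(_ _ ep0).
have H : \forall z \near y, U z /\ forall i, `|partial i f y - partial i f z| <= ep.
  by apply: filterS2 (open_nbhs_nbhs (conj oU Uy)) H1 => z.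
have /nbhs_ballP[d /= d0 dP] := H.
apply/nbhs_ballP; exists d => //= h; rewrite -ball_normE /= sub0r normrN => hd.
(* The first k coordinates of h followed by zeros: the points P k + y are the vertices of the
   path. *)
pose P k : 'rV[R]_n := \row_j (if (j < k)%N then h 0 j else 0).
have P0 : P 0%N = 0 by apply/rowP => j; rewrite !mxE.
have Pn : P n = h by apply/rowP => j; rewrite !mxE ltn_ord.
have PS (i : 'I_n) : P i.+1 = h 0 i *: e i + P i.
  apply/rowP => j; rewrite !mxE eqxx /= ltnS.
  have [->|ij] := eqVneq j i; first by rewrite leqnn ltnn mulr1 addr0.
  by rewrite mulr0 add0r leq_eqVlt (negbTE (_ : val j != val i)).
have tel : f (h + y) - f y = \sum_(i < n) (f (P i.+1 + y) - f (P i + y)).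
  rewrite -{1}Pn -[f y]/(f y) -{2}(add0r y) -P0.
  by rewrite -(big_mkord xpredT (fun i => f (P i.+1 + y) - f (P i + y))) telescope_sumr.
have small (i : 'I_n) (t : R) : `|t| <= `|h 0 i| -> ball y d (t *: e i + (P i + y)).
  move=> th; rewrite -ball_normE /= addrA opprD addrCA subrr addr0 normrN.
  apply: le_lt_trans hd; apply: rV_norm_le => // j; rewrite !mxE eqxx /=.
  have [->|ij] := eqVneq j i.
    by rewrite ltnn mulr1 addr0 (le_trans th) // coord_norm_le.
  rewrite mulr0 add0r; case: ifP => _; first exact: coord_norm_le.
  by rewrite normr0.
change (`|f (h + y) - (f y + D h)| <= eps%:num * `|h|).
have -> : f (h + y) - (f y + D h) = \sum_(i < n) (f (P i.+1 + y) - f (P i + y) - h 0 i * partial i f y).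
  by rewrite sumrB -tel opprD addrA.
apply: le_trans (ler_norm_sum _ _ _) _.
apply: (@le_trans _ _ (\sum_(i < n) ep * `|h|)).
  apply: ler_sum => i _.
  have dd (t : R) : `|t| <= `|h 0 i| -> derivable f (t *: e i + (P i + y)) (e i).
    by move=> ht; apply: CD_derivable Hf _; have [] := dP _ (small i t ht).
  have [t th E] := @mvt_line f (P i + y) (e i) (h 0 i) dd.
  rewrite PS -[h 0 i *: _ + P i + y]addrA E -mulrBr normrM mulrC ler_pM //.
    by rewrite distrC; exact: (dP _ (small i t th)).2.
  exact: coord_norm_le.
rewrite sumr_const card_ord -mulr_natl mulrA ler_wpM2r // /ep mulrCA ler_piMr //.
by rewrite ler_pdivrMr // mul1r lerDl.
Qed.

Lemma dist_half (a b c eps : R) : `|a - c| <= eps / 2 -> `|b - c| <= eps / 2 -> `|a - b| <= eps.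
Proof.
move=> ac bc; apply: le_trans (ler_distD c _ _) _.
by rewrite [leRHS]splitr lerD // distrC.
Qed.

(** The second difference of f over a square of side s does not depend on the order of the two
    differences, and the mean value theorem applied twice writes it as s^2 times a mixed derivative,
    in either order, at a point of the square. Both mixed derivatives are continuous at y. *)
Lemma schwarz U f i j y : open U -> CD 2 U f -> U y ->
  partial i (partial j f) y = partial j (partial i f) y.
Proof.
move=> oU Hf Uy.
apply/eqP; rewrite -subr_eq0 -normr_le0; apply/ler_addgt0Pl => eps eps0; rewrite addr0.
have e20 : 0 < eps / 2 by rewrite divr_gt0.
have near2 a b : \forall z \near y, `|partial a (partial b f) y - partial a (partial b f) z| <= eps / 2.
  have := CD_cont (CD_partial a (CD_partial b Hf)) Uy.
  by rewrite /prop_for /continuous_at => /cvgrPdist_le/(_ _ e20).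
have H : \forall z \near y, [/\ U z, `|partial i (partial j f) y - partial i (partial j f) z| <= eps / 2
   & `|partial j (partial i f) y - partial j (partial i f) z| <= eps / 2].
  apply: filterS3 (open_nbhs_nbhs (conj oU Uy)) (near2 i j) (near2 j i) => z *; by split.
have /nbhs_ballP[d /= d0 dP] := H.
(* Points of the square have distance at most 2 s < d from y. *)
pose s := d / 4.
have s0 : 0 < s by rewrite divr_gt0.
have e1 (k : 'I_n) : `|e k| <= 1.
  apply: rV_norm_le => // l; rewrite mxE eqxx /=.
  by case: (l == k); rewrite ?normr1 ?normr0.
have small (a b : 'I_n) (t t' : R) : `|t| <= `|s| -> `|t'| <= `|s| -> ball y d (t *: e a + (t' *: e b + y)).
  move=> ts ts'; rewrite -ball_normE /= addrA opprD addrCA subrr addr0 normrN.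
  apply: le_lt_trans (ler_normD _ _) _; rewrite !normrZ.
  apply: (@le_lt_trans _ _ (s + s)); last by rewrite /s; lra.
  move: ts ts'; rewrite !(gtr0_norm s0) => ts ts'.
  by rewrite lerD // -[leRHS]mulr1 ler_pM.
have swap (a b : 'I_n) (t t' : R) : t *: e a + (t' *: e b + y) = t' *: e b + (t *: e a + y).
  by rewrite addrCA.
have dbl (a b : 'I_n) : exists2 z, ball y d z &
    f (s *: e a + (s *: e b + y)) - f (s *: e a + y) - (f (s *: e b + y) - f y) =
    s * (s * partial b (partial a f) z).
  pose g z := f (s *: e b + z) - f z.
  have dsh (t : R) : `|t| <= `|s| -> derivable f (s *: e b + (t *: e a + y)) (e a).
    by move=> ts; rewrite swap; apply: CD_derivable Hf _; have [] := dP _ (small a b t s ts (lexx _)).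
  have dnsh (t : R) : `|t| <= `|s| -> derivable f (t *: e a + y) (e a).
    move=> ts; apply: CD_derivable Hf _; have [] := dP _ (small a b t 0 ts _); rewrite ?normr0 //.
    by rewrite scale0r add0r.
  have shiftE (z v : 'rV[R]_n) : derivable f (s *: e b + z) v ->
      is_derive z v (fun z => f (s *: e b + z)) ('D_v f (s *: e b + z)).
    have E : (fun h : R => h^-1 *: (f (h *: v + (s *: e b + z)) - f (s *: e b + z))) =
             (fun h : R => h^-1 *: (f (s *: e b + (h *: v + z)) - f (s *: e b + z))).
      by apply/funext => h; rewrite addrCA.
    by move=> dz; split; rewrite /derivable /derive -E.
  have dg (t : R) : `|t| <= `|s| -> is_derive (t *: e a + y) (e a) g
      (partial a f (s *: e b + (t *: e a + y)) - partial a f (t *: e a + y)).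
    move=> ts; apply: is_deriveB; first exact: shiftE (dsh t ts).
    by apply: derivableP; exact: dnsh.
  have [t ts E] := @mvt_line g y (e a) s (fun t ts => let: DeriveDef d _ := dg t ts in d).
  have dd (t' : R) : `|t'| <= `|s| -> derivable (partial a f) (t' *: e b + (t *: e a + y)) (e b).
    by move=> ts'; apply: CD_derivable (CD_partial a Hf) _; have [] := dP _ (small b a t' t ts' ts).
  have [t' ts' E'] := @mvt_line (partial a f) (t *: e a + y) (e b) s
    dd.
  exists (t' *: e b + (t *: e a + y)); first exact: small.
  rewrite -E' -[X in s * X](_ : 'D_(e a) g (t *: e a + y) = _); last by case: (dg t ts).
  by rewrite -E /g swap; ring.
have [z zd E] := dbl i j; have [z' zd' E'] := dbl j i.
have sw (a b c e : R) : a - b - (c - e) = a - c - (b - e) by ring.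
have EE' : s * (s * partial j (partial i f) z) = s * (s * partial i (partial j f) z').
  apply: etrans (esym E) _; apply: etrans _ E'.
  by rewrite (swap i j s s); exact: sw.
have s_neq0 := lt0r_neq0 s0.
have EE : partial j (partial i f) z = partial i (partial j f) z'.
  by move/(mulfI s_neq0)/(mulfI s_neq0): EE'.
have [_ _ H1] := dP _ zd; have [_ H2 _] := dP _ zd'.
rewrite EE in H1; exact: dist_half H2 H1.
Qed.

End CD.

(** * The chain rule in several variables and bump functions *)

Section Chain.
Variable R : realType.
Local Notation e i := (delta_mx 0 i).

Lemma rV_continuous n (T : topologicalType) (F : T -> 'rV[R]_n) x :
  (forall j, {for x, continuous (fun t => F t 0 j)}) -> {for x, continuous F}.
Proof.
move=> cF; rewrite /prop_for /continuous_at; apply/cvgrPdist_le => eps eps0.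
have : \forall t \near x, forall j, `|F x 0 j - F t 0 j| <= eps.
  apply: (@filter_forall _ _ (fun j : 'I_n => [set t | `|F x 0 j - F t 0 j| <= eps]) (nbhs x) _) => j.
  by have := cF j; rewrite /prop_for /continuous_at => /cvgrPdist_le; apply.
apply: filterS => t H; apply: rV_norm_le; first exact: ltW.
by move=> j; have := H j; rewrite !mxE.
Qed.

Lemma differentiable_rV m n (F : 'rV[R]_m -> 'rV[R]_n) y :
  (forall j, differentiable (fun z => F z 0 j) y) -> differentiable F y.
Proof.
move=> dF.
have -> : F = \sum_(j < n) (fun z => F z 0 j *: (e j : 'rV[R]_n)).
  apply/funext => z; rewrite fct_sumE; exact: row_sum_delta.
by apply: differentiable_sum => j; apply: differentiableZl.
Qed.

(** Given entry by entry so that the smoothness of the entries is that of partial derivatives;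
    [jacobianE] identifies it with [jacobian] where the components are differentiable. *)
Definition jac m n (F : 'rV[R]_m -> 'rV[R]_n) y : 'M[R]_(m, n) :=
  \matrix_(i, j) partial i (fun z => F z 0 j) y.

Lemma jacobianE m n (F : 'rV[R]_m -> 'rV[R]_n) y :
  (forall j, differentiable (fun z => F z 0 j) y) -> jacobian F y = jac F y.
Proof.
move=> dF; have dFy := differentiable_rV dF.
apply/matrixP => i j; rewrite mxE.
have := deriveEjacobian (e i) dFy.
rewrite derive_mx; last exact: diff_derivable.
move=> /rowP/(_ j); rewrite -rowE !mxE => <-.
by [].
Qed.

Lemma is_derive_comp m n (f : 'rV[R]_n -> R) (F : 'rV[R]_m -> 'rV[R]_n) y i :
  differentiable f (F y) -> (forall j, differentiable (fun z => F z 0 j) y) ->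
  is_derive y (e i : 'rV[R]_m) (fun z => f (F z)) (\sum_j jac F y i j * partial j f (F y)).
Proof.
move=> df dF; have dFy := differentiable_rV dF.
have dfF : differentiable (f \o F) y by exact: differentiable_comp.
split; first exact: diff_derivable.
rewrite -[LHS]/('D_(e i) (f \o F) y) deriveE // diff_comp //=.
rewrite -(deriveE (e i : 'rV[R]_m) dFy) derive_mx; last exact: diff_derivable.
rewrite (row_sum_delta (\matrix_(_, _) _)) linear_sum; apply: eq_bigr => j _.
by rewrite linearZ /= /partial deriveE // !mxE.
Qed.

Lemma CD_comp m n k (U : set 'rV[R]_m) (V : set 'rV[R]_n) (f : 'rV[R]_n -> R)
    (F : 'rV[R]_m -> 'rV[R]_n) : open U -> open V -> (forall y, U y -> V (F y)) ->
  (forall j, continuously_differentiable k U (fun y => F y 0 j)) ->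
  continuously_differentiable k V f ->
  continuously_differentiable k U (fun y => f (F y)).
Proof.
move=> oU oV UV; elim: k f => [|k IH] f HF Hf;
  have c y (Uy : U y) : {for y, continuous (fun y => f (F y))}
    by (apply: continuous_comp; [apply: rV_continuous => j; exact: CD_cont (HF j) Uy|
        exact: CD_cont Hf (UV y Uy)]).
  by split.
split=> [//|i].
have D y (Uy : U y) : is_derive y (e i) (fun z => f (F z)) (\sum_j jac F y i j * partial j f (F y)).
  apply: is_derive_comp => [|j].
    by apply: (C1_differentiable oV _ (UV y Uy)); apply: CD_le Hf.
  by apply: (C1_differentiable oU _ Uy); apply: CD_le (HF j).
split; first by move=> y /D[].
have H : continuously_differentiable k U (fun y => \sum_j jac F y i j * partial j f (F y)).
  apply: CD_sum => // j _; apply: CDM => //.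
    by apply: (CD_eq oU _ (CD_partial i (HF j))) => y _; rewrite mxE.
  by apply: IH => [l|]; [exact: CDS|exact: CD_partial].
by apply: CD_eq H => // y /D[].
Qed.

(* x^-m exp (-1/x): with the factor x^-m the family is closed under derivatives. *)
Definition bump_fun m (x : R) : R := if 0 < x then (x^-1) ^+ m * expR (- x^-1) else 0.

(** One term of the exponential series bounds exp (1/x) from below by x^-(m+2) / (m+2)!. The square
    on the right makes the difference quotient at 0 tend to 0. *)
Lemma bump_fun_le m x : `|bump_fun m x| <= (m.+2)`!%:R * x ^+ 2.
Proof.
have f0 : 0 < (m.+2)`!%:R :> R by rewrite ltr0n fact_gt0.
rewrite /bump_fun; case: ifPn => x0; last by rewrite normr0 mulr_ge0 ?sqr_ge0 // ltW.
have u0 : 0 < x^-1 by rewrite invr_gt0.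
rewrite ger0_norm; last by rewrite mulr_ge0 ?expR_ge0 // exprn_ge0 // ltW.
have := expR_ge1Dxn m.+1 (ltW u0).
rewrite expRN ler_pdivrMr ?expR_gt0 // => H.
apply: (@le_trans _ _ ((m.+2)`!%:R * x ^+ 2 * (x^-1 ^+ m.+2 / (m.+2)`!%:R))); last first.
  rewrite ler_pM2l; last by rewrite mulr_gt0 // exprn_gt0.
  by apply: le_trans H; rewrite lerDr.
rewrite le_eqVlt; apply/orP; left; apply/eqP.
rewrite !exprS expr0 exprVn; field.
by rewrite !gt_eqF //= exprn_gt0.
Qed.

Lemma is_derive_bump_fun m (x : R) :
  is_derive x 1 (bump_fun m) (bump_fun m.+2 x - m%:R * bump_fun m.+1 x).
Proof.
have [x0|x0|->] := ltgtP x 0.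
- have -> : bump_fun m.+2 x - m%:R * bump_fun m.+1 x = 0.
    by rewrite /bump_fun ltNge (ltW x0) /= mulr0 subr0.
  apply: (@near_eq_is_derive _ _ _ (cst 0)) => //.
  near=> z; rewrite /bump_fun /cst ifF //; apply/negbTE; rewrite -leNgt ltW //.
  near: z; exact: lt_nbhsl.
- apply: (@near_eq_is_derive _ _ _ (fun z : R => (z^-1) ^+ m * expR (- z^-1))).
    near=> z; rewrite /bump_fun ifT //; near: z; exact: lt_nbhsr.
  have dV : is_derive x 1 (fun z : R => z^-1) (- x ^- 2 *: 1).
    by apply: is_deriveV; rewrite gt_eqF.
  have dE : is_derive x 1 (fun z : R => expR (- z^-1)) (expR (- x^-1) * - (- x ^- 2 *: 1)).
    by apply: (@is_derive1_comp _ expR (fun z : R => - z^-1)).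
  rewrite /bump_fun x0.
  case: m => [|m].
    have -> : (fun z : R => z^-1 ^+ 0 * expR (- z^-1)) = (fun z => expR (- z^-1)).
      by apply/funext => z; rewrite expr0 mul1r.
    apply: is_derive_eq dE _; rewrite mul0r subr0 scaleNr opprK [_ *: 1]mulr1 mulrC.
    by rewrite exprVn.
  have dX : is_derive x 1 (fun z : R => z^-1 ^+ m.+1) ((m.+1)%:R *: (x^-1) ^+ m *: 1 * (- x ^- 2 *: 1)).
    by apply: (@is_derive1_comp _ (fun u : R => u ^+ m.+1) (fun z : R => z^-1)); split; [exact: exprn_derivable|exact: exp_derive].
  have dM := is_deriveM dX dE.
  apply: is_derive_eq dM _; rewrite ![_ *: 1]mulr1 /GRing.scale /= -exprVn !exprS expr0.
  ring.
have b0 k : bump_fun k 0 = 0 by rewrite /bump_fun ltxx.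
rewrite !b0 mulr0 subr0.
suff H : (fun h : R => h^-1 *: (bump_fun m (h *: (1 : R) + 0) - bump_fun m 0)) @ 0^' --> (0 : R).
  by split; [apply/cvg_ex; exists 0|exact: cvg_lim H].
apply/cvgrPdist_le => eps eps0.
have f0 : 0 < (m.+2)`!%:R :> R by rewrite ltr0n fact_gt0.
near=> h.
rewrite b0 sub0r normrN subr0 addr0 [h *: 1]mulr1 normrZ normfV.
have h0 : h != 0 by near: h; exact: nbhs_dnbhs_neq.
rewrite ler_pdivrMl ?normr_gt0 //; apply: le_trans (bump_fun_le m h) _.
rewrite -real_normK ?num_real // expr2 mulrA mulrC ler_pM2l ?normr_gt0 //.
rewrite -ler_pdivlMl //; near: h; apply: dnbhs0_le; by rewrite mulr_gt0 // invr_gt0.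
Unshelve. all: by end_near. Qed.

Lemma CD_bump n k m (U : set 'rV[R]_n) f : open U -> continuously_differentiable k U f ->
  continuously_differentiable k U (fun y => bump_fun m (f y)).
Proof.
move=> oU; have cb j : continuous (bump_fun j).
  by move=> x; apply: differentiable_continuous; apply/derivable1_diffP; case: (is_derive_bump_fun j x).
elim: k m => [|k IH] m Hf.
  by split=> // y Uy; apply: continuous_comp; [exact: CD_cont Hf Uy|exact: cb].
have D y i : U y -> is_derive y (e i) (fun y => bump_fun m (f y))
    ((bump_fun m.+2 (f y) - m%:R * bump_fun m.+1 (f y)) * partial i f y).
  move=> Uy; apply: is_derive_comp1; first exact: is_derive_bump_fun.
  by apply: derivableP; exact: CD_derivable Hf Uy.
split; first by move=> y Uy; apply: continuous_comp; [exact: CD_cont Hf Uy|exact: cb].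
move=> i; split; first by move=> y Uy; case: (D y i Uy).
have := CDM oU (CDB oU (IH m.+2 (CDS Hf)) (CDZ m%:R oU (IH m.+1 (CDS Hf)))) (CD_partial i Hf).
by apply: CD_eq => // y Uy; rewrite /partial; case: (D y i Uy).
Qed.

End Chain.

(** * The exterior derivative and pullbacks *)

Section SmoothForms.
Variables (R : realType) (n : nat).
Implicit Types (U V : set 'rV[R]_n) (f : 'rV[R]_n -> R) (alpha beta : 'rV[R]_n -> ext R n).
Local Notation e i := (delta_mx 0 i : 'rV[R]_n).

Definition smooth_form U alpha : Prop := forall I, smooth_on U (fun y => alpha y I).

Lemma smooth_form_eq U alpha beta : open U -> (forall y, U y -> alpha y = beta y) ->
  smooth_form U alpha -> smooth_form U beta.
Proof.
by move=> oU ab Ha I k; apply: CD_eq (Ha I k) => // y Uy; rewrite ab.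
Qed.

Lemma smooth_formZ U f alpha : open U -> smooth_on U f -> smooth_form U alpha ->
  smooth_form U (fun y => f y *: alpha y).
Proof.
move=> oU Hf Ha I k; apply: (CD_eq oU _ (CDM oU (Hf k) (Ha I k))) => y _; by rewrite extZ.
Qed.

Lemma smooth_form_cst U a : smooth_form U (fun=> a).
Proof. by move=> I k; exact: CD_cst. Qed.

Lemma smooth_form_sum U (T : Type) (r : seq T) (P : pred T) (F : T -> 'rV[R]_n -> ext R n) :
  open U -> (forall t, P t -> smooth_form U (F t)) ->
  smooth_form U (fun y => \sum_(t <- r | P t) F t y).
Proof.
move=> oU HF I k.
have := @CD_sum _ _ k U _ r P (fun t y => F t y I) oU (fun t Pt => HF t Pt I k).
by apply: CD_eq => // y _; rewrite ext_sum.
Qed.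

Lemma smooth_formD U alpha beta : open U -> smooth_form U alpha -> smooth_form U beta ->
  smooth_form U (fun y => alpha y + beta y).
Proof.
move=> oU Ha Hb I k; apply: (CD_eq oU _ (CDD oU (Ha I k) (Hb I k))) => y _; by rewrite extD.
Qed.

Lemma smooth_wedge U alpha beta : open U -> smooth_form U alpha -> smooth_form U beta ->
  smooth_form U (fun y => wedge (alpha y) (beta y)).
Proof.
move=> oU Ha Hb K k.
have : continuously_differentiable k U (fun y => \sum_(I : {set 'I_n} | I \subset K)
     shuffle_sign R I (K :\: I)%SET * (alpha y I * beta y (K :\: I)%SET)).
  by apply: CD_sum => // I _; apply: CDZ => //; apply: CDM => //; [exact: Ha|exact: Hb].
by apply: CD_eq => // y _; rewrite wedgeE.
Qed.

Lemma smooth_covector U (w : 'rV[R]_n -> 'I_n -> R) : open U ->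
  (forall i, smooth_on U (fun y => w y i)) -> smooth_form U (fun y => covector (w y)).
Proof.
move=> oU Hw; have : smooth_form U (fun y => \sum_i w y i *: ebase R [set i]%SET).
  by apply: smooth_form_sum => // i _; apply: smooth_formZ => //; exact: smooth_form_cst.
by apply: smooth_form_eq => // y _; rewrite covectorE.
Qed.

Lemma smooth_big_wedge U (T : Type) (r : seq T) (F : T -> 'rV[R]_n -> ext R n) : open U ->
  (forall t, smooth_form U (F t)) -> smooth_form U (fun y => \big[@wedge R n/ext1]_(t <- r) F t y).
Proof.
move=> oU HF; elim: r => [|t r IH].
  by apply: smooth_form_eq (smooth_form_cst U ext1) => // y _; rewrite big_nil.
by apply: smooth_form_eq (smooth_wedge oU (HF t) IH) => // y _; rewrite big_cons.
Qed.

Definition smooth_mx U m p (B : 'rV[R]_n -> 'M[R]_(m, p)) : Prop :=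
  forall i j, smooth_on U (fun y => B y i j).

Lemma smooth_ext_map U (B : 'rV[R]_n -> 'M[R]_n) alpha : open U ->
  smooth_mx U B -> smooth_form U alpha -> smooth_form U (fun y => ext_map (B y) (alpha y)).
Proof.
move=> oU HB Ha; apply: smooth_form_sum => // J _; apply: smooth_formZ => //.
by apply: smooth_big_wedge => // j; apply: smooth_covector => // i; exact: HB.
Qed.

Lemma smooth_dscale U (h : nat -> R) alpha : open U -> smooth_form U alpha ->
  smooth_form U (fun y => dscale h (alpha y)).
Proof.
move=> oU Ha I k; apply: (CD_eq oU _ (CDZ (h #|I|) oU (Ha I k))) => y _; by rewrite dscaleE.
Qed.

Lemma smooth_det U m (B : 'rV[R]_n -> 'M[R]_m) : open U -> smooth_mx U B ->
  smooth_on U (fun y => \det (B y)).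
Proof.
move=> oU HB k; apply: CD_sum => // s _; apply: CDZ => //.
by apply: CD_prod => // i _; exact: HB.
Qed.

Lemma smooth_invmx U m (B : 'rV[R]_n -> 'M[R]_m) : open U -> smooth_mx U B ->
  (forall y, U y -> \det (B y) != 0) -> smooth_mx U (fun y => invmx (B y)).
Proof.
move=> oU HB B0 i j k.
have H : smooth_on U (fun y => cofactor (B y) j i).
  move=> l; apply: CDZ => //; apply: smooth_det => // a b.
  suff : smooth_on U (fun y => B y (lift j a) (lift i b)).
    by move=> H l'; apply: CD_eq (H l') => // y _; rewrite !mxE.
  exact: HB.
have := CDM oU (CDV oU B0 (smooth_det oU HB k)) (H k).
apply: CD_eq => // y Uy; rewrite /invmx unitmxE unitfE B0 //= mxE; congr (_ * _).
by rewrite mxE.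
Qed.

Lemma smooth_hodge U (g : 'rV[R]_n -> 'M[R]_n) alpha : open U -> smooth_mx U g ->
  (forall y, U y -> 0 < \det (g y)) -> smooth_form U alpha ->
  smooth_form U (fun y => hodge (g y) (alpha y)).
Proof.
move=> oU Hg g0 Ha.
have Hi : smooth_mx U (fun y => invmx (g y)).
  by apply: smooth_invmx => // y /g0; rewrite lt0r => /andP[].
have Hm := smooth_ext_map oU Hi Ha.
have : smooth_form U (fun y => Num.sqrt (\det (g y)) *: star (ext_map (invmx (g y)) (alpha y))).
  apply: smooth_formZ => //; first by move=> k; apply: CD_sqrt => //; exact: smooth_det.
  move=> K k; apply: (CD_eq oU _ (CDZ (shuffle_sign R (~: K)%SET K) oU (Hm (~: K)%SET k))) => y _.
  by rewrite starE.
by apply: smooth_form_eq => // y _; rewrite hodgeE.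
Qed.

Lemma smooth_wedge_exp U alpha : open U -> smooth_form U alpha ->
  smooth_form U (fun y => wedge_exp (alpha y)).
Proof.
move=> oU Ha; apply: smooth_form_sum => // k _; apply: smooth_formZ => //.
  by move=> l; exact: CD_cst.
elim: (nat_of_ord k) => [|j IH] /=; first exact: smooth_form_cst.
exact: smooth_wedge.
Qed.

Lemma smooth_partial U f i : smooth_on U f -> smooth_on U (partial i f).
Proof. by move=> Hf k; exact: CD_partial (Hf k.+1). Qed.

Definition pdiff i alpha y : ext R n := [ffun I : {set 'I_n} => partial i (fun z => alpha z I) y].

Lemma pdiffE i alpha y I : pdiff i alpha y I = partial i (fun z => alpha z I) y.
Proof. by rewrite ffunE. Qed.

Lemma smooth_pdiff U alpha i : open U -> smooth_form U alpha -> smooth_form U (pdiff i alpha).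
Proof.
by move=> oU Ha I k; apply: CD_eq (smooth_partial i (Ha I) k) => // y _; rewrite pdiffE.
Qed.

Definition dext alpha y : ext R n := \sum_i wedge (ebase R [set i]%SET) (pdiff i alpha y).

Lemma smooth_dext U alpha : open U -> smooth_form U alpha -> smooth_form U (dext alpha).
Proof.
move=> oU Ha; apply: smooth_form_sum => // i _; apply: smooth_wedge => //.
  exact: smooth_form_cst.
exact: smooth_pdiff.
Qed.

Lemma smooth_derivable U f i y : smooth_on U f -> U y -> derivable f y (e i).
Proof. by move=> Hf; exact: CD_derivable (Hf 1%N). Qed.

Lemma pdiff_eq U alpha beta i y : open U -> (forall z, U z -> alpha z = beta z) -> U y ->
  pdiff i alpha y = pdiff i beta y.
Proof.
move=> oU ab Uy; apply/ffunP => I; rewrite !pdiffE; apply: near_eq_derive.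
by apply: (near_eq_on oU _ Uy) => z Uz; rewrite ab.
Qed.

Lemma dext_eq U alpha beta y : open U -> (forall z, U z -> alpha z = beta z) -> U y ->
  dext alpha y = dext beta y.
Proof.
by move=> oU ab Uy; apply: eq_bigr => i _; rewrite (pdiff_eq i oU ab Uy).
Qed.

Lemma is_derive_bigsum (T : Type) (r : seq T) (P : pred T) (F : T -> 'rV[R]_n -> R)
    (dF : T -> R) y v : (forall t, P t -> is_derive y v (F t) (dF t)) ->
  is_derive y v (fun z => \sum_(t <- r | P t) F t z) (\sum_(t <- r | P t) dF t).
Proof.
move=> H; elim: r => [|t r IH].
  rewrite big_nil (_ : (fun _ => _) = cst 0); first exact: is_derive_cst.
  by apply/funext => z; rewrite big_nil.
rewrite big_cons; case Pt: (P t).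
  rewrite (_ : (fun _ => _) = F t + (fun z => \sum_(t <- r | P t) F t z)); last first.
    by apply/funext => z; rewrite big_cons Pt.
  by apply: is_deriveD => //; exact: H.
rewrite (_ : (fun _ => _) = (fun z => \sum_(t <- r | P t) F t z)) //.
by apply/funext => z; rewrite big_cons Pt.
Qed.

Lemma pdiff_wedge U alpha beta i y : smooth_form U alpha -> smooth_form U beta -> U y ->
  pdiff i (fun z => wedge (alpha z) (beta z)) y =
  wedge (pdiff i alpha y) (beta y) + wedge (alpha y) (pdiff i beta y).
Proof.
move=> Ha Hb Uy; apply/ffunP => K; rewrite pdiffE extD !wedgeE -big_split /=.
rewrite /partial (_ : (fun z => _) = (fun z => \sum_(I : {set 'I_n} | I \subset K)
   shuffle_sign R I (K :\: I)%SET * (alpha z I * beta z (K :\: I)%SET))); last first.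
  by apply/funext => z; rewrite wedgeE.
apply: derive_val; apply: is_derive_bigsum => I _; rewrite !pdiffE -mulrDr.
have da := derivableP (@smooth_derivable U _ i y (Ha I) Uy).
have db := derivableP (@smooth_derivable U _ i y (Hb (K :\: I)%SET) Uy).
have H := is_deriveZ (shuffle_sign R I (K :\: I)%SET) (is_deriveM da db).
have E (s a b a' b' : R) : s *: (a *: b' + b *: a') = s * (a' * b + a * b').
  by rewrite /GRing.scale /= addrC [b * a']mulrC.
by rewrite E in H; exact: H.
Qed.

Lemma pdiffD U alpha beta i y : smooth_form U alpha -> smooth_form U beta -> U y ->
  pdiff i (fun z => alpha z + beta z) y = pdiff i alpha y + pdiff i beta y.
Proof.
move=> Ha Hb Uy; apply/ffunP => K; rewrite pdiffE extD !pdiffE /partial.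
rewrite (_ : (fun z => _) = (fun z => alpha z K) + (fun z => beta z K)).
  by rewrite deriveD //; [exact: smooth_derivable (Ha K) Uy|exact: smooth_derivable (Hb K) Uy].
by apply/funext => z; rewrite extD.
Qed.

Lemma dextD U alpha beta y : smooth_form U alpha -> smooth_form U beta -> U y ->
  dext (fun z => alpha z + beta z) y = dext alpha y + dext beta y.
Proof.
move=> Ha Hb Uy; rewrite /dext -big_split /=; apply: eq_bigr => i _.
by rewrite (pdiffD i Ha Hb Uy) wedgeDr.
Qed.

Lemma dext_sum U (T : Type) (r : seq T) (P : pred T) (F : T -> 'rV[R]_n -> ext R n) y : open U ->
  (forall t, P t -> smooth_form U (F t)) -> U y ->
  dext (fun z => \sum_(t <- r | P t) F t z) y = \sum_(t <- r | P t) dext (F t) y.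
Proof.
move=> oU HF Uy; rewrite /dext exchange_big /=; apply: eq_bigr => i _.
rewrite -wedge_sumr; congr wedge; apply/ffunP => K; rewrite pdiffE ext_sum /partial.
rewrite (_ : (fun z => _) = (fun z => \sum_(t <- r | P t) F t z K)); last first.
  by apply/funext => z; rewrite ext_sum.
apply: derive_val; apply: is_derive_bigsum => t Pt; rewrite pdiffE.
by apply: derivableP; exact: smooth_derivable (HF t Pt K) Uy.
Qed.

Lemma dext_wedge U alpha beta y : smooth_form U alpha -> smooth_form U beta -> U y ->
  dext (fun z => wedge (alpha z) (beta z)) y =
  wedge (dext alpha y) (beta y) + wedge (tilde (alpha y)) (dext beta y).
Proof.
move=> Ha Hb Uy; rewrite /dext wedge_suml wedge_sumr -big_split /=; apply: eq_bigr => i _.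
have d1 : has_degree 1 (ebase R [set i]%SET) by rewrite -(cards1 i); exact: degree_ebase.
rewrite (pdiff_wedge i Ha Hb Uy) wedgeDr !wedgeA; congr (_ + wedge _ _).
by rewrite (wedge_degree1 _ d1) tildeK.
Qed.

Lemma pdiff_cst i a y : pdiff i (fun=> a) y = 0.
Proof. by apply/ffunP => I; rewrite pdiffE partial_cst ext0. Qed.

Lemma dext_cst a y : dext (fun=> a) y = 0.
Proof. by rewrite /dext big1 // => i _; rewrite pdiff_cst wedge0r. Qed.

Lemma pdiffZ U f alpha i y : smooth_on U f -> smooth_form U alpha -> U y ->
  pdiff i (fun z => f z *: alpha z) y = partial i f y *: alpha y + f y *: pdiff i alpha y.
Proof.
move=> Hf Ha Uy; apply/ffunP => I; rewrite extD !extZ !pdiffE.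
have df := @smooth_derivable U _ i y Hf Uy; have da := @smooth_derivable U _ i y (Ha I) Uy.
rewrite /partial (_ : (fun z => _) = f * (fun z => alpha z I)).
  by rewrite (deriveM df da) addrC; congr (_ + _); exact: mulrC.
by apply/funext => z; rewrite extZ.
Qed.

Lemma dextZ U f alpha y : smooth_on U f -> smooth_form U alpha -> U y ->
  dext (fun z => f z *: alpha z) y =
  wedge (covector (fun i => partial i f y)) (alpha y) + f y *: dext alpha y.
Proof.
move=> Hf Ha Uy; rewrite covectorE wedge_suml /dext scaler_sumr -big_split /=.
apply: eq_bigr => i _; rewrite (pdiffZ i Hf Ha Uy) wedgeDr !wedgeZr; congr (_ + _).
by rewrite wedgeZl.
Qed.

Lemma dext_top alpha y : dext alpha y finset.setT =
  \sum_i shuffle_sign R [set i]%SET (~: [set i])%SET * partial i (fun z => alpha z (~: [set i])%SET) y.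
Proof.
rewrite /dext ext_sum; apply: eq_bigr => i _.
rewrite wedge_top (bigD1 [set i]%SET) //= big1 ?addr0 => [|J Ji].
  by rewrite ebaseE eqxx mul1r pdiffE.
by rewrite ebaseE (negbTE Ji) mul0r mulr0.
Qed.

Section Pullback.
Variables (U V : set 'rV[R]_n) (F : 'rV[R]_n -> 'rV[R]_n).
Hypotheses (oU : open U) (oV : open V) (UV : forall y, U y -> V (F y)).
Hypothesis (HF : forall j, smooth_on U (fun y => F y 0 j)).

Definition pull alpha y : ext R n := ext_map (jac F y) (alpha (F y)).

Lemma smooth_jac : smooth_mx U (jac F).
Proof.
by move=> i j k; apply: CD_eq (smooth_partial i (HF j) k) => // y _; rewrite mxE.
Qed.

Lemma smooth_comp f : smooth_on V f -> smooth_on U (fun y => f (F y)).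
Proof. by move=> Hf k; apply: CD_comp (Hf k) => // j; exact: HF. Qed.

Lemma smooth_pull alpha : smooth_form V alpha -> smooth_form U (pull alpha).
Proof.
move=> Ha; apply: smooth_ext_map => //; first exact: smooth_jac.
by move=> I; exact: (smooth_comp (Ha I)).
Qed.

(** This is d o d = 0 for a component of F: a symmetric matrix of second derivatives is paired with
    the anticommuting products of basis covectors. *)
Lemma dext_dF j y : U y -> dext (fun z => covector (fun i => jac F z i j)) y = 0.
Proof.
move=> Uy; pose a k l := partial k (partial l (fun z => F z 0 j)) y.
have E : dext (fun z => covector (fun i => jac F z i j)) y =
    \sum_k \sum_l a k l *: wedge (ebase R [set k]%SET) (ebase R [set l]%SET).
  apply: eq_bigr => k _.
  have -> : pdiff k (fun z => covector (fun i => jac F z i j)) y = \sum_l a k l *: ebase R [set l]%SET.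
    rewrite -covectorE; apply/ffunP => I; rewrite pdiffE /partial.
    rewrite (_ : (fun z => _) = (fun z => \sum_l (I == [set l]%SET)%:R * partial l (fun z => F z 0 j) z)).
      rewrite [RHS]ffunE; apply: derive_val; apply: is_derive_bigsum => l _.
      apply: is_deriveZ; apply: derivableP.
      exact: smooth_derivable (smooth_partial l (HF j)) Uy.
    by apply/funext => z; rewrite ffunE; apply: eq_bigr => l _; rewrite mxE.
  by rewrite wedge_sumr; apply: eq_bigr => l _; rewrite wedgeZr.
have aS k l : a k l = a l k by exact: (schwarz k l oU (HF j 2%N) Uy).
rewrite E; clearbody a; set s := \sum_k _.
have S : s = - s.
  rewrite {1}/s exchange_big /s -sumrN; apply: eq_bigr => k _.
  by rewrite -sumrN; apply: eq_bigr => l _; rewrite aS ebase1C scalerN.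
apply/ffunP => I; have := congr1 (fun b : ext R n => b I) S; rewrite /= extN ext0; lra.
Qed.

(** The pullback of dx^J is a wedge of differentials of components of F, hence closed. So d falls
    only on the coefficients, where it is the chain rule. *)
Lemma dext_pull alpha y : smooth_form V alpha -> U y ->
  dext (pull alpha) y = pull (dext alpha) y.
Proof.
move=> Ha Uy.
pose W J z := ext_map (jac F z) (ebase R J).
have HW J : smooth_form U (W J).
  by apply: smooth_ext_map => //; [exact: smooth_jac|exact: smooth_form_cst].
have Hc i : smooth_form U (fun z => covector (fun k => jac F z k i)).
  by apply: smooth_covector => // k; exact: smooth_jac.
have dW J : dext (W J) y = 0.
  elim/set_ind: J => [|i J iJ IH].
    rewrite (_ : W finset.set0 = fun=> ext1); first exact: dext_cst.
    by apply/funext => z; rewrite /W ebase0 ext_map_ext1.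
  rewrite (_ : W (i |: J)%SET = fun z => shuffle_sign R [set i]%SET J *:
     wedge (covector (fun k => jac F z k i)) (W J z)); last first.
    by apply/funext => z; rewrite /W ebaseU1 // ext_mapZ ext_mapM ext_map_ebase1.
  rewrite (dextZ _ _ Uy) ?(dext_wedge (Hc i) (HW J) Uy).
  - rewrite IH wedge0r addr0 dext_dF // wedge0l scaler0 addr0.
    rewrite (_ : covector _ = 0) ?wedge0l // covectorE big1 // => k _.
    by rewrite partial_cst scale0r.
  - by move=> k; exact: CD_cst.
  - exact: smooth_wedge.
have paE z : pull alpha z = \sum_J alpha (F z) J *: W J z.
  rewrite /pull {1}(ext_expand (alpha (F z))) ext_map_sum.
  by apply: eq_bigr => J _; rewrite ext_mapZ.
have HaF J : smooth_on U (fun z => alpha (F z) J) by exact: (smooth_comp (Ha J)).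
rewrite (_ : pull alpha = fun z => \sum_J alpha (F z) J *: W J z); last exact/funext.
rewrite (@dext_sum U _ _ _ _ y oU _ Uy) => [|J _]; last exact: smooth_formZ.
transitivity (\sum_J wedge (ext_map (jac F y) (covector (fun i => partial i (fun z => alpha z J) (F y)))) (W J y)).
  apply: eq_bigr => J _; rewrite (dextZ (HaF J) (HW J) Uy) dW scaler0 addr0; congr wedge.
  rewrite ext_map_covector; congr covector; apply/funext => i.
  apply: derive_val; apply: is_derive_comp => [|j].
    exact: (C1_differentiable oV (Ha J 1%N) (UV Uy)).
  exact: (C1_differentiable oU (HF j 1%N) Uy).
rewrite /pull; transitivity (ext_map (jac F y) (\sum_J wedge (covector (fun i => partial i (fun z => alpha z J) (F y))) (ebase R J))).
  by rewrite ext_map_sum; apply: eq_bigr => J _; rewrite ext_mapM.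
congr ext_map; rewrite /dext.
transitivity (\sum_J \sum_i partial i (fun z => alpha z J) (F y) *: wedge (ebase R [set i]%SET) (ebase R J)).
  apply: eq_bigr => J _; rewrite covectorE wedge_suml; apply: eq_bigr => i _.
  by rewrite wedgeZl.
rewrite exchange_big; apply: eq_bigr => i _.
rewrite [pdiff i alpha _]ext_expand wedge_sumr; apply: eq_bigr => J _.
by rewrite wedgeZr pdiffE.
Qed.

End Pullback.
End SmoothForms.

(** * Integrals of compactly supported functions *)

Section Integral1.
Variable R : realType.
Local Notation mu := (@lebesgue_measure R).
Implicit Types (f g F : R -> R) (S T u : R).

Lemma restrict_in (X : Type) (A : set X) (f : X -> R) x : A x -> (f \_ A) x = f x.
Proof. by move=> Ax; rewrite patchE mem_set. Qed.
Lemma restrict_out (X : Type) (A : set X) (f : X -> R) x : ~ A x -> (f \_ A) x = 0.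
Proof. by move=> Ax; rewrite patchE memNset. Qed.

Lemma near_dist (t d : R) : 0 < d -> \forall t' \near t, `|t - t'| < d.
Proof. by move=> d0; apply/nbhs_ballP; exists d. Qed.

Lemma int_zero (A : set R) f : measurable A -> (forall t, A t -> f t = 0) ->
  \int[mu]_(t in A) f t = 0.
Proof.
move=> mA f0; rewrite (@eq_Rintegral _ _ _ mu A (cst 0)) ?Rintegral_cst ?mul0r //.
by move=> t /set_mem/f0.
Qed.

Lemma derive1_continuous f (df : R -> R) : (forall t : R, is_derive t (1 : R) f (df t)) -> continuous f.
Proof.
by move=> d t; apply: differentiable_continuous; apply/derivable1_diffP; case: (d t).
Qed.

Definition cc1 S f : Prop := continuous f /\ forall t, S < `|t| -> f t = 0.

Lemma cc1_integrable S f : cc1 S f -> mu.-integrable setT (EFin \o f).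
Proof.
move=> [cf f0]; pose A := `[- `|S|, `|S|]%classic : set R.
have fA : f = f \_ A.
  apply/funext => t; have [tA|tA] := pselect (A t); first by rewrite restrict_in.
  rewrite restrict_out // f0 // ltNge; apply/negP => tS; apply: tA.
  rewrite /A /= in_itv /= -ler_norml; exact: le_trans tS (ler_norm _).
have H : mu.-integrable A (EFin \o f).
  by apply: continuous_compact_integrable; [exact: segment_compact|exact: continuous_subspaceT].
have := (@integrable_mkcond _ _ _ mu A (EFin \o f) (measurable_itv _)).1 H; rewrite restrict_EFin.
by rewrite -fA.
Qed.

Lemma cc1_integrableA S f (A : set R) : measurable A -> cc1 S f -> mu.-integrable A (EFin \o f).
Proof. by move=> mA /cc1_integrable H; apply: integrableS H => //; exact: measurableT. Qed.

(** Starting at -oo makes the primitive vanish to the left of the support and equal the full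
    integral to the right of it; integrals over R can then be found by comparing derivatives. *)
Definition prim f u : R := \int[mu]_(t in `]-oo, u]) f t.

Lemma prim_derive S f u : cc1 S f -> is_derive u (1 : R) (prim f) (f u).
Proof.
move=> fS; have uu : u < u + 1 by rewrite ltrDl.
have [d dE] := @continuous_FTC1 R f -oo%O u (u + 1) uu
  (cc1_integrableA (measurable_itv _) fS) (ltNyr _) (fS.1 u).
by split; [exact: d|rewrite -derive1E dE].
Qed.

Lemma prim_lo S f u : cc1 S f -> u < - S -> prim f u = 0.
Proof.
move=> fS uS; apply: int_zero; first exact: measurable_itv.
move=> t /=; rewrite in_itv /= => tu; rewrite fS.2 //.
by have [t0|t0] := leP 0 t; [rewrite ger0_norm //; lra|rewrite ltr0_norm //; lra].
Qed.

Lemma prim_hi S f u : cc1 S f -> S <= u -> prim f u = \int[mu]_(t in setT) f t.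
Proof.
move=> fS Su; rewrite /prim Rintegral_mkcond; apply: eq_Rintegral => t _.
have [tu|ut] := leP t u; first by rewrite restrict_in //= in_itv.
rewrite restrict_out ?fS.2 //; first by apply: le_lt_trans Su (lt_le_trans ut (ler_norm _)).
by rewrite /= in_itv /= leNgt ut.
Qed.

Lemma prim_unique S f F T u : cc1 S f -> S < T -> (forall t : R, is_derive t (1 : R) F (f t)) ->
  prim f u = F u - F (- T).
Proof.
move=> fS ST dF.
have H (t : R) : is_derive t (1 : R) (fun x => prim f x - F x) 0.
  have := @is_deriveB _ _ _ _ _ _ _ _ _ (prim_derive t fS) (dF t).
  by rewrite subrr.
have E : prim f u - F u = prim f (- T) - F (- T) := @is_derive_0_is_cst R _ u (- T) H.
by rewrite (prim_lo (u := - T) fS) ?ltrN2 // sub0r in E; rewrite -E addrC subrK.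
Qed.

Lemma int_unique S f F T : cc1 S f -> S < T -> (forall t : R, is_derive t (1 : R) F (f t)) ->
  \int[mu]_(t in setT) f t = F T - F (- T).
Proof. by move=> fS ST dF; rewrite -(prim_hi fS (ltW ST)) (prim_unique T fS ST dF). Qed.

Lemma prim_bound S f T u (eps : R) : cc1 S f -> S < T -> (forall t, `|f t| <= eps) ->
  `|prim f u| <= (`|u| + `|T|) * eps.
Proof.
move=> fS ST fe.
have dp t := prim_derive t fS; have cp := derive1_continuous dp.
have e0 : 0 <= eps by apply: le_trans (fe 0).
have mvt a b : a <= b -> `|prim f b - prim f a| <= (b - a) * eps.
  move=> ab; have [c _ ->] := @MVT_segment _ (prim f) f a b ab (fun t _ => dp t) (continuous_subspaceT cp).
  by rewrite normrM mulrC [`|b - a|]ger0_norm ?subr_ge0 // ler_wpM2l // subr_ge0.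
have lo : prim f (- T) = 0 by rewrite (prim_lo fS) // ltrN2.
have [Tu|uT] := leP (- T) u.
  have := mvt _ _ Tu; rewrite lo subr0 => /le_trans; apply; rewrite ler_wpM2r //.
  have := ler_norm u; have := ler_norm T; lra.
by rewrite (prim_lo fS) ?normr0 ?mulr_ge0 ?addr_ge0 //; lra.
Qed.

Lemma int_bound S f T (eps : R) : cc1 S f -> S < T -> 0 <= T -> (forall t, `|f t| <= eps) ->
  `|\int[mu]_(t in setT) f t| <= 2 * T * eps.
Proof.
move=> fS ST T0 fe; rewrite -(prim_hi fS (ltW ST)).
apply: le_trans (prim_bound T fS ST fe) _; rewrite ger0_norm //.
by rewrite -mulr2n [2 * T]mulr_natl.
Qed.

Lemma cc1Z S c f : cc1 S f -> cc1 S (fun t => c * f t).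
Proof.
move=> [cf f0]; split; first by move=> t; apply: continuousM; [exact: cst_continuous|exact: cf].
by move=> t St; rewrite f0 // mulr0.
Qed.
Lemma cc1B S f g : cc1 S f -> cc1 S g -> cc1 S (fun t => f t - g t).
Proof.
move=> [cf f0] [cg g0]; split; first by move=> t; apply: continuousB; [exact: cf|exact: cg].
by move=> t St; rewrite f0 // g0 // subr0.
Qed.
Lemma cc1_le S T f : S <= T -> cc1 S f -> cc1 T f.
Proof. by move=> ST [cf f0]; split=> // t Tt; apply: f0; exact: le_lt_trans ST Tt. Qed.

Lemma primB S f g u : cc1 S f -> cc1 S g -> prim (fun t => f t - g t) u = prim f u - prim g u.
Proof.
move=> fS gS; rewrite /prim RintegralB //; first exact: cc1_integrableA fS.
exact: cc1_integrableA gS.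
Qed.
Lemma int1D S f g : cc1 S f -> cc1 S g ->
  \int[mu]_(t in setT) (f t + g t) = \int[mu]_(t in setT) f t + \int[mu]_(t in setT) g t.
Proof. by move=> fS gS; rewrite RintegralD //; [exact: cc1_integrable fS|exact: cc1_integrable gS]. Qed.
Lemma int1Z S c f : cc1 S f -> \int[mu]_(t in setT) (c * f t) = c * \int[mu]_(t in setT) f t.
Proof. by move=> fS; rewrite RintegralZl //; exact: cc1_integrable fS. Qed.

Lemma cc1_comp_affine S f (a b : R) : a != 0 -> cc1 S f -> cc1 ((`|S| + `|b|) / `|a|) (fun t => f (a * t + b)).
Proof.
move=> a0 [cf f0]; split.
  move=> t; apply: continuous_comp; last exact: cf.
  by apply: continuousD; [apply: continuousM; [exact: cst_continuous|exact: cvg_id]|exact: cst_continuous].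
move=> t; rewrite ltr_pdivrMr ?normr_gt0 // => H; apply: f0.
have := ler_normB (a * t + b) b; rewrite addrK normrM.
have := ler_norm S; move: H; rewrite mulrC; lra.
Qed.

(** A primitive of the integrand is [a^-1 * prim f (a * t + b)]. The sign of a decides at which end
    it reaches its full value, whence the absolute value. *)
Lemma int1_affine S f (a b : R) : a != 0 -> cc1 S f ->
  `|a| * \int[mu]_(t in setT) f (a * t + b) = \int[mu]_(t in setT) f t.
Proof.
move=> a0 fS; have gS := cc1_comp_affine b a0 fS.
(* Large enough for a T + b and - a T + b to lie beyond the support of f on opposite sides. *)
set S' := (_ / _) in gS; pose T := `|S'| + (`|S| + `|b|) / `|a| + 1.
have na : 0 < `|a| by rewrite normr_gt0.
have S'T : S' < T.
  have := ler_norm S'; have : 0 <= (`|S| + `|b|) / `|a| by rewrite divr_ge0 // addr_ge0.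
  rewrite /T; lra.
have dF (t : R) : is_derive t (1 : R) (fun t => a^-1 * prim f (a * t + b)) (f (a * t + b)).
  have d1 : is_derive t (1 : R) (fun t : R => a * t + b) a.
    have := @is_deriveD _ _ _ _ _ _ _ _ _ (@is_deriveZ _ _ _ _ a _ _ _ (@is_derive_id _ _ t (1 : R))) (@is_derive_cst _ _ _ b t (1 : R)).
    by rewrite addr0 [_ *: _]mulr1.
  have d2 := @is_derive1_comp _ (prim f) (fun t : R => a * t + b) t _ _ (prim_derive (a * t + b) fS) d1.
  have := @is_deriveZ _ _ _ _ a^-1 _ _ _ d2.
  by rewrite /GRing.scale /= mulrCA mulVf // mulr1.
rewrite (int_unique gS S'T dF).
have aT : `|S| + `|b| < `|a| * T.
  rewrite /T !mulrDr mulr1 [`|a| * (_ / _)]mulrCA mulfV ?gt_eqF // mulr1.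
  have : 0 <= `|a| * `|S'| by rewrite mulr_ge0.
  lra.
have Sb u : S <= u + b -> prim f (u + b) = \int[mu]_(t in setT) f t by exact: prim_hi fS.
have Slo u : u + b < - S -> prim f (u + b) = 0 by exact: prim_lo fS.
have := ler_norm S; have := ler_norm b; have := ler_norm (- b); rewrite normrN => b1 b2 b3.
move: aT; have [a1|a1] := ltP 0 a => aT.
  rewrite Sb; last by move: aT; rewrite (gtr0_norm a1); lra.
  rewrite Slo; last by move: aT; rewrite (gtr0_norm a1) mulrN; lra.
  by rewrite (gtr0_norm a1) mulr0 subr0 mulrA mulfV // mul1r.
have {}a1 : a < 0 by rewrite lt_neqAle a0.
rewrite Slo; last by move: aT; rewrite (ltr0_norm a1); lra.
rewrite Sb; last by move: aT; rewrite (ltr0_norm a1) mulrN; lra.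
by rewrite (ltr0_norm a1) mulr0 sub0r mulrN mulNr opprK mulrA mulfV // mul1r.
Qed.

Lemma int1_ge0 f : (forall t, 0 <= f t) -> 0 <= \int[mu]_(t in setT) f t.
Proof. by move=> f0; apply: Rintegral_ge0. Qed.

Lemma int1_eq0 S f : cc1 S f -> (forall t, 0 <= f t) -> \int[mu]_(t in setT) f t = 0 ->
  forall t, f t = 0.
Proof.
move=> fS f0 I0.
have d t := prim_derive t fS; have cp := derive1_continuous d.
have mono a b : a <= b -> prim f a <= prim f b.
  move=> ab; have [c _ E] := @MVT_segment _ (prim f) f a b ab (fun t _ => d t) (continuous_subspaceT cp).
  by rewrite -subr_ge0 E mulr_ge0 // subr_ge0.
have z t : prim f t = 0.
  apply/eqP; rewrite eq_le; apply/andP; split.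
    rewrite -I0 -(prim_hi fS (u := Num.max S t)) ?le_max ?lexx //.
    by apply: mono; rewrite le_max lexx orbT.
  rewrite -(@prim_lo S f (Num.min (- S - 1) t)) //; first by apply: mono; rewrite ge_min lexx orbT.
  by rewrite gt_min; apply/orP; left; lra.
move=> t; have [_ <-] := d t; rewrite (_ : prim f = cst 0); first exact: derive_cst.
by apply/funext => u; rewrite z.
Qed.

(* Fubini for a function of two real variables with compact support, as the
   equality of two functions of the upper bound of the t-integral that have the
   same derivative. *)
Lemma swap2 S (G : R -> R -> R) :
  (forall t s, S < `|t| -> G t s = 0) -> (forall t s, S < `|s| -> G t s = 0) ->
  (forall eps : R, 0 < eps -> exists2 d : R, 0 < d & forall t t' s, `|t - t'| < d -> `|G t s - G t' s| <= eps) ->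
  (forall eps : R, 0 < eps -> exists2 d : R, 0 < d & forall t s s', `|s - s'| < d -> `|G t s - G t s'| <= eps) ->
  \int[mu]_(t in setT) \int[mu]_(s in setT) G t s = \int[mu]_(s in setT) \int[mu]_(t in setT) G t s.
Proof.
move=> Gt0 Gs0 Gt Gs.
wlog S0 : S Gt0 Gs0 / 0 <= S => [H|].
  apply: (H `|S|) => // t s St; [apply: Gt0|apply: Gs0]; exact: le_lt_trans (ler_norm _) St.
pose T := S + 1; have ST : S < T by rewrite ltrDl.
have T0 : 0 <= T by rewrite addr_ge0.
have ccs t : cc1 S (G t).
  split; last by move=> s; exact: Gs0.
  move=> s; apply/cvgrPdist_le => eps /(Gs _)[d d0 H].
  by apply: filterS (near_dist s d0) => s'; exact: H.
have cct s : cc1 S (G ^~ s).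
  split; last by move=> t; exact: Gt0.
  move=> t; apply/cvgrPdist_le => eps /(Gt _)[d d0 H].
  by apply: filterS (near_dist t d0) => t'; exact: H.
have ccA : cc1 S (fun t => \int[mu]_(s in setT) G t s).
  split=> [t|t St]; last first.
    by apply: int_zero => // s _; rewrite Gt0.
  apply/cvgrPdist_le => eps eps0.
  have e1 : 0 < eps / (2 * T + 1) by rewrite divr_gt0 //; lra.
  have [d d0 H] := Gt _ e1; apply: filterS (near_dist t d0) => t' tt'.
  have -> : \int[mu]_(s in setT) G t s - \int[mu]_(s in setT) G t' s = \int[mu]_(s in setT) (G t s - G t' s).
    by rewrite RintegralB //; apply: cc1_integrable; exact: ccs.
  apply: le_trans (int_bound (cc1B (ccs t) (ccs t')) ST T0 (fun s => H t t' s tt')) _.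
  rewrite mulrCA ler_piMr ?(ltW eps0) // ler_pdivrMr ?mul1r ?lerDl //; lra.
pose B u := \int[mu]_(s in setT) prim (G ^~ s) u.
have ccB u : cc1 S (fun s => prim (G ^~ s) u).
  split=> [s|s Ss]; last first.
    by apply: int_zero => [|t _]; [exact: measurable_itv|rewrite Gs0].
  apply/cvgrPdist_le => eps eps0.
  have e1 : 0 < eps / (`|u| + `|T| + 1) by rewrite divr_gt0 // ltr_wpDl // addr_ge0.
  have [d d0 H] := Gs _ e1; apply: filterS (near_dist s d0) => s' ss'.
  rewrite -(primB u (cct s) (cct s')).
  apply: le_trans (prim_bound u (cc1B (cct s) (cct s')) ST (fun t => H t s s' ss')) _.
  rewrite mulrCA ler_piMr ?(ltW eps0) // ler_pdivrMr ?mul1r ?lerDl // ltr_wpDl // addr_ge0 //.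
have dB (u : R) : is_derive u (1 : R) B (\int[mu]_(s in setT) G u s).
  suff H : (fun h : R => h^-1 *: (B (h *: (1 : R) + u) - B u)) @ 0^' --> \int[mu]_(s in setT) G u s.
    by split; [apply/cvg_ex; exists (\int[mu]_(s in setT) G u s)|exact: cvg_lim H].
  apply/cvgrPdist_le => eps eps0.
  have e1 : 0 < eps / (2 * T + 1) by rewrite divr_gt0 //; lra.
  have [d d0 H] := Gt _ e1; near=> h.
  have h0 : h != 0 by near: h; exact: nbhs_dnbhs_neq.
  have hd : `|h| < d by near: h; exact: dnbhs0_lt.
  rewrite [h *: 1]mulr1.
  have cB := cc1B (ccs u) (cc1Z h^-1 (cc1B (ccB (h + u)) (ccB u))).
  have -> : \int[mu]_(s in setT) G u s - h^-1 *: (B (h + u) - B u) =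
     \int[mu]_(s in setT) (G u s - h^-1 * (prim (G ^~ s) (h + u) - prim (G ^~ s) u)).
    rewrite RintegralB //; last 2 first.
    - exact: cc1_integrable (ccs u).
    - exact: cc1_integrable (cc1Z h^-1 (cc1B (ccB (h + u)) (ccB u))).
    congr (_ - _); rewrite (int1Z h^-1 (cc1B (ccB (h + u)) (ccB u))); congr (_ * _).
    by rewrite RintegralB //; apply: cc1_integrable; exact: ccB.
  apply: (@le_trans _ _ (2 * T * (eps / (2 * T + 1)))); last first.
    rewrite mulrCA ler_piMr ?(ltW eps0) // ler_pdivrMr ?mul1r ?lerDl //; lra.
  apply: (int_bound cB ST T0) => s.
  (* By the mean value theorem the difference quotient of the primitive is a value of G at some c
     within d of u; uniform continuity in t bounds the error for all s at once, which allows
     differentiation under the integral. *)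
  have [c cI E] : exists2 c, `|u - c| < d & prim (G ^~ s) (h + u) - prim (G ^~ s) u = G c s * h.
    have dp t := prim_derive t (cct s); have cp := derive1_continuous dp.
    have [hp|hn] := leP 0 h.
      have uh : u <= h + u by rewrite lerDr.
      have [c cI E] := @MVT_segment _ (prim (G ^~ s)) (G ^~ s) u (h + u) uh (fun t _ => dp t) (continuous_subspaceT cp).
      exists c; last by rewrite E addrK.
      move: cI hd; rewrite in_itv /= ger0_norm // => /andP[uc ch] hd.
      by rewrite ler0_norm ?subr_le0 //; lra.
    have uh : h + u <= u by rewrite gerDr ltW.
    have [c cI E] := @MVT_segment _ (prim (G ^~ s)) (G ^~ s) (h + u) u uh (fun t _ => dp t) (continuous_subspaceT cp).
    exists c; last by rewrite -opprB E opprD addrA addrAC subrr add0r mulrN opprK.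
    move: cI hd; rewrite in_itv /= ltr0_norm // => /andP[uc ch] hd.
    by rewrite ger0_norm ?subr_ge0 //; lra.
  by rewrite E mulrC mulfK //; exact: H.
rewrite (int_unique ccA ST dB) /B.
have -> : \int[mu]_(s in setT) prim (G ^~ s) (- T) = 0.
  by apply: int_zero => // s _; rewrite (prim_lo (cct s)) ?ltrN2.
rewrite subr0; apply: eq_Rintegral => s _; exact: prim_hi (cct s) (ltW ST).
Unshelve. all: by end_near. Qed.

End Integral1.

(** * Iterated integrals over R^n *)

Section IntegralN.
Variable R : realType.
Local Notation mu := (@lebesgue_measure R).

Section RowCons.
Variable m : nat.
Implicit Types (t : R) (y : 'rV[R]_m).

Definition rcons t y : 'rV[R]_m.+1 := row_mx (t%:M : 'rV[R]_1) y.

Lemma rcons0 t y : rcons t y 0 ord0 = t.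
Proof.
have -> : (ord0 : 'I_m.+1) = lshift m (0 : 'I_1) by apply/val_inj.
by rewrite /rcons (@row_mxEl _ 1 1 m) mxE eqxx mulr1n.
Qed.

Lemma rconsS t y j : rcons t y 0 (lift ord0 j) = y 0 j.
Proof.
have -> : lift ord0 j = rshift 1 j by apply/val_inj.
by rewrite /rcons (@row_mxEr _ 1 1 m).
Qed.

Lemma rcons_eta (v : 'rV[R]_m.+1) : v = rcons (v 0 ord0) (\row_j v 0 (lift ord0 j)).
Proof.
apply/rowP => j; have [k ->|->] := unliftP ord0 j; first by rewrite rconsS mxE.
by rewrite rcons0.
Qed.

Lemma rcons_inj_coord (v w : 'rV[R]_m.+1) : v 0 ord0 = w 0 ord0 ->
  (forall j, v 0 (lift ord0 j) = w 0 (lift ord0 j)) -> v = w.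
Proof.
by move=> v0 vS; apply/rowP => j; have [k ->|->] := unliftP ord0 j.
Qed.

Lemma rconsD t t' y y' : rcons t y + rcons t' y' = rcons (t + t') (y + y').
Proof.
by apply: rcons_inj_coord => [|j]; rewrite [LHS]mxE ?rcons0 // !rconsS mxE.
Qed.

Lemma rconsN t y : - rcons t y = rcons (- t) (- y).
Proof.
by apply: rcons_inj_coord => [|j]; rewrite [LHS]mxE ?rcons0 // !rconsS mxE.
Qed.

Lemma norm_rcons_l t y : `|t| <= `|rcons t y|.
Proof. by rewrite -{1}(rcons0 t y) coord_norm_le. Qed.

Lemma norm_rcons_r t y : `|y| <= `|rcons t y|.
Proof. by apply: rV_norm_le => // j; rewrite -(rconsS t) coord_norm_le. Qed.

Lemma norm_rcons_le t y r : `|t| <= r -> `|y| <= r -> `|rcons t y| <= r.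
Proof.
move=> tr yr; apply: rV_norm_le => [|j]; first exact: le_trans tr.
have [k ->|->] := unliftP ord0 j; last by rewrite rcons0.
by rewrite rconsS (le_trans _ yr) // coord_norm_le.
Qed.

Lemma continuous_rcons t : continuous (rcons t).
Proof.
move=> y; apply: rV_continuous => j; have [k ->|->] := unliftP ord0 j.
  rewrite (_ : (fun _ => _) = (fun y : 'rV[R]_m => y 0 k)); first exact: coord_continuous.
  by apply/funext => z; rewrite rconsS.
rewrite (_ : (fun _ => _) = (fun _ : 'rV[R]_m => t)); first exact: cst_continuous.
by apply/funext => z; rewrite rcons0.
Qed.

End RowCons.

Implicit Types (S T eps : R).
Definition Cc n S (f : 'rV[R]_n -> R) : Prop :=
  continuous f /\ forall y, S < `|y| -> f y = 0.

Lemma Cc_le n S T (f : 'rV[R]_n -> R) : S <= T -> Cc S f -> Cc T f.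
Proof. by move=> ST [cf f0]; split=> // y Ty; apply: f0; exact: le_lt_trans ST Ty. Qed.

(** Compactness provides d on the ball of radius S + 1. The margin 1 exceeds d, so if x lies outside
    that ball, both x and y lie outside the support. *)
Lemma Cc_unif n S (f : 'rV[R]_n -> R) : Cc S f -> forall eps, 0 < eps ->
  exists2 d : R, 0 < d & forall x y, `|x - y| < d -> `|f x - f y| <= eps.
Proof.
move=> [cf f0] eps eps0; pose K := [set x : 'rV[R]_n | `|x| <= S + 1].
have cK : compact K.
  apply: bounded_closed_compact.
    exists (S + 1); split; first exact: num_real.
    by move=> r Sr x /le_trans; apply; exact: ltW.
  apply: (@preimage_closed _ _ (fun x : 'rV[R]_n => `|x|) [set r | r <= S + 1]).
    by move=> x _; exact: norm_continuous.
  exact: closed_le.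
have /compact_near_coveringP/(_ R (0^'+) (fun d x => forall y, `|x - y| < d -> `|f x - f y| <= eps) _) := cK.
move=> H; have {}H : \forall d \near 0^'+, K `<=` (fun x => forall y, `|x - y| < d -> `|f x - f y| <= eps).
  apply: H => x _.
  have e2 : 0 < eps / 2 by rewrite divr_gt0.
  have /cvgrPdist_le/(_ _ e2)/nbhs_ballP[r /= r0 rP] := cf x.
  have r2 : 0 < r / 2 by rewrite divr_gt0.
  exists (ball x (r / 2), [set d | d < r / 2]).
    by split; [exact: nbhsx_ballx|exact: nbhs_right_lt].
  move=> [x' d] /= [xx' dr] y x'y.
  move: xx'; rewrite -ball_normE /= => xx'.
  have xy : `|x - y| < r by rewrite (le_lt_trans (ler_distD x' _ _)) // [ltRHS]splitr ltrD // (lt_trans x'y).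
  rewrite -(subrK (f x) (f x')) -addrA (le_trans (ler_normD _ _)) // [leRHS]splitr lerD //.
    rewrite distrC; apply: rP; rewrite -ball_normE /= (lt_trans xx') // ltr_pdivrMr // ltr_pMr // ltr1n //.
  by apply: rP; rewrite -ball_normE.
have [d [d0 d1 dP]] : exists d : R, [/\ 0 < d, d < 1 & K `<=` (fun x => forall y, `|x - y| < d -> `|f x - f y| <= eps)].
  near (0 : R)^'+ => d; exists d; split.
  - near: d; exact: nbhs_right_gt.
  - near: d; exact: nbhs_right_lt.
  - by near: d.
exists d => // x y xy; have [xK|xK] := leP `|x| (S + 1); first exact: (dP x).
rewrite !f0 ?subrr ?normr0 ?(ltW eps0) //; last lra.
by have := ler_distD y x 0; rewrite !subr0; lra.
Unshelve. all: by end_near. Qed.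

Definition slice m (f : 'rV[R]_m.+1 -> R) t : 'rV[R]_m -> R := fun y => f (rcons t y).

Lemma int_slice m (f : 'rV[R]_m.+1 -> R) :
  integral_rV f = \int[mu]_(t in setT) integral_rV (slice f t).
Proof. by []. Qed.

Lemma eq_int n (f g : 'rV[R]_n -> R) : (forall y, f y = g y) -> integral_rV f = integral_rV g.
Proof. by move=> fg; congr integral_rV; apply/funext. Qed.

Lemma Cc_slice m S (f : 'rV[R]_m.+1 -> R) t : Cc S f -> Cc S (slice f t).
Proof.
move=> [cf f0]; split=> [y|y Sy].
  by apply: continuous_comp; [exact: continuous_rcons|exact: cf].
by apply: f0; apply: lt_le_trans Sy (norm_rcons_r t y).
Qed.

Lemma CcD n S (f g : 'rV[R]_n -> R) : Cc S f -> Cc S g -> Cc S (fun y => f y + g y).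
Proof.
move=> [cf f0] [cg g0]; split; first by move=> t; apply: continuousD; [exact: cf|exact: cg].
by move=> t St; rewrite f0 // g0 // addr0.
Qed.
Lemma CcZ n S c (f : 'rV[R]_n -> R) : Cc S f -> Cc S (fun y => c * f y).
Proof.
move=> [cf f0]; split; first by move=> t; apply: continuousM; [exact: cst_continuous|exact: cf].
by move=> t St; rewrite f0 // mulr0.
Qed.
Lemma CcB n S (f g : 'rV[R]_n -> R) : Cc S f -> Cc S g -> Cc S (fun y => f y - g y).
Proof.
move=> [cf f0] [cg g0]; split; first by move=> t; apply: continuousB; [exact: cf|exact: cg].
by move=> t St; rewrite f0 // g0 // subr0.
Qed.

Lemma slice_dist m S (f : 'rV[R]_m.+1 -> R) : Cc S f -> forall eps, 0 < eps ->
  exists2 d : R, 0 < d & forall t t' y, `|t - t'| < d -> `|slice f t y - slice f t' y| <= eps.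
Proof.
move=> fS eps /(Cc_unif fS)[d d0 H]; exists d => // t t' y tt'; apply: H.
rewrite rconsN rconsD subrr; apply: le_lt_trans tt'.
by apply: norm_rcons_le => //; rewrite normr0.
Qed.

(** Proved together since they feed one another: linearity and the bound in dimension m + 1
    integrate slice integrals, whose continuity is the last clause for m; the last clause itself
    follows from linearity and the bound in the same dimension. *)
Lemma int_basics m :
  [/\ forall S (f g : 'rV[R]_m -> R), Cc S f -> Cc S g ->
        integral_rV (fun y => f y + g y) = integral_rV f + integral_rV g,
      forall S c (f : 'rV[R]_m -> R), Cc S f -> integral_rV (fun y => c * f y) = c * integral_rV f,
      forall S T eps (f : 'rV[R]_m -> R), Cc S f -> S < T -> 0 <= T -> (forall y, `|f y| <= eps) ->
        `|integral_rV f| <= (2 * T) ^+ m * eps &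
      forall S (f : 'rV[R]_m.+1 -> R), Cc S f -> cc1 S (fun t => integral_rV (slice f t))].
Proof.
elim: m => [|m [IHD IHZ IHb IHc]].
  split=> [//|//|S T eps f fS ST T0 fe|S f fS]; first by rewrite expr0 mul1r; exact: fe.
  split=> [t|t St]; last by apply: fS.2; apply: lt_le_trans St (norm_rcons_l _ _).
  apply/cvgrPdist_le => eps /(slice_dist fS)[d d0 H].
  by apply: filterS (near_dist t d0) => t' tt'; exact: H.
have D S (f g : 'rV[R]_m.+1 -> R) : Cc S f -> Cc S g ->
    integral_rV (fun y => f y + g y) = integral_rV f + integral_rV g.
  move=> fS gS; rewrite !int_slice -(int1D (IHc _ _ fS) (IHc _ _ gS)).
  by apply: eq_Rintegral => t _; exact: (IHD S _ _ (Cc_slice t fS) (Cc_slice t gS)).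
have Z S c (f : 'rV[R]_m.+1 -> R) : Cc S f ->
    integral_rV (fun y => c * f y) = c * integral_rV f.
  move=> fS; rewrite !int_slice -(int1Z c (IHc _ _ fS)).
  by apply: eq_Rintegral => t _; exact: (IHZ S c _ (Cc_slice t fS)).
have b S T eps (f : 'rV[R]_m.+1 -> R) : Cc S f -> S < T -> 0 <= T -> (forall y, `|f y| <= eps) ->
    `|integral_rV f| <= (2 * T) ^+ m.+1 * eps.
  move=> fS ST T0 fe; rewrite int_slice exprS -mulrA.
  apply: (int_bound (IHc _ _ fS) ST T0) => t.
  by apply: (IHb S T eps _ (Cc_slice t fS) ST T0) => y; exact: fe.
split=> // S f fS; split=> [t|t St]; last first.
  have /eq_int-> : forall y, slice f t y = 0 * slice f t y.
    by move=> y; rewrite mul0r; apply: fS.2; exact: lt_le_trans St (norm_rcons_l _ _).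
  by rewrite (Z S 0 _ (Cc_slice t fS)) mul0r.
apply/cvgrPdist_le => eps eps0; pose T := `|S| + 1.
have ST : S < T by rewrite (le_lt_trans (ler_norm S)) // ltrDl.
have T0 : 0 <= T by rewrite addr_ge0.
have C0 : 0 <= (2 * T) ^+ m.+1 by rewrite exprn_ge0 // mulr_ge0.
have e1 : 0 < eps / ((2 * T) ^+ m.+1 + 1) by rewrite divr_gt0 // ltr_wpDl.
have [d d0 H] := slice_dist fS e1; apply: filterS (near_dist t d0) => t' tt'.
have -> : integral_rV (slice f t) - integral_rV (slice f t') =
    integral_rV (fun y => slice f t y + -1 * slice f t' y).
  rewrite (D S _ _ (Cc_slice t fS) (CcZ (-1) (Cc_slice t' fS))).
  by rewrite (Z S (-1) _ (Cc_slice t' fS)) mulN1r.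
have cS := CcD (Cc_slice t fS) (CcZ (-1) (Cc_slice t' fS)).
have Hb y : `|slice f t y + -1 * slice f t' y| <= eps / ((2 * T) ^+ m.+1 + 1).
  by rewrite mulN1r; exact: H.
apply: le_trans (b S T _ _ cS ST T0 Hb) _.
rewrite mulrCA ler_piMr ?(ltW eps0) // ler_pdivrMr ?mul1r ?lerDl //; exact: ltr_wpDl.
Qed.

Lemma intD m S (f g : 'rV[R]_m -> R) : Cc S f -> Cc S g ->
  integral_rV (fun y => f y + g y) = integral_rV f + integral_rV g.
Proof. by case: (int_basics m) => + _ _ _; apply. Qed.
Lemma intZ m S c (f : 'rV[R]_m -> R) : Cc S f -> integral_rV (fun y => c * f y) = c * integral_rV f.
Proof. by case: (int_basics m) => _ + _ _; apply. Qed.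
Lemma intN_bound m S T eps (f : 'rV[R]_m -> R) : Cc S f -> S < T -> 0 <= T ->
  (forall y, `|f y| <= eps) -> `|integral_rV f| <= (2 * T) ^+ m * eps.
Proof. by case: (int_basics m) => _ _ + _; apply. Qed.
Lemma cc1_slice m S (f : 'rV[R]_m.+1 -> R) : Cc S f -> cc1 S (fun t => integral_rV (slice f t)).
Proof. by case: (int_basics m) => _ _ _; apply. Qed.

Lemma intB m S (f g : 'rV[R]_m -> R) : Cc S f -> Cc S g ->
  integral_rV (fun y => f y - g y) = integral_rV f - integral_rV g.
Proof.
move=> fS gS; have := intD fS (CcZ (-1) gS); rewrite (intZ _ gS) mulN1r => <-.
by apply: eq_int => y; rewrite mulN1r.
Qed.

Lemma Cc0 n S : Cc S (fun _ : 'rV[R]_n => 0).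
Proof. by split=> // y; exact: cst_continuous. Qed.

Lemma int0 n : integral_rV (fun _ : 'rV[R]_n => 0 : R) = 0.
Proof.
transitivity (integral_rV (fun _ : 'rV[R]_n => 0 * 0 : R)); first by apply: eq_int => y; rewrite mulr0.
by rewrite (intZ 0 (@Cc0 n 0)) mul0r.
Qed.

Lemma Cc_sum n S (I : Type) (r : seq I) (P : pred I) (F : I -> 'rV[R]_n -> R) :
  (forall i, P i -> Cc S (F i)) -> Cc S (fun y => \sum_(i <- r | P i) F i y).
Proof.
move=> HF; elim: r => [|i r IH].
  by rewrite (_ : (fun _ => _) = fun=> 0); [exact: Cc0|apply/funext => y; rewrite big_nil].
case Pi: (P i).
  rewrite (_ : (fun _ => _) = fun y => F i y + \sum_(i <- r | P i) F i y).
    by apply: CcD IH; exact: HF.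
  by apply/funext => y; rewrite big_cons Pi.
rewrite (_ : (fun _ => _) = fun y => \sum_(i <- r | P i) F i y) //.
by apply/funext => y; rewrite big_cons Pi.
Qed.

Lemma int_sum n S (I : Type) (r : seq I) (P : pred I) (F : I -> 'rV[R]_n -> R) :
  (forall i, P i -> Cc S (F i)) ->
  integral_rV (fun y => \sum_(i <- r | P i) F i y) = \sum_(i <- r | P i) integral_rV (F i).
Proof.
move=> HF; elim: r => [|i r IH].
  by rewrite [RHS]big_nil -[RHS](int0 n); apply: eq_int => y; rewrite big_nil.
rewrite big_cons; case Pi: (P i); rewrite -IH; last first.
  by apply: eq_int => y; rewrite big_cons Pi.
rewrite -(intD (HF i Pi) (Cc_sum r HF)); apply: eq_int => y; by rewrite big_cons Pi.
Qed.

Lemma intN_ge0 n (f : 'rV[R]_n -> R) : (forall y, 0 <= f y) -> 0 <= integral_rV f.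
Proof.
elim: n f => [|n IH] f f0; first exact: f0.
by rewrite int_slice; apply: int1_ge0 => t; apply: IH => y; exact: f0.
Qed.

Lemma intN_eq0 n S (f : 'rV[R]_n -> R) : Cc S f -> (forall y, 0 <= f y) -> integral_rV f = 0 ->
  forall y, f y = 0.
Proof.
elim: n f => [|n IH] f fS f0 I0 y.
  by rewrite (_ : y = 0) //; apply/rowP => -[].
rewrite (rcons_eta y).
have H t : integral_rV (slice f t) = 0.
  by apply: (int1_eq0 (cc1_slice fS) _ I0) => {}t; apply: intN_ge0 => z; exact: f0.
exact: (IH (slice f (y 0 ord0)) (Cc_slice _ fS) (fun z => f0 _) (H _)).
Qed.

Lemma Cc_shift n S (f : 'rV[R]_n -> R) v : Cc S f -> Cc (S + `|v|) (fun y => f (y + v)).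
Proof.
move=> [cf f0]; split=> [y|y Sy].
  apply: continuous_comp; last exact: cf.
  by apply: continuousD; [exact: cvg_id|exact: cst_continuous].
apply: f0; have := ler_normB (y + v) v; rewrite addrK; lra.
Qed.

Lemma int_shift n S (f : 'rV[R]_n -> R) v : Cc S f ->
  integral_rV (fun y => f (y + v)) = integral_rV f.
Proof.
elim: n f v => [|n IH] f v fS; first by congr f; apply/rowP => -[].
rewrite !int_slice -(int1_affine (v 0 ord0) (oner_neq0 R) (cc1_slice fS)) normr1 mul1r.
apply: eq_Rintegral => t _; rewrite mul1r.
rewrite -(IH (slice f (t + v 0 ord0)) (\row_j v 0 (lift ord0 j)) (Cc_slice _ fS)).
by apply: eq_int => y; rewrite /slice {1}(rcons_eta v) rconsD.
Qed.

Lemma norm_mulmx n (M : 'M[R]_n) (y : 'rV[R]_n) : `|y *m M| <= (\sum_i \sum_j `|M i j|) * `|y|.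
Proof.
have M0 i : 0 <= \sum_j `|M i j| by apply: sumr_ge0.
apply: rV_norm_le => [|j]; first by rewrite mulr_ge0 // sumr_ge0.
rewrite mxE (le_trans (ler_norm_sum _ _ _)) // mulr_suml; apply: ler_sum => i _.
rewrite normrM mulrC ler_pM // ?coord_norm_le //.
by rewrite (bigD1 j) //= lerDl sumr_ge0.
Qed.

Lemma continuous_mulmx n (M : 'M[R]_n) : continuous (fun y : 'rV[R]_n => y *m M).
Proof.
move=> y; apply: rV_continuous => j.
have c : continuously_differentiable 0 setT (fun y : 'rV[R]_n => \sum_i y 0 i * M i j).
  by apply: CD_sum => [|i _]; [exact: openT|apply: CDM; [exact: openT|exact: CD_coord|exact: CD_cst]].
rewrite (_ : (fun _ => _) = (fun y : 'rV[R]_n => \sum_i y 0 i * M i j)); first exact: CD_cont c I.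
by apply/funext => z; rewrite mxE.
Qed.

Lemma Cc_mulmx n S (f : 'rV[R]_n -> R) (M : 'M[R]_n) : M \in unitmx -> Cc S f ->
  Cc ((\sum_i \sum_j `|invmx M i j|) * `|S|) (fun y => f (y *m M)).
Proof.
move=> uM [cf f0]; split=> [y|y Sy].
  by apply: continuous_comp; [exact: continuous_mulmx|exact: cf].
apply: f0; rewrite ltNge; apply/negP => yS; move: Sy; rewrite ltNge => /negP; apply.
rewrite -{1}[y](mulmxK uM) (le_trans (norm_mulmx _ _)) // ler_wpM2l //.
  by apply: sumr_ge0 => i _; apply: sumr_ge0.
exact: le_trans yS (ler_norm _).
Qed.

(** * Linear changes of variables *)

Definition int_inv n (A : 'M[R]_n) : Prop := forall S (f : 'rV[R]_n -> R), Cc S f ->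
  `|\det A| * integral_rV (fun y => f (y *m A)) = integral_rV f.

Lemma int_invM n (A B : 'M[R]_n) : B \in unitmx -> int_inv A -> int_inv B -> int_inv (A *m B).
Proof.
move=> uB IA IB S f fS; rewrite det_mulmx normrM -(IB S f fS) -(IA _ _ (Cc_mulmx uB fS)).
by rewrite mulrCA mulrA; congr (_ * _); apply: eq_int => y; rewrite mulmxA.
Qed.

Lemma int_inv1 n : int_inv (1%:M : 'M[R]_n).
Proof.
by move=> S f fS; rewrite det1 normr1 mul1r; apply: eq_int => y; rewrite mulmx1.
Qed.

(** In row-vector convention the first coordinate t is scaled by a and the others undergo B followed
    by the translation t w. For fixed t this is the case of B together with translation
    invariance. *)
Lemma int_inv_ublock m (a : R) (w : 'rV[R]_m) (B : 'M[R]_m) : a != 0 -> B \in unitmx ->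
  int_inv B -> int_inv (block_mx (a%:M : 'M[R]_1) w 0 B : 'M[R]_(m.+1)).
Proof.
move=> a0 uB IB S f fS.
have -> : \det (block_mx (a%:M : 'M[R]_1) w 0 B : 'M[R]_(m.+1)) = a * \det B.
  by rewrite (@det_ublock _ 1 m) det_scalar1.
have E t y : rcons t y *m (block_mx (a%:M : 'M[R]_1) w 0 B : 'M[R]_(m.+1)) =
    rcons (a * t) (y *m B + t *: w).
  rewrite /rcons (@mul_row_block _ 1 1 m 1 m) mulmx0 addr0 mul_scalar_mx scale_scalar_mx.
  by rewrite mul_scalar_mx mulrC addrC.
rewrite int_slice normrM -mulrA.
have dB : `|\det B| != 0 by rewrite normr_eq0 -unitfE -unitmxE.
have H t : integral_rV (slice (fun y => f (y *m (block_mx (a%:M : 'M[R]_1) w 0 B : 'M[R]_(m.+1)))) t) =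
    `|\det B|^-1 * integral_rV (slice f (a * t + 0)).
  apply: (mulfI dB); rewrite mulVKf // addr0 -(int_shift (t *: w) (Cc_slice (a * t) fS)).
  rewrite -(IB _ _ (Cc_shift (t *: w) (Cc_slice (a * t) fS))); congr (_ * _).
  by apply: eq_int => y; rewrite /slice E.
rewrite (_ : (fun t => _) = (fun t => `|\det B|^-1 * integral_rV (slice f (a * t + 0)))); last first.
  by apply/funext => t; exact: H.
rewrite (int1Z _ (cc1_comp_affine 0 a0 (cc1_slice fS))) mulVKf //.
by rewrite (int1_affine 0 a0 (cc1_slice fS)).
Qed.

(** Fubini's theorem for the function of the first two coordinates that is left after integrating
    out the others. *)
Lemma int_inv_swap m : int_inv (perm_mx (tperm (ord0 : 'I_m.+2) (lift ord0 ord0))).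
Proof.
move=> S f fS; rewrite det_perm odd_tperm /= expr1 normrN1 mul1r.
have E t s (y : 'rV[R]_m) : rcons t (rcons s y) *m perm_mx (tperm (ord0 : 'I_m.+2) (lift ord0 ord0)) =
    rcons s (rcons t y).
  rewrite -[tperm _ _]tpermV -col_permE.
  apply: rcons_inj_coord => [|j]; rewrite mxE.
    by rewrite tpermL rconsS !rcons0.
  have [k ->|->] := unliftP ord0 j; last by rewrite tpermR !rconsS !rcons0.
  by rewrite tpermD ?rconsS // (inj_eq (@lift_inj _ ord0)) neq_lift.
pose G t s := integral_rV (fun y : 'rV[R]_m => f (rcons t (rcons s y))).
transitivity (\int[mu]_(s in setT) \int[mu]_(t in setT) G t s).
  apply: eq_Rintegral => s _; apply: eq_Rintegral => t _.
  by apply: eq_int => y; rewrite -(E s t y).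
have cS t s : Cc S (fun y : 'rV[R]_m => f (rcons t (rcons s y))).
  exact: (Cc_slice s (Cc_slice t fS)).
have G0 t s : S < `|t| \/ S < `|s| -> G t s = 0.
  move=> H; rewrite /G -(int0 m); apply: eq_int => y; apply: fS.2.
  case: H => H; first exact: lt_le_trans H (norm_rcons_l _ _).
  by apply: lt_le_trans H _; apply: le_trans (norm_rcons_l s y) (norm_rcons_r _ _).
pose T := `|S| + 1.
have ST : S < T by rewrite (le_lt_trans (ler_norm S)) // ltrDl.
have T0 : 0 <= T by rewrite addr_ge0.
have C0 : 0 <= (2 * T) ^+ m by rewrite exprn_ge0 // mulr_ge0.
have dist eps : 0 < eps -> exists2 d : R, 0 < d & forall t s t' s', `|t - t'| < d -> `|s - s'| < d ->
    `|G t s - G t' s'| <= eps.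
  move=> eps0; have e1 : 0 < eps / ((2 * T) ^+ m + 1) by rewrite divr_gt0 // ltr_wpDl.
  have [d d0 H] := Cc_unif fS e1; exists d => // t s t' s' tt' ss'.
  rewrite /G -(intB (cS t s) (cS t' s')).
  have Hb (y : 'rV[R]_m) : `|f (rcons t (rcons s y)) - f (rcons t' (rcons s' y))| <= eps / ((2 * T) ^+ m + 1).
    apply: H; rewrite !rconsN !rconsD subrr; apply: (@le_lt_trans _ _ (Num.max `|t - t'| `|s - s'|)).
      apply: norm_rcons_le; first by rewrite le_max lexx.
      apply: norm_rcons_le; first by rewrite le_max lexx orbT.
      by rewrite normr0 le_max normr_ge0.
    by rewrite gt_max tt'.
  apply: le_trans (intN_bound (CcB (cS t s) (cS t' s')) ST T0 Hb) _.
  rewrite mulrCA ler_piMr ?(ltW eps0) // ler_pdivrMr ?mul1r ?lerDl //; exact: ltr_wpDl.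
rewrite -(@swap2 R S G) //.
- by move=> t s H; apply: G0; left.
- by move=> t s H; apply: G0; right.
- move=> eps /dist[d d0 H]; exists d => // t t' s tt'; apply: H => //; by rewrite subrr normr0.
- move=> eps /dist[d d0 H]; exists d => // t s s' ss'; apply: H => //; by rewrite subrr normr0.
Qed.

Lemma unitmx_perm1 n (s : 'S_n) : (perm_mx s : 'M[R]_n) \in unitmx.
Proof. exact: unitmx_perm. Qed.

(** A transposition fixing the first coordinate comes from the dimension below as a block matrix;
    one that moves it is the swap of the first two coordinates or a conjugate of that swap by a
    transposition of the former kind. *)
Lemma int_inv_tperm n (i j : 'I_n) : int_inv (perm_mx (tperm i j)).
Proof.
elim: n i j => [[]//|[|m] IH] i j.
  by rewrite !ord1 tperm1 perm_mx1; exact: int_inv1.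
have lifted (i' j' : 'I_m.+1) : int_inv (perm_mx (tperm (lift ord0 i') (lift ord0 j'))).
  rewrite (_ : perm_mx _ = block_mx (1%:M : 'M[R]_1) (0 : 'rV[R]_m.+1) 0 (perm_mx (tperm i' j'))).
    by apply: int_inv_ublock (IH i' j'); rewrite ?oner_neq0 // unitmx_perm1.
  have lr (k : 'I_m.+1) : lift ord0 k = rshift 1 k by apply/val_inj.
  have l0 : (ord0 : 'I_m.+2) = lshift m.+1 (0 : 'I_1) by apply/val_inj.
  have dr (a b : 'I_m.+1) : block_mx (1%:M : 'M[R]_1) (0 : 'rV[R]_m.+1) 0 (perm_mx (tperm i' j')) (lift ord0 a) (lift ord0 b) =
      (perm_mx (tperm i' j')) a b by rewrite !lr (@block_mxEdr _ 1 m.+1 1 m.+1).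
  have dl (a : 'I_m.+1) : block_mx (1%:M : 'M[R]_1) (0 : 'rV[R]_m.+1) 0 (perm_mx (tperm i' j')) (lift ord0 a) ord0 = 0.
    by rewrite lr l0 (@block_mxEdl _ 1 m.+1 1 m.+1) mxE.
  have ur (a : 'I_m.+1) : block_mx (1%:M : 'M[R]_1) (0 : 'rV[R]_m.+1) 0 (perm_mx (tperm i' j')) ord0 (lift ord0 a) = 0.
    by rewrite lr l0 (@block_mxEur _ 1 m.+1 1 m.+1) mxE.
  have ul : block_mx (1%:M : 'M[R]_1) (0 : 'rV[R]_m.+1) 0 (perm_mx (tperm i' j')) ord0 ord0 = 1.
    by rewrite l0 (@block_mxEul _ 1 m.+1 1 m.+1) mxE eqxx.
  have pE k (s : 'S_k) a b : perm_mx s a b = (s a == b)%:R :> R by rewrite !mxE.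
  have T0 : tperm (lift ord0 i') (lift ord0 j') ord0 = ord0 by rewrite tpermD // eq_sym neq_lift.
  have TS a : tperm (lift ord0 i') (lift ord0 j') (lift ord0 a) = lift ord0 (tperm i' j' a).
    by rewrite -inj_tperm //; exact: lift_inj.
  apply/matrixP => a b; rewrite pE.
  have [a' ->|->] := unliftP ord0 a; have [b' ->|->] := unliftP ord0 b.
  - by rewrite TS (inj_eq (@lift_inj _ ord0)) dr pE.
  - by rewrite TS dl eq_sym (negbTE (neq_lift _ _)).
  - by rewrite T0 ur (negbTE (neq_lift _ _)).
  - by rewrite T0 ul eqxx.
have zero (j' : 'I_m.+1) : int_inv (perm_mx (tperm ord0 (lift ord0 j'))).
  have [->|j0] := eqVneq j' ord0; first exact: int_inv_swap.
  have -> : tperm ord0 (lift ord0 j') = (tperm (lift ord0 ord0) (lift ord0 j') *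
      (tperm ord0 (lift ord0 ord0) * tperm (lift ord0 ord0) (lift ord0 j')))%g.
    have := tpermJ (ord0 : 'I_m.+2) (lift ord0 ord0) (tperm (lift ord0 ord0) (lift ord0 j')).
    by rewrite tpermL tpermD ?neq_lift // 1?eq_sym ?neq_lift // => <-; rewrite conjgE tpermV.
  rewrite !perm_mxM; apply: int_invM; first by rewrite unitmx_mul !unitmx_perm1.
    exact: lifted.
  by apply: int_invM; [exact: unitmx_perm1|exact: int_inv_swap|exact: lifted].
have [i' ->|->] := unliftP ord0 i; have [j' ->|->] := unliftP ord0 j.
- exact: lifted.
- by rewrite tpermC; exact: zero.
- exact: zero.
- by rewrite tperm1 perm_mx1; exact: int_inv1.
Qed.

Lemma int_inv_perm n (s : 'S_n) : int_inv (perm_mx s).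
Proof.
have [ts -> _] := prod_tpermP s.
elim: ts => [|t ts IH]; first by rewrite big_nil perm_mx1; exact: int_inv1.
by rewrite big_cons perm_mxM; apply: int_invM IH; [exact: unitmx_perm1|exact: int_inv_tperm].
Qed.

Lemma int_inv_upper n (U : 'M[R]_n) : U \in unitmx ->
  (forall i j : 'I_n, (j < i)%N -> U i j = 0) -> int_inv U.
Proof.
elim: n U => [|m IH] U uU U0.
  by move=> S f _; rewrite det_mx00 normr1 mul1r; congr f; apply/rowP => -[].
pose U' : 'M[R]_(1 + m) := U.
have E : U' = block_mx ((U 0 0)%:M : 'M[R]_1) (ursubmx U') 0 (drsubmx U').
  rewrite -[LHS]submxK; congr block_mx.
    by apply/matrixP => i j; rewrite !ord1 !mxE /= mulr1n; congr (U _ _); apply/val_inj.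
  by apply/matrixP => i j; rewrite !mxE U0 //= !ord1.
have dU : \det U = U 0 0 * \det (drsubmx U').
  by rewrite -[U]/U' E (@det_ublock _ 1 m) det_scalar1 -E.
move: uU; rewrite unitmxE dU unitrM !unitfE => /andP[a0 uB].
rewrite -[U]/U' E; apply: int_inv_ublock; rewrite ?unitmxE ?unitfE //.
apply: IH; first by rewrite unitmxE unitfE.
by move=> i j ij; rewrite !mxE U0.
Qed.

(** By LUP factorisation. The lower triangular factor becomes upper triangular after conjugation by
    the permutation reversing the coordinates. *)
Lemma int_inv_unit n (A : 'M[R]_n) : A \in unitmx -> int_inv A.
Proof.
case: n A => [|n] A uA.
  by apply: int_inv_upper => // -[].
have := cormen_lup_correct A; have := cormen_lup_perm A.
have := cormen_lup_lower A; have := cormen_lup_upper A; have := cormen_lup_detL A.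
case: (cormen_lup A) => [[P L] U] /= dL Uu Ll /is_perm_mxP[s ->] PA.
have uL : L \in unitmx by rewrite unitmxE dL unitr1.
have uU : U \in unitmx.
  have : L *m U \in unitmx by rewrite -[L *m U]PA unitmx_mul unitmx_perm1 uA.
  by rewrite unitmx_mul => /andP[].
have AE : A = perm_mx s^-1 *m (L *m U).
  by rewrite -[L *m U]PA mulmxA -perm_mxM mulVg perm_mx1 mul1mx.
pose r : 'S_n.+1 := perm (@rev_ord_inj n.+1).
have LE : L = perm_mx r *m (perm_mx r^-1 *m L *m perm_mx r) *m perm_mx r^-1.
  by rewrite !mulmxA -perm_mxM mulgV perm_mx1 mul1mx -mulmxA -perm_mxM mulgV perm_mx1 mulmx1.
have uL' : perm_mx r^-1 *m L *m perm_mx r \in unitmx by rewrite !unitmx_mul !unitmx_perm1 uL.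
have IL' : int_inv (perm_mx r^-1 *m L *m perm_mx r).
  apply: int_inv_upper => // i j ij.
  have -> : (perm_mx r^-1 *m L *m perm_mx r) i j = L (r^-1 i)%g (r^-1 j)%g.
    by rewrite -{2}[r]invgK -col_permE -row_permE !mxE.
  have rE k : (r^-1)%g k = rev_ord k by apply: (@perm_inj _ r); rewrite permKV permE rev_ordK.
  rewrite !rE Ll; last by rewrite /= leq_sub2l // ltnW.
  by rewrite (inj_eq (@rev_ord_inj _)) -val_eqE /= gtn_eqF.
rewrite AE; apply: int_invM; [by rewrite unitmx_mul uL|exact: int_inv_perm|].
apply: int_invM => //; last exact: int_inv_upper.
rewrite LE; apply: int_invM; [exact: unitmx_perm1| |exact: int_inv_perm].
by apply: int_invM => //; exact: int_inv_perm.
Qed.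

End IntegralN.

(** * Change of variables *)

Section Lax.
Variable R : realType.
Local Notation mu := (@lebesgue_measure R).
Local Notation e i := (delta_mx 0 i).
Implicit Types (S T eps : R).

Definition Csm n S (f : 'rV[R]_n -> R) : Prop :=
  smooth_on setT f /\ forall y, S < `|y| -> f y = 0.

Lemma Csm_Cc n S (f : 'rV[R]_n -> R) : Csm S f -> Cc S f.
Proof. by move=> [sf f0]; split=> // y; exact: CD_cont (sf 0%N) I. Qed.

Lemma open_norm_gt n S : open [set y : 'rV[R]_n | S < `|y|].
Proof.
apply: (@open_comp _ _ (fun y : 'rV[R]_n => `|y|) [set r | S < r]); last exact: open_gt.
by move=> y _; exact: norm_continuous.
Qed.

Lemma Csm_partial n S (f : 'rV[R]_n -> R) i : Csm S f -> Csm S (partial i f).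
Proof.
move=> [sf f0]; split; first exact: smooth_partial.
move=> y Sy; rewrite /partial -(@derive_cst R 'rV[R]_n R^o 0 y (e i)); apply: near_eq_derive.
exact: (near_eq_on (@open_norm_gt n S) f0 Sy).
Qed.

(** The quotient is a value of the partial derivative at a nearby point, and that derivative is
    uniformly continuous. Uniformity in z is what differentiation under an integral requires. *)
Lemma diff_quot n S (f : 'rV[R]_n -> R) i : Csm S f -> forall eps, 0 < eps ->
  exists2 d : R, 0 < d & forall h z, h != 0 -> `|h| < d ->
    `|partial i f z - h^-1 * (f (h *: e i + z) - f z)| <= eps.
Proof.
move=> fS eps /(Cc_unif (Csm_Cc (Csm_partial i fS)))[d d0 H]; exists d => // h z h0 hd.
have [t th ->] := @mvt_line R n f z (e i) h (fun t _ => @smooth_derivable _ _ setT f i _ fS.1 I).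
rewrite mulKf //; apply: H; rewrite opprD addrCA subrr addr0 normrN.
apply: le_lt_trans hd; apply: le_trans th; apply: rV_norm_le => // j.
rewrite !mxE normrM eqxx /=; case: (_ == _); by rewrite ?normr1 ?mulr1 // normr0 mulr0.
Qed.

Lemma near0_ne (d : R) : 0 < d -> \forall h \near 0^', (h : R) != 0 /\ `|h| < d.
Proof.
move=> d0; near=> h; split; first by near: h; exact: nbhs_dnbhs_neq.
by near: h; exact: dnbhs0_lt.
Unshelve. all: by end_near. Qed.

Lemma is_deriveP n (f : 'rV[R]_n -> R) y v (a : R) :
  (forall eps, 0 < eps -> exists2 d : R, 0 < d & forall h, h != 0 -> `|h| < d ->
     `|a - h^-1 * (f (h *: v + y) - f y)| <= eps) -> is_derive y v f a.
Proof.
move=> H; suff L : (fun h : R => h^-1 *: (f (h *: v + y) - f y)) @ 0^' --> a.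
  by split; [apply/cvg_ex; exists a|exact: cvg_lim L].
apply/cvgrPdist_le => eps /H[d d0 {}H].
by apply: filterS (near0_ne d0) => h [h0 hd]; exact: H.
Qed.

Lemma is_deriveP1 (f : R -> R) (y a : R) :
  (forall eps, 0 < eps -> exists2 d : R, 0 < d & forall h, h != 0 -> `|h| < d ->
     `|a - h^-1 * (f (h + y) - f y)| <= eps) -> is_derive y (1 : R) f a.
Proof.
move=> H; suff L : (fun h : R => h^-1 *: (f (h *: (1 : R) + y) - f y)) @ 0^' --> a.
  by split; [apply/cvg_ex; exists a|exact: cvg_lim L].
apply/cvgrPdist_le => eps /H[d d0 {}H].
by apply: filterS (near0_ne d0) => h [h0 hd]; rewrite [h *: 1]mulr1; exact: H.
Qed.

Lemma rcons_shift0 m t (y : 'rV[R]_m) h : h *: e ord0 + rcons t y = rcons (h + t) y.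
Proof.
apply: rcons_inj_coord => [|j]; rewrite mxE ?rcons0 ?rconsS !mxE !eqxx /=.
  by rewrite mulr1.
by rewrite mulr0 add0r.
Qed.

Lemma rcons_shiftS m t (y : 'rV[R]_m) h j : h *: e (lift ord0 j) + rcons t y = rcons t (h *: e j + y).
Proof.
apply: rcons_inj_coord => [|k]; rewrite mxE ?rcons0 ?rconsS !mxE !eqxx /=.
  by rewrite mulr0 add0r.
by rewrite (inj_eq (@lift_inj _ ord0)).
Qed.

Lemma eps_bound (C eps : R) : 0 <= C -> 0 < eps -> exists2 e1, 0 < e1 & C * e1 <= eps.
Proof.
move=> C0 e0; exists (eps / (C + 1)); first by rewrite divr_gt0 // ltr_wpDl.
rewrite mulrCA ler_piMr ?(ltW e0) // ler_pdivrMr ?mul1r ?lerDl //; exact: ltr_wpDl.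
Qed.

Lemma partial_slice m (f : 'rV[R]_m.+1 -> R) t j :
  slice (partial (lift ord0 j) f) t = partial j (slice f t).
Proof.
apply/funext => y; rewrite /slice /partial /derive; congr lim.
have -> // : (fun h : R => h^-1 *: ((f \o shift (rcons t y)) (h *: e (lift ord0 j)) - f (rcons t y))) =
   (fun h : R => h^-1 *: (((fun y0 => f (rcons t y0)) \o shift y) (h *: e j) - f (rcons t y))).
by apply/funext => h /=; rewrite rcons_shiftS.
Qed.

Lemma Csm_slice m S (f : 'rV[R]_m.+1 -> R) t : Csm S f -> Csm S (slice f t).
Proof.
move=> fS; split; last by case: (Cc_slice t (Csm_Cc fS)).
move=> k; apply: (CD_comp openT openT (F := rcons t) (f := f)) => // [j|]; last exact: fS.1.
have [i ->|->] := unliftP ord0 j.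
  by apply: (CD_eq openT _ (@CD_coord R m k setT i)) => y _; rewrite rconsS.
by apply: (CD_eq openT _ (CD_cst k setT t)) => y _; rewrite rcons0.
Qed.

(** In a direction other than the first it holds slice by slice. In the first direction,
    differentiation under the integral exhibits the integrand in t as the derivative of the slice
    integral, which vanishes far out. *)
Lemma int_partial n S (f : 'rV[R]_n -> R) i : Csm S f -> integral_rV (partial i f) = 0.
Proof.
elim: n f i => [f []//|m IH] f i fS; have [j ->|->] := unliftP ord0 i.
  rewrite int_slice -[RHS](int_zero (@measurableT _ _) (f := fun=> 0 : R)) //.
  by apply: eq_Rintegral => t _; rewrite partial_slice; exact: IH (Csm_slice t fS).
pose T := `|S| + 1.
have ST : S < T by rewrite (le_lt_trans (ler_norm S)) // ltrDl.
have T0 : 0 <= T by rewrite addr_ge0.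
have pS := Csm_partial ord0 fS.
have D (t : R) : is_derive t (1 : R) (fun t => integral_rV (slice f t)) (integral_rV (slice (partial ord0 f) t)).
  apply: is_deriveP1 => eps eps0.
  have C0 : 0 <= (2 * T) ^+ m by rewrite exprn_ge0 // mulr_ge0.
  have [e1 e10 eE] := eps_bound C0 eps0.
  have [d d0 H] := diff_quot ord0 fS e10; exists d => // h h0 hd.
  have c1 t := Cc_slice t (Csm_Cc fS).
  have c2 := Cc_slice t (Csm_Cc pS).
  rewrite -(intB (c1 _) (c1 _)) -(intZ h^-1 (CcB (c1 _) (c1 _))).
  rewrite -(intB c2 (CcZ h^-1 (CcB (c1 _) (c1 _)))).
  apply: le_trans eE; apply: (intN_bound (CcB c2 (CcZ h^-1 (CcB (c1 _) (c1 _)))) ST T0) => y.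
  by have := H h (rcons t y) h0 hd; rewrite rcons_shift0.
rewrite int_slice (int_unique (cc1_slice (Csm_Cc pS)) ST D).
have z t : S < `|t| -> integral_rV (slice f t) = 0 by exact: (cc1_slice (Csm_Cc fS)).2.
by rewrite !z ?subr0 ?normrN // (lt_le_trans ST) // ler_norm.
Qed.

Section Antiderivative.
Variable m : nat.
Implicit Types (f : 'rV[R]_m.+1 -> R) (y : 'rV[R]_m.+1).

(** The integral of f along the first coordinate, from -oo up to the point y. Measuring s from y
    keeps the interval of integration fixed, so that derivatives in all directions, the first
    included, fall on f. *)
Definition antider f y : R := prim (fun s : R => f (s *: e ord0 + y)) 0.

Lemma norm_Zdelta (h : R) (i : 'I_m.+1) : `|(h *: e i : 'rV[R]_m.+1)| = `|h|.
Proof.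
apply/eqP; rewrite eq_le; apply/andP; split.
  apply: rV_norm_le => // j; rewrite !mxE normrM eqxx /=.
  by case: (_ == _); rewrite ?normr1 ?mulr1 // normr0 mulr0.
by have := coord_norm_le (h *: e i) i; rewrite !mxE !eqxx mulr1.
Qed.

Lemma norm_line s y : `|s| <= `|s *: e ord0 + y| + `|y|.
Proof.
by rewrite -(norm_Zdelta s ord0) -{1}[s *: _](addrK y) ler_normB.
Qed.

Lemma cc1_line S f y : Cc S f -> cc1 (S + `|y|) (fun s : R => f (s *: e ord0 + y)).
Proof.
move=> fS; split=> [s|s Ss]; last by apply: fS.2; have := norm_line s y; lra.
apply/cvgrPdist_le => eps /(Cc_unif fS)[d d0 H].
apply: filterS (near_dist s d0) => s' ss'; apply: H.
rewrite opprD addrACA subrr addr0 -scalerBl; apply: le_lt_trans ss'.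
apply: rV_norm_le => // j; rewrite !mxE normrM eqxx /=.
by case: (_ == _); rewrite ?normr1 ?mulr1 // normr0 mulr0.
Qed.

Lemma antider_is_derive S f y i : Csm S f -> is_derive y (e i) (antider f) (antider (partial i f) y).
Proof.
move=> fS; apply: is_deriveP => eps eps0; pose S' := S + `|y| + 1; pose T := `|S'| + 1.
have ST : S' < T by rewrite (le_lt_trans (ler_norm _)) // ltrDl.
have T0 : 0 <= T by rewrite addr_ge0.
have [e1 e10 eE] := eps_bound T0 eps0.
have [d d0 H] := diff_quot i fS e10; exists (Num.min d 1); first by rewrite lt_min d0 ltr01.
move=> h h0; rewrite lt_min => /andP[hd h1].
have cc (g : 'rV[R]_m.+1 -> R) z : Csm S g -> `|z| <= `|y| + 1 -> cc1 S' (fun s : R => g (s *: e ord0 + z)).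
  move=> gS zy; apply: cc1_le (cc1_line z (Csm_Cc gS)); rewrite /S'; lra.
have y1 : `|y| <= `|y| + 1 by rewrite lerDl.
have hy : `|h *: e i + y| <= `|y| + 1.
  apply: le_trans (ler_normD _ _) _; rewrite addrC lerD2l; apply: le_trans (ltW h1).
  by rewrite norm_Zdelta.
have c0 := cc _ _ fS y1; have c1 := cc _ _ fS hy; have c2 := cc _ _ (Csm_partial i fS) y1.
rewrite /antider -(primB 0 c1 c0).
have -> : h^-1 * prim (fun s : R => f (s *: e ord0 + (h *: e i + y)) - f (s *: e ord0 + y)) 0 =
    prim (fun s : R => h^-1 * (f (s *: e ord0 + (h *: e i + y)) - f (s *: e ord0 + y))) 0.
  by rewrite /prim RintegralZl //; apply: cc1_integrableA (cc1B c1 c0); exact: measurable_itv.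
rewrite -(primB 0 c2 (cc1Z h^-1 (cc1B c1 c0))).
apply: le_trans (prim_bound 0 (cc1B c2 (cc1Z h^-1 (cc1B c1 c0))) ST (eps := e1) _) _.
  by move=> s; rewrite addrCA; exact: H.
by rewrite normr0 add0r ger0_norm.
Qed.

Lemma antider_cont S f : Cc S f -> continuous (antider f).
Proof.
move=> fS y; apply/(@cvgrPdist_le _ _ _ (nbhs y) (nbhs_filter y) (antider f) (antider f y)) => eps eps0.
pose S' := S + `|y| + 1; pose T := `|S'| + 1.
have ST : S' < T by rewrite (le_lt_trans (ler_norm _)) // ltrDl.
have T0 : 0 <= T by rewrite addr_ge0.
have [e1 e10 eE] := eps_bound T0 eps0.
have [d d0 H] := Cc_unif fS e10.
have d1 : 0 < Num.min d 1 by rewrite lt_min d0 ltr01.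
apply/nbhs_ballP; exists (Num.min d 1) => // z; rewrite -ball_normE /= lt_min => /andP[yz yz1].
have zy : `|z| <= `|y| + 1 by have := ler_distD y z 0; rewrite !subr0 distrC; lra.
have c0 : cc1 S' (fun s : R => f (s *: e ord0 + y)).
  by apply: cc1_le (cc1_line y fS); rewrite lerDl.
have c1 : cc1 S' (fun s : R => f (s *: e ord0 + z)).
  by apply: cc1_le (cc1_line z fS); rewrite /S'; lra.
rewrite /antider -(primB 0 c0 c1); apply: le_trans (prim_bound 0 (cc1B c0 c1) ST (eps := e1) _) _.
  by move=> s; apply: H; rewrite opprD addrACA subrr add0r.
by rewrite normr0 add0r ger0_norm.
Qed.

Lemma antider_smooth S f : Csm S f -> smooth_on setT (antider f).
Proof.
move=> fS k; elim: k f fS => [|k IH] f fS; (split; first by move=> y _; exact: antider_cont (Csm_Cc fS) y) => //.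
move=> i; split=> [y _|]; first by case: (antider_is_derive y i fS).
rewrite (_ : partial i (antider f) = antider (partial i f)); first by apply: IH; exact: Csm_partial.
by apply/funext => y; case: (antider_is_derive y i fS).
Qed.

Lemma partial_antider S f : Csm S f -> partial ord0 (antider f) = f.
Proof.
move=> fS; apply/funext => y; have [_ E] := antider_is_derive y ord0 fS; rewrite /partial E.
have D (s : R) : is_derive s (1 : R) (fun s : R => f (s *: e ord0 + y)) (partial ord0 f (s *: e ord0 + y)).
  by apply: line_derive; apply: (smooth_derivable fS.1).
have ST : S + `|y| < S + `|y| + 1 by rewrite ltrDl.
rewrite /antider (prim_unique 0 (cc1_line y (Csm_Cc (Csm_partial ord0 fS))) ST D).
rewrite scale0r add0r [X in _ - X]fS.2 ?subr0 //.
by have := norm_line (- (S + `|y| + 1)) y; rewrite normrN; have := ler_norm (S + `|y| + 1); lra.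
Qed.

End Antiderivative.

Lemma jac_affine n (A : 'M[R]_n) b y : jac (fun z : 'rV[R]_n => z *m A + b) y = A.
Proof.
apply/matrixP => i j; rewrite mxE.
rewrite (_ : (fun z => _) = fun z : 'rV[R]_n => (\sum_k A k j * z 0 k) + b 0 j); last first.
  by apply/funext => z; rewrite !mxE; congr (_ + _); apply: eq_bigr => k _; rewrite mulrC.
have D : is_derive y (e i : 'rV[R]_n) (fun z : 'rV[R]_n => (\sum_k A k j * z 0 k) + b 0 j) (\sum_k A k j * (e i : 'rV[R]_n) 0 k + 0).
  apply: is_deriveD; apply: is_derive_bigsum => k _; apply: is_deriveZ.
  by split; [exact: derivable_coord|exact: derive_coord].
have [_ E] := D; rewrite /partial E addr0 (bigD1 i) //= big1 => [|k ki]; rewrite !mxE eqxx /=.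
  by rewrite eqxx mulr1 addr0.
by rewrite (negbTE ki) mulr0.
Qed.

Lemma smooth_affine n (A : 'M[R]_n) b j : smooth_on setT (fun z : 'rV[R]_n => (z *m A + b) 0 j).
Proof.
move=> k; apply: (CD_eq openT _ (f := fun z : 'rV[R]_n => (\sum_l A l j * z 0 l) + b 0 j)).
  by move=> z _; rewrite !mxE; congr (_ + _); apply: eq_bigr => l _; rewrite mulrC.
apply: CDD openT _ (CD_cst _ _ _); apply: CD_sum openT _ => l _; apply: CDZ openT _; exact: CD_coord.
Qed.

Lemma dextZc n (U : set 'rV[R]_n) (c : R) alpha y : smooth_form U alpha -> U y ->
  dext (fun z => c *: alpha z) y = c *: dext alpha y.
Proof.
move=> sa Uy; rewrite (@dextZ R n U (fun=> c) alpha y) //; last by move=> k; exact: CD_cst.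
rewrite covectorE big1 ?wedge0l ?add0r // => i _; by rewrite partial_cst scale0r.
Qed.

(* Lax's trick: f dy is d of omega = (antider f) dy_1 ... dy_(n-1), and the
   pullbacks of omega by F and by the affine map differ by a form with compact
   support; so F need not be injective. *)
Lemma lax m (S0 S : R) (F : 'rV[R]_m.+1 -> 'rV[R]_m.+1) (A : 'M[R]_m.+1) b f :
  (forall j, smooth_on setT (fun y => F y 0 j)) ->
  (forall y, S0 < `|y| -> F y = y *m A + b) -> A \in unitmx -> Csm S f ->
  integral_rV (fun y => \det (jac F y) * f (F y)) = integral_rV (fun y => \det A * f (y *m A + b)).
Proof.
move=> sF F0 uA fS; pose G (y : 'rV[R]_m.+1) := y *m A + b.
pose J := (~: [set ord0 : 'I_m.+1])%SET.
pose om (y : 'rV[R]_m.+1) := antider f y *: ebase R J.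
have som : smooth_form setT om.
  by apply: smooth_formZ openT (antider_smooth fS) (smooth_form_cst _ _).
have UV (H : 'rV[R]_m.+1 -> 'rV[R]_m.+1) (y : 'rV[R]_m.+1) : setT y -> setT (H y) by [].
have sG j : smooth_on setT (fun y => G y 0 j) by exact: smooth_affine.
pose ze y := pull F om y + (-1) *: pull G om y.
have spF := smooth_pull openT openT (UV F) sF som.
have spG := smooth_pull openT openT (UV G) sG som.
have spG' : smooth_form setT (fun y => (-1) *: pull G om y).
  by apply: smooth_formZ openT (fun k => CD_cst k _ _) spG.
have sze : smooth_form setT ze by exact: smooth_formD openT spF spG'.
have zeS I : Csm S0 (fun y => ze y I).
  split; first exact: sze.
  move=> y Sy; rewrite /ze /pull F0 // (_ : jac F y = jac G y) ?scaleN1r ?subrr ?ext0 //.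
  apply/matrixP => i j; rewrite !mxE; apply: near_eq_derive.
  by apply: (near_eq_on (@open_norm_gt m.+1 S0) _ Sy) => z Sz; rewrite F0.
pose s := shuffle_sign R [set ord0]%SET J.
have omE z I : om z I = antider f z * (I == J)%:R by rewrite /om extZ ffunE.
have domtop y : dext om y finset.setT = s * f y.
  rewrite dext_top (bigD1 ord0) //= big1 ?addr0 => [|i i0].
    have omJ : (fun z => om z J) = antider f by apply/funext => z; rewrite omE eqxx mulr1.
    by rewrite -/J omJ (partial_antider fS).
  rewrite (_ : (fun z => _) = fun=> 0) ?partial_cst ?mulr0 //; apply/funext => z.
  rewrite omE (inj_eq (can_inj (@finset.setCK _))) (inj_eq (@finset.set1_inj _)).
  by rewrite (negbTE i0) mulr0.
have dze y : dext ze y finset.setT = s * (\det (jac F y) * f (F y) - \det A * f (G y)).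
  have pT (H : 'rV[R]_m.+1 -> 'rV[R]_m.+1) : (forall j, smooth_on setT (fun y => H y 0 j)) ->
      dext (pull H om) y finset.setT = s * (\det (jac H y) * f (H y)).
    move=> sH; have -> : dext (pull H om) y = ext_map (jac H y) (dext om (H y)).
      exact: (@dext_pull R m.+1 setT setT H openT openT (UV H) sH om y som I).
    by rewrite top_map domtop mulrCA.
  have -> : dext ze y = dext (pull F om) y + (-1) *: dext (pull G om) y.
    by rewrite -(dextZc _ spG) //; exact: (dextD spF spG').
  have tF := pT F sF; have tG := pT G sG; have jG : jac G y = A := jac_affine A b y.
  rewrite jG in tG.
  have H (u v a c : R) : u = s * a -> v = s * c -> u + -1 * v = s * (a - c).
    by move=> -> ->; rewrite mulN1r mulrBr.
  by rewrite extD extZ; exact: H tF tG.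
have E : (fun y => \det (jac F y) * f (F y) - \det A * f (G y)) = fun y => \sum_i
    (s * shuffle_sign R [set i]%SET (~: [set i])%SET) * partial i (fun z => ze z (~: [set i])%SET) y.
  apply/funext => y; rewrite -[LHS]mul1r -(@sgn_sq R _ [set ord0]%SET J) -mulrA -dze dext_top mulr_sumr.
  by apply: eq_bigr => i _; rewrite mulrA.
have C1 i : Cc S0 (fun y => (s * shuffle_sign R [set i]%SET (~: [set i])%SET) * partial i (fun z => ze z (~: [set i])%SET) y).
  by apply: CcZ; apply: Csm_Cc; apply: Csm_partial; exact: zeS.
have Cd : Cc S0 (fun y => \det (jac F y) * f (F y) - \det A * f (G y)).
  by rewrite E; apply: Cc_sum => i _; exact: C1.
have I0 : integral_rV (fun y => \det (jac F y) * f (F y) - \det A * f (G y)) = 0.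
  rewrite E (int_sum _ (fun i _ => C1 i)) big1 // => i _.
  rewrite (intZ _ (Csm_Cc (Csm_partial i (zeS _)))) (int_partial i (zeS _)) mulr0 //.
(* The support of this integrand is compact because A is invertible. The integrand for F is the sum
   of this one and the compactly supported difference [Cd]. *)
have Cg := CcZ (\det A) (Cc_mulmx uA (Cc_shift b (Csm_Cc fS))).
set S1 := _ * `|_| in Cg.
have S0M : S0 <= Num.max S0 S1 by rewrite le_max lexx.
have S1M : S1 <= Num.max S0 S1 by rewrite le_max lexx orbT.
rewrite -[RHS]add0r -I0 -(intD (Cc_le S0M Cd) (Cc_le S1M Cg)).
by apply: eq_int => y; rewrite subrK.
Qed.

(** [lax] replaces F by the affine map that it equals far out, and for this map linear and
    translation invariance suffice. In dimension 0 there is no coordinate to integrate along, but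
    the integral is evaluation at the only point. *)
Lemma change_of_variables n (S0 S : R) (F : 'rV[R]_n -> 'rV[R]_n) (A : 'M[R]_n) b f :
  (forall j, smooth_on setT (fun y => F y 0 j)) ->
  (forall y, S0 < `|y| -> F y = y *m A + b) -> 0 < \det A -> Csm S f ->
  integral_rV (fun y => \det (jac F y) * f (F y)) = integral_rV f.
Proof.
case: n F A b f => [|m] F A b f sF F0 dA fS.
  by rewrite /= det_mx00 mul1r; congr f; apply/rowP => -[].
have uA : A \in unitmx by rewrite unitmxE unitfE gt_eqF.
rewrite (lax sF F0 uA fS) -(int_shift b (Csm_Cc fS)) -(int_inv_unit uA (Cc_shift b (Csm_Cc fS))).
by rewrite gtr0_norm // (intZ _ (Cc_mulmx uA (Cc_shift b (Csm_Cc fS)))).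
Qed.

End Lax.

(** * Charts and partitions of unity *)

Lemma finite_cover (T : topologicalType) (U : T -> set T) : compact [set: T] ->
  (forall x, open (U x) /\ U x x) -> exists s : seq T, forall x, exists2 y, y \in s & U y x.
Proof.
(* [F] consists of the properties shared by all lists that contain some fixed list. For this filter
   the near-covering form of compactness says that one list serves every point. *)
move=> cT HU; pose F : set_system (seq T) := [set Q | exists s : seq T, forall s' : seq T, {subset s <= s'} -> Q s'].
have FF : Filter F.
  constructor; first by exists [::].
  - move=> P Q [s sP] [s' sQ]; exists (s ++ s') => u su.
    by split; [apply: sP|apply: sQ] => z zs; apply: su; rewrite mem_cat zs ?orbT.
  - by move=> P Q PQ [s sP]; exists s => u su; apply: PQ; exact: sP.
have /compact_near_coveringP/(_ _ F (fun s x => exists2 y, y \in s & U y x) FF) := cT.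
case=> [x _|s sP]; last by exists s => x; exact: (sP s).
exists (U x, [set s : seq T | x \in s]); first split => /=.
- by apply: open_nbhs_nbhs; have [] := HU x.
- by exists [:: x] => s; apply; rewrite inE.
- by move=> [z s] /= [Uz xs]; exists x.
Qed.

Section SquareDistance.
Variables (R : realType) (n : nat).
Implicit Types (p y : 'rV[R]_n) (s d : R).

(** The squared Euclidean distance: unlike the norm of ['rV[R]_n], which is a maximum, it is smooth.
    [norm_sqd] and [sqd_norm] compare the two. *)
Definition sqd p y : R := \sum_j (y 0 j - p 0 j) ^+ 2.

Lemma sqd_ge0 p y : 0 <= sqd p y.
Proof. by apply: sumr_ge0 => j _; exact: sqr_ge0. Qed.

Lemma sqdpp p : sqd p p = 0.
Proof. by apply: big1 => j _; rewrite subrr expr0n. Qed.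

Lemma norm_sqd p y : `|y - p| ^+ 2 <= sqd p y.
Proof.
have H : `|y - p| <= Num.sqrt (sqd p y).
  apply: rV_norm_le; first exact: sqrtr_ge0.
  move=> j; rewrite -sqrtr_sqr ler_wsqrtr // !mxE /sqd (bigD1 j) //= lerDl.
  by apply: sumr_ge0 => i _; exact: sqr_ge0.
rewrite -[leRHS]sqr_sqrtr ?sqd_ge0 //.
by apply: lerXn2r; rewrite ?nnegrE ?sqrtr_ge0.
Qed.

Lemma sqd_norm p y : sqd p y <= n%:R * `|y - p| ^+ 2.
Proof.
apply: le_trans (_ : \sum_(j < n) `|y - p| ^+ 2 <= _); last first.
  by rewrite sumr_const card_ord mulr_natl.
apply: ler_sum => j _; rewrite -real_normK ?num_real //; apply: lerXn2r; rewrite ?nnegrE //.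
by have := coord_norm_le (y - p) j; rewrite !mxE.
Qed.

Lemma sqd_lt p y d : 0 <= d -> sqd p y < d ^+ 2 -> `|y - p| < d.
Proof.
move=> d0 H; rewrite ltNge; apply/negP => dy; move: H; rewrite ltNge => /negP; apply.
by apply: le_trans (norm_sqd p y); apply: lerXn2r; rewrite ?nnegrE.
Qed.

Lemma smooth_sqd U p : open U -> smooth_on U (sqd p).
Proof.
move=> oU k; apply: CD_sum => // j _.
apply: (CD_eq oU _ (CDM oU (CDB oU (CD_coord k U j) (CD_cst k U (p 0 j))) (CDB oU (CD_coord k U j) (CD_cst k U (p 0 j))))).
by move=> y _; rewrite expr2.
Qed.

Lemma continuous_sqd p : continuous (sqd p).
Proof. by move=> y; exact: CD_cont (smooth_sqd p openT 0%N) I. Qed.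

Lemma open_sqd_lt p s : open [set y | sqd p y < s].
Proof. by apply: (@open_comp _ _ (sqd p) [set r | r < s]) => [y _|]; [exact: continuous_sqd|exact: open_lt]. Qed.

Lemma open_sqd_gt p s : open [set y | s < sqd p y].
Proof. by apply: (@open_comp _ _ (sqd p) [set r | s < r]) => [y _|]; [exact: continuous_sqd|exact: open_gt]. Qed.

Lemma compact_sqd p s : compact [set y | sqd p y <= s].
Proof.
apply: bounded_closed_compact.
  exists (`|p| + 1 + `|s|); split; first exact: num_real.
  move=> r Hr y /= ys; apply: ltW; apply: le_lt_trans Hr.
  have : `|y - p| <= 1 + `|s|.
    rewrite leNgt; apply/negP => H; have := norm_sqd p y.
    have : 1 + `|s| < `|y - p| ^+ 2.
      by apply: lt_le_trans (H) _; rewrite expr2 ler_peMr // (le_trans _ (ltW H)) // lerDl.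
    have := ler_norm s; lra.
  have := ler_normD (y - p) p; rewrite subrK; lra.
apply: (@preimage_closed _ _ (sqd p) [set r | r <= s]); last exact: closed_le.
by move=> y _; exact: continuous_sqd.
Qed.

Lemma bump_gt0 (x : R) : (0 < bump_fun 0 x) = (0 < x).
Proof. by rewrite /bump_fun; case: ifP => //; rewrite ?ltxx // expr0 mul1r expR_gt0. Qed.

Lemma bump_eq0 (x : R) : x <= 0 -> bump_fun 0 x = 0.
Proof. by rewrite /bump_fun ltNge => ->. Qed.

Lemma bump_ge0 (x : R) : 0 <= bump_fun 0 x.
Proof. by rewrite /bump_fun; case: ifP => // _; rewrite expr0 mul1r expR_ge0. Qed.

End SquareDistance.

Section Charts.
Variables (R : realType) (n : nat) (M : topologicalType) (A : oriented_atlas R n M).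
Implicit Types (a b c : chart_index A) (x z : M) (y : 'rV[R]_n).

Definition img a : set 'rV[R]_n := chart a @` chart_dom a.
Definition ov a b : set 'rV[R]_n := [set y | img a y /\ chart_dom b (chart_inv a y)].

Lemma img_open a : open (img a). Proof. exact: image_open. Qed.

Lemma img_chart a x : chart_dom a x -> img a (chart a x).
Proof. by move=> ax; exists x. Qed.

Lemma img_dom a y : img a y -> chart_dom a (chart_inv a y).
Proof. by move=> [x ax <-]; rewrite chartK. Qed.

Lemma chart_invK a y : img a y -> chart a (chart_inv a y) = y.
Proof. by move=> [x ax <-]; rewrite chartK. Qed.

Lemma open_img_pre a (B : set M) : open B -> open [set y | img a y /\ B (chart_inv a y)].
Proof.
move=> oB; rewrite openE => y [Vy By]; rewrite /interior.
have cy : {for y, continuous (chart_inv a)} := chart_inv_continuous Vy.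
have nB : nbhs (chart_inv a y) B by exact: open_nbhs_nbhs.
have h1 : nbhs y (img a) := open_nbhs_nbhs (conj (@img_open a) Vy).
have h2 : nbhs y (chart_inv a @^-1` B) := cy _ nB.
exact: filterI h1 h2.
Qed.

Lemma open_dom_pre a (U : set 'rV[R]_n) : open U -> open [set x | chart_dom a x /\ U (chart a x)].
Proof.
move=> oU; rewrite openE => x [ax Ux]; rewrite /interior.
have cx : {for x, continuous (chart a)} := chart_continuous ax.
have nU : nbhs (chart a x) U by exact: open_nbhs_nbhs.
apply: filterS2 (open_nbhs_nbhs (conj (chart_dom_open a) ax)) (cx _ nU) => z az Uz; by split.
Qed.

Lemma ov_open a b : open (ov a b).
Proof. exact: open_img_pre (chart_dom_open b). Qed.

Lemma ov_chart a b x : chart_dom a x -> chart_dom b x -> ov a b (chart a x).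
Proof. by move=> ax bx; split; [exact: img_chart|rewrite chartK]. Qed.

Definition trans a b y : 'rV[R]_n := chart b (chart_inv a y).

Lemma trans_smooth a b j : smooth_on (ov a b) (fun y => trans a b y 0 j).
Proof.
move=> k; apply: CD_sub (transition_smooth a b j k) => y [Vy by_].
by exists (chart_inv a y); [split=> //; exact: img_dom|exact: chart_invK].
Qed.

Hypotheses (hM : hausdorff_space M) (cM : compact [set: M]).

(** A bump on a closed Euclidean ball in a chart image, extended by 0. The extension is smooth since
    the preimage K of the ball is compact, hence closed in the Hausdorff space M. *)
Lemma bump_exists (N : set M) x0 : open N -> N x0 ->
  exists a (K : set M) (B : M -> R),
    [/\ closed K, K `<=` N, K `<=` chart_dom a & smooth_field ((fun _ => B) : local_field A R)] /\
    [/\ forall x, 0 <= B x, forall x, ~ K x -> B x = 0, open [set x | 0 < B x] & 0 < B x0].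
Proof.
move=> oN Nx0; have [a ax0] := chart_dom_cover A x0; pose p := chart a x0.
have oU := open_img_pre (a := a) oN.
have Up : img a p /\ N (chart_inv a p) by split; [exact: img_chart|rewrite /p chartK].
have /nbhs_ballP[d /= d0 dU] := open_nbhs_nbhs (conj oU Up).
(* Half the radius, so that the closed ball still lies in the open ball of radius d. *)
pose s := (d / 2) ^+ 2.
have d2 : 0 < d / 2 by rewrite divr_gt0.
have s0 : 0 < s by rewrite exprn_gt0.
have sU y : sqd p y <= s -> img a y /\ N (chart_inv a y).
  move=> ys; apply: dU; rewrite -ball_normE /= distrC; apply: sqd_lt (ltW d0) _.
  apply: le_lt_trans ys _; rewrite /s; apply: ltrXn2r => //; rewrite ?nnegrE ?(ltW d2) ?(ltW d0) //.
  by rewrite ltr_pdivrMr // ltr_pMr // ltr1n.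
pose K := chart_inv a @` [set y | sqd p y <= s].
have cK : compact K.
  apply: (@continuous_compact _ _ (chart_inv a) [set y | sqd p y <= s]); last exact: compact_sqd.
  apply: continuous_in_subspaceT => y /set_mem ys.
  by apply: chart_inv_continuous; have [] := sU y ys.
have clK : closed K by exact: compact_closed.
have Kdom : K `<=` chart_dom a by move=> _ [y /sU[Vy _] <-]; exact: img_dom.
pose B z : R := if `[< chart_dom a z >] then bump_fun 0 (s - sqd p (chart a z)) else 0.
have B0 z : ~ K z -> B z = 0.
  move=> Kz; rewrite /B; case: asboolP => // az; apply: bump_eq0.
  rewrite subr_le0 leNgt; apply/negP => zs; apply: Kz.
  by exists (chart a z); [exact: ltW|rewrite chartK].
have Bpos z : 0 < B z <-> chart_dom a z /\ sqd p (chart a z) < s.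
  rewrite /B; case: asboolP => az; last by rewrite ltxx; split=> // -[].
  by rewrite bump_gt0 subr_gt0; split=> // -[].
exists a, K, B; split; split=> //.
- by move=> _ [y /sU[_ Ny] <-].
- move=> c k; apply: CD_local => y Vy.
  have [dy|dy] := pselect (chart_dom a (chart_inv c y)).
    exists (ov c a) => //.
    apply: (CD_eq (@ov_open c a) _ (f := fun y => bump_fun 0 (s - sqd p (trans c a y)))).
      by move=> z [_ dz]; rewrite /B asboolT.
    apply: CD_bump (@ov_open c a) _; apply: CDB (@ov_open c a) (CD_cst _ _ _) _.
    exact: (smooth_comp (@ov_open c a) openT (fun _ _ => I) (@trans_smooth c a) (smooth_sqd p openT) k).
  have oW := open_img_pre (a := c) (closed_openC clK).
  exists [set z | img c z /\ (~` K) (chart_inv c z)].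
    by split=> //= /Kdom.
  by apply: (CD_eq oW _ (CD_cst k _ 0)) => z [_ Kz]; rewrite B0.
- by move=> x; rewrite /B; case: asboolP => // _; exact: bump_ge0.
- rewrite (_ : [set x | _] = [set x | chart_dom a x /\ [set y | sqd p y < s] (chart a x)]).
    by apply: open_dom_pre; exact: open_sqd_lt.
  by apply/seteqP; split=> x /Bpos.
- by apply/Bpos; split=> //; rewrite sqdpp.
Qed.

(** Compactness leaves finitely many bumps whose sum is positive everywhere; they are divided by
    that sum. Prescribing neighbourhoods for the supports is what lets Stokes' theorem be
    localised. *)
Lemma pou_exists (N : M -> set M) : (forall x, open (N x) /\ N x x) ->
  exists (P : partition_of_unity A) (pt : 'I_(pou_size P) -> M),
    forall k, closure [set x | pou_fun (p := P) k x != 0] `<=` N (pt k).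
Proof.
move=> HN.
have [fa Hfa] := choice (fun x => bump_exists (HN x).1 (HN x).2).
have [fK HfK] := choice Hfa.
have {Hfa HfK} [fB H] := choice HfK.
have HU x : open [set z | 0 < fB x z] /\ [set z | 0 < fB x z] x by have [_ [_ _ ? ?]] := H x.
have [s Hs] := finite_cover cM HU.
pose t := in_tuple s; pose b k := fB (tnth t k).
have b0 k z : 0 <= b k z by have [_ [+ _ _ _]] := H (tnth t k); apply.
have S0 z : 0 < \sum_k b k z.
  have [y ys yz] := Hs z; have /tnthP[k yk] : y \in t by [].
  rewrite (bigD1 k) //= ltr_pwDl //; first by rewrite /b -yk.
  by apply: sumr_ge0.
have sb k : smooth_field ((fun _ => b k) : local_field A R) by have [[_ _ _ +] _] := H (tnth t k).
pose psi k z := b k z / \sum_j b j z.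
have spsi k : smooth_field ((fun _ => psi k) : local_field A R).
  move=> a l; apply: CDM (@img_open a) (sb k a l) _; apply: CDV (@img_open a) _ _.
    by move=> y _; rewrite gt_eqF.
  by apply: CD_sum (@img_open a) _ => j _; exact: sb.
have psi0 k z : 0 <= psi k z by rewrite divr_ge0 // ltW.
have cl k : closure [set z | psi k z != 0] `<=` fK (tnth t k).
  have [[cK _ _ _] [_ K0 _ _]] := H (tnth t k).
  apply: subset_trans cK; apply: closureS => z /=.
  by apply: contraNP => Kz; rewrite /psi /b K0 // mul0r.
have psiS z : \sum_k psi k z = 1 by rewrite -mulr_suml divff // gt_eqF.
have sup k : closure [set z | psi k z != 0] `<=` chart_dom (fa (tnth t k)).
  by apply: subset_trans (cl k) _; have [[]] := H (tnth t k).
exists (@PartitionOfUnity R n M A _ (fun k => fa (tnth t k)) psi spsi psi0 sup psiS), (tnth t).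
by move=> k; apply: subset_trans (cl k) _; have [[]] := H (tnth t k).
Qed.

End Charts.

(** * Making a map affine far from a point *)

Section Blend.
Variables (R : realType) (n : nat).
Implicit Types (p y : 'rV[R]_n) (s d : R).

Lemma differentiable_estimate (F : 'rV[R]_n -> 'rV[R]_n) p (kap : R) :
  differentiable F p -> 0 < kap ->
  exists2 d : R, 0 < d & forall y, `|y - p| < d ->
    `|F y - (F p + (y - p) *m jacobian F p)| <= kap * `|y - p|.
Proof.
move=> dF kap0.
have /eqaddoP/(_ _ kap0)/nbhs_ballP[d /= d0 H] := diff_locally dF; exists d => // y yd.
have := H (y - p); rewrite -ball_normE /= sub0r normrN => /(_ yd).
by rewrite !fctE /= subrK -deriveE // deriveEjacobian.
Qed.

(** Equal to 1 within squared distance s of p and to 0 beyond squared distance 4 s. The two bumps in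
    the denominator have no common zero. *)
Definition cutoff p s y : R :=
  bump_fun 0 (4 * s - sqd p y) / (bump_fun 0 (4 * s - sqd p y) + bump_fun 0 (sqd p y - s)).

Lemma cutoff_den p s y : 0 < s -> 0 < bump_fun 0 (4 * s - sqd p y) + bump_fun 0 (sqd p y - s).
Proof.
move=> s0; have [H|H] := ltP (sqd p y) (4 * s).
  by rewrite ltr_pwDl ?bump_ge0 // bump_gt0 subr_gt0.
by rewrite addrC ltr_pwDl ?bump_ge0 // bump_gt0; lra.
Qed.

Lemma cutoff1 p s y : 0 < s -> sqd p y < s -> cutoff p s y = 1.
Proof.
move=> s0 H; have := cutoff_den p y s0; rewrite /cutoff.
by rewrite (@bump_eq0 _ (sqd p y - s)) ?addr0 => [/gt_eqF/negbT/divff|]; last lra.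
Qed.

Lemma cutoff0 p s y : 4 * s <= sqd p y -> cutoff p s y = 0.
Proof. by move=> H; rewrite /cutoff bump_eq0 ?mul0r //; lra. Qed.

Lemma cutoff_norm p s y : 0 < s -> `|cutoff p s y| <= 1.
Proof.
move=> s0; have D := cutoff_den p y s0.
rewrite ger0_norm ?divr_ge0 ?bump_ge0 ?(ltW D) //.
by rewrite ler_pdivrMr // mul1r lerDl bump_ge0.
Qed.

Lemma smooth_cutoff U p s : 0 < s -> open U -> smooth_on U (cutoff p s).
Proof.
move=> s0 oU k.
have c1 : continuously_differentiable k U (fun y => bump_fun 0 (4 * s - sqd p y)).
  exact: (CD_bump 0 oU (CDB oU (CD_cst _ _ _) (smooth_sqd p oU k))).
have c2 : continuously_differentiable k U (fun y => bump_fun 0 (sqd p y - s)).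
  exact: (CD_bump 0 oU (CDB oU (smooth_sqd p oU k) (CD_cst _ _ _))).
apply: (CDM oU c1); apply: (CDV oU _ (CDD oU c1 c2)) => y _.
by rewrite gt_eqF // cutoff_den.
Qed.

(* G is F near p and affine far from p; the last clause says that the points where
   G is not F are mapped away from F p. *)
Lemma blend (F : 'rV[R]_n -> 'rV[R]_n) (W : set 'rV[R]_n) p :
  open W -> W p -> (forall j, smooth_on W (fun y => F y 0 j)) -> jacobian F p \in unitmx ->
  exists (s delta S : R) (b : 'rV[R]_n) (G : 'rV[R]_n -> 'rV[R]_n),
  [/\ 0 < s, 0 < delta, forall j, smooth_on setT (fun y => G y 0 j) &
      forall y, S < `|y| -> G y = y *m jacobian F p + b] /\
  (forall y, sqd p y < s -> W y /\ G y = F y) /\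
  (forall y, s <= sqd p y -> delta <= `|G y - F p|).
Proof.
move=> oW Wp sF uJ; set J := jacobian F p in uJ *.
have dF : differentiable F p.
  by apply: differentiable_rV => j; apply: C1_differentiable oW (sF j 1%N) Wp.
pose C := \sum_i \sum_j `|invmx J i j| + 1.
have C0 : 0 < C by rewrite ltr_wpDl // sumr_ge0 // => i _; rewrite sumr_ge0.
have HC (v : 'rV[R]_n) : `|v| <= C * `|v *m J|.
  rewrite -{1}(mulmxK uJ v) (le_trans (norm_mulmx _ _)) // ler_wpM2r // lerDl //.
(* With this kap the error kap |y - p| of the linear approximation is at most half of |(y - p) J|,
   which is at least |y - p| / C; hence G y stays at distance at least kap |y - p| from F p. *)
pose kap := (2 * C)^-1; have kap0 : 0 < kap by rewrite invr_gt0 mulr_gt0.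
have [d1 d10 est] := differentiable_estimate dF kap0.
have /nbhs_ballP[d2 /= d20 dW] := open_nbhs_nbhs (conj oW Wp).
pose d := Num.min d1 d2; have d0 : 0 < d by rewrite lt_min d10.
(* The cutoff lives within squared distance 4 s = (d / 2)^2, well inside the ball of radius d on
   which F is defined and estimated. *)
pose s := (d / 4) ^+ 2; have s0 : 0 < s by rewrite exprn_gt0 // divr_gt0.
have sd : 4 * s < d ^+ 2 by rewrite /s; have : 0 < d ^+ 2 by [rewrite exprn_gt0]; lra.
have nearW y : sqd p y < d ^+ 2 -> W y /\ `|F y - (F p + (y - p) *m J)| <= kap * `|y - p|.
  move=> /(sqd_lt (ltW d0)); rewrite lt_min => /andP[y1 y2]; split; last exact: est.
  by apply: dW; rewrite -ball_normE /= distrC.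
pose b := F p - p *m J.
have bE y : y *m J + b = F p + (y - p) *m J by rewrite mulmxBl /b addrCA.
pose G y := y *m J + b + (if `[< W y >] then cutoff p s y *: (F y - (y *m J + b)) else 0).
have Gfar y : 4 * s <= sqd p y -> G y = y *m J + b.
  by move=> H; rewrite /G cutoff0 // scale0r if_same addr0.
(* The minimum bounds |y - p| from below when s <= sqd p y, as sqd p y <= n |y - p|^2 <= n |y - p|
   if |y - p| <= 1. Beyond the given radius |y - p| > 1 + 4 s, so its square exceeds 4 s and the
   cutoff is 0. *)
exists s, (kap * Num.min 1 (s / (n%:R + 1))), (`|p| + 1 + 4 * s), b, G; split; last split.
- split=> //.
  + by rewrite mulr_gt0 // lt_min ltr01 divr_gt0 // ltr_wpDl.
  + move=> j k; apply: CD_local => y _; have [H|H] := ltP (sqd p y) (d ^+ 2).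
      have oV := @open_sqd_lt R n p (d ^+ 2); exists [set y | sqd p y < d ^+ 2] => //.
      apply: (CD_eq oV _ (f := fun y => (y *m J + b) 0 j + cutoff p s y * (F y 0 j - (y *m J + b) 0 j))).
        by move=> z /nearW[Wz _]; rewrite /G asboolT // !mxE.
      have sA : continuously_differentiable k [set y | sqd p y < d ^+ 2] (fun y => (y *m J + b) 0 j).
        by apply: CD_sub (smooth_affine J b j k).
      apply: (CDD oV sA); apply: (CDM oV (smooth_cutoff p s0 oV k)); apply: (CDB oV _ sA).
      by apply: CD_sub (sF j k) => z /nearW[].
    have oV := @open_sqd_gt R n p (4 * s); exists [set y | 4 * s < sqd p y]; first exact: lt_le_trans sd H.
    apply: (CD_eq oV _ (f := fun y => (y *m J + b) 0 j)).
      by move=> z zs; rewrite Gfar // ltW.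
    by apply: CD_sub (smooth_affine J b j k).
  + move=> y Hy; apply: Gfar; apply: le_trans (norm_sqd p y).
    have H : 1 + 4 * s < `|y - p| by have := ler_normD (y - p) p; rewrite subrK; lra.
    apply: le_trans (_ : `|y - p| <= _); first lra.
    by rewrite expr2 ler_peMr //; lra.
- move=> y ys; have [Wy _] : W y /\ `|F y - (F p + (y - p) *m J)| <= kap * `|y - p| by apply: nearW; lra.
  by split=> //; rewrite /G asboolT // cutoff1 // scale1r addrC subrK.
move=> y ys.
have P : `|G y - (F p + (y - p) *m J)| <= kap * `|y - p|.
  rewrite -bE /G [_ + b + _]addrC addrK; case: asboolP => Wy; last by rewrite normr0 mulr_ge0 // ltW.
  rewrite normrZ; have [H|H] := ltP (sqd p y) (d ^+ 2).
    rewrite -[leRHS]mul1r ler_pM // ?cutoff_norm // bE; by have [] := nearW y H.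
  by rewrite cutoff0 ?normr0 ?mul0r ?mulr_ge0 ?(ltW kap0) //; apply: le_trans H; exact: ltW.
have L : 2 * kap * `|y - p| <= `|(y - p) *m J|.
  rewrite /kap invfM mulrA mulfV // mul1r mulrC ler_pdivrMr // mulrC; exact: HC.
apply: (@le_trans _ _ (kap * `|y - p|)).
  rewrite ler_wpM2l ?(ltW kap0) // leNgt lt_min; apply/negP => /andP[y1 y2].
  move: ys; rewrite leNgt => /negP; apply; apply: le_lt_trans (sqd_norm p y) _.
  apply: (@le_lt_trans _ _ (n%:R * `|y - p|)).
    by rewrite ler_wpM2l // expr2 ler_piMr // ltW.
  apply: (@le_lt_trans _ _ ((n%:R + 1) * `|y - p| - `|y - p|)); first by rewrite mulrDl mul1r addrK.
  move: y2; rewrite ltr_pdivlMr ?ltr_wpDl // mulrC; have := normr_ge0 (y - p).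
  by set t := _ * `|_|; lra.
have E : (y - p) *m J = (G y - F p) - (G y - (F p + (y - p) *m J)).
  by rewrite opprB [RHS]addrC addrA subrK addrAC subrr add0r.
have := ler_normB (G y - F p) (G y - (F p + (y - p) *m J)); rewrite -E; move: L P; rewrite -mulrA.
by set t := kap * _; lra.
Qed.

End Blend.

(** * Smooth functions with compact support *)

Section CompactlySupported.
Variables (R : realType) (n : nat).
Implicit Types (f g : 'rV[R]_n -> R).

Definition csmooth f : Prop := exists S : R, Csm S f.

Lemma csmoothD f g : csmooth f -> csmooth g -> csmooth (fun y => f y + g y).
Proof.
move=> [S fS] [T gT]; exists (Num.max S T); split.
  by move=> k; exact: (CDD openT (fS.1 k) (gT.1 k)).
by move=> y; rewrite gt_max => /andP[/fS.2-> /gT.2->]; rewrite addr0.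
Qed.

Lemma csmoothZ c f : csmooth f -> csmooth (fun y => c * f y).
Proof.
move=> [S fS]; exists S; split; first by move=> k; exact: (CDZ c openT (fS.1 k)).
by move=> y /fS.2->; rewrite mulr0.
Qed.

Lemma csmooth_sum (T : Type) (r : seq T) (F : T -> 'rV[R]_n -> R) : (forall t, csmooth (F t)) ->
  csmooth (fun y => \sum_(t <- r) F t y).
Proof.
move=> H; elim: r => [|t r IH].
  exists 0; rewrite (_ : (fun y => _) = fun=> 0); last by apply/funext => y; rewrite big_nil.
  by split=> // k; exact: CD_cst.
rewrite (_ : (fun y => _) = fun y => F t y + \sum_(t <- r) F t y); first exact: csmoothD.
by apply/funext => y; rewrite big_cons.
Qed.

Lemma csmooth_intD f g : csmooth f -> csmooth g ->
  integral_rV (fun y => f y + g y) = integral_rV f + integral_rV g.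
Proof.
move=> [S /Csm_Cc fS] [T /Csm_Cc gT]; apply: (intD (S := Num.max S T)).
  by apply: Cc_le fS; rewrite le_max lexx.
by apply: Cc_le gT; rewrite le_max lexx orbT.
Qed.

Lemma csmooth_intZ c f : csmooth f -> integral_rV (fun y => c * f y) = c * integral_rV f.
Proof. by move=> [S /Csm_Cc]; exact: intZ. Qed.

Lemma csmooth_int_sum (T : Type) (r : seq T) (F : T -> 'rV[R]_n -> R) : (forall t, csmooth (F t)) ->
  integral_rV (fun y => \sum_(t <- r) F t y) = \sum_(t <- r) integral_rV (F t).
Proof.
move=> H; elim: r => [|t r IH].
  by rewrite [RHS]big_nil -[RHS](int0 R n); apply: eq_int => y; rewrite big_nil.
rewrite big_cons -IH -(csmooth_intD (H t) (csmooth_sum r H)).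
by apply: eq_int => y; rewrite big_cons.
Qed.

End CompactlySupported.

(** * Integrals over charts *)

Section ChartIntegrals.
Variables (R : realType) (n : nat) (M : topologicalType) (A : oriented_atlas R n M).
Hypotheses (hM : hausdorff_space M) (cM : compact [set: M]).
Implicit Types (a b c : chart_index A) (x z : M) (y : 'rV[R]_n) (u v : M -> R) (K : set M).

Definition cfun a u : 'rV[R]_n -> R := (fun y => u (chart_inv a y)) \_ (img a).
Definition cint a u : R := integral_rV (cfun a u).
Definition csm a u : Prop := smooth_on (img a) (fun y => u (chart_inv a y)).
Definition vanish_off a K u : Prop := forall x, chart_dom a x -> ~ K x -> u x = 0.

Lemma cfun_in a u y : img a y -> cfun a u y = u (chart_inv a y).
Proof. exact: restrict_in. Qed.
Lemma cfun_out a u y : ~ img a y -> cfun a u y = 0.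
Proof. exact: restrict_out. Qed.

Lemma eq_cint a u v : (forall x, chart_dom a x -> u x = v x) -> cint a u = cint a v.
Proof.
move=> uv; apply: eq_int => y; have [Vy|Vy] := pselect (img a y); last by rewrite !cfun_out.
by rewrite !cfun_in // uv //; exact: img_dom.
Qed.

Lemma compact_chart_image a K : closed K -> K `<=` chart_dom a -> compact (chart a @` K).
Proof.
move=> cK Ka; apply: (@continuous_compact _ _ (chart a) K); last by apply: subclosed_compact cK cM _.
by apply: continuous_in_subspaceT => x /set_mem/Ka; exact: chart_continuous.
Qed.

Lemma closed_chart_image a K : closed K -> K `<=` chart_dom a -> closed (chart a @` K).
Proof.
by move=> cK Ka; apply: compact_closed (compact_chart_image cK Ka); exact: norm_hausdorff.
Qed.

Lemma cfun_off a u K y : vanish_off a K u -> ~ (chart a @` K) y -> cfun a u y = 0.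
Proof.
move=> uK Ky; have [Vy|Vy] := pselect (img a y); last exact: cfun_out.
rewrite cfun_in // uK //; first exact: img_dom.
by move=> Kx; apply: Ky; exists (chart_inv a y) => //; exact: chart_invK.
Qed.

(** The image of K in the chart is compact, hence closed and bounded: off it the extension by 0 is
    locally zero, also at the boundary of the chart image. *)
Lemma cfun_csmooth a u K : closed K -> K `<=` chart_dom a -> csm a u -> vanish_off a K u ->
  csmooth (cfun a u).
Proof.
move=> cK Ka su uK.
have clK := closed_chart_image cK Ka; have off y := @cfun_off a u K y uK.
have [S [_ HS]] := compact_bounded (compact_chart_image cK Ka).
exists (S + 1); split=> [k|y Sy]; last first.
  apply: off => Ky; have S1 : S < S + 1 by rewrite ltrDl.
  by have := HS _ S1 y Ky; rewrite /= leNgt Sy.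
apply: CD_local => y _; have [Vy|Vy] := pselect (img a y).
  by exists (img a) => //; apply: (CD_eq (@img_open _ _ _ _ a) _ (su k)) => z Vz; rewrite cfun_in.
exists (~` (chart a @` K)).
  by move=> [x Kx xy]; apply: Vy; exists x => //; exact: Ka.
by apply: (CD_eq (closed_openC clK) _ (CD_cst k _ 0)) => z Kz; rewrite off.
Qed.

Lemma jacobian_trans a b y : ov a b y -> jacobian (trans a b) y = jac (trans a b) y.
Proof.
move=> oy; apply: jacobianE => j.
exact: (C1_differentiable (@ov_open _ _ _ _ a b) (@trans_smooth _ _ _ _ a b j 1%N) oy).
Qed.

Lemma trans_jac a b x : chart_dom a x -> chart_dom b x ->
  transition_jacobian a b x = jac (trans a b) (chart a x).
Proof. by move=> ax bx; rewrite -jacobian_trans //; exact: ov_chart. Qed.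

(** The transition function is replaced by its blend G, to which the global formula applies. On N1
    they agree; N2 is cut down to a ball that G does not reach from outside N1, so the points where
    G is artificial contribute nothing. *)
Lemma local_change_of_variables a b x0 : chart_dom a x0 -> chart_dom b x0 ->
  exists N : set M, [/\ open N, N x0, N `<=` chart_dom a, N `<=` chart_dom b &
    forall K u v, closed K -> K `<=` N -> csm a u -> csm b v ->
      vanish_off a K u -> vanish_off b K v ->
      (forall x, chart_dom a x -> chart_dom b x -> u x = \det (transition_jacobian a b x) * v x) ->
      cint a u = cint b v].
Proof.
move=> ax0 bx0; pose p := chart a x0.
have dJ : 0 < \det (jacobian (trans a b) p) := transition_oriented ax0 bx0.
have uJ : jacobian (trans a b) p \in unitmx by rewrite unitmxE unitfE gt_eqF.
have [s [del [S [t [G [[s0 del0 sG GS] [G1 G2]]]]]]] :=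
  blend (@ov_open _ _ _ _ a b) (ov_chart ax0 bx0) (@trans_smooth _ _ _ _ a b) uJ.
rewrite -/p in G1 G2 GS.
pose q := trans a b p; have qE : q = chart b x0 by rewrite /q /trans /p chartK.
pose N1 := [set x | chart_dom a x /\ [set y | sqd p y < s] (chart a x)].
pose N2 := [set x | chart_dom b x /\ (ball q del) (chart b x)].
have oN1 : open N1 by apply: open_dom_pre; exact: open_sqd_lt.
have oN2 : open N2 by apply: open_dom_pre; exact: ball_open.
exists (N1 `&` N2); split.
- exact: openI.
- split; split=> //=; first by rewrite -/p sqdpp.
  by rewrite -qE; exact: ballxx.
- by move=> x [[]].
- by move=> x [_ []].
move=> K u v cK KN su sv uK vK uv.
have Kb : K `<=` chart_dom b by move=> x /KN[_ []].
have [T fT] := cfun_csmooth cK Kb sv vK.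
rewrite /cint -(change_of_variables sG GS dJ fT); apply: eq_int => y.
have [ys|sy] := ltP (sqd p y) s.
  have [oy Gy] := G1 y ys; have [Vy by_] := oy.
  have -> : jac G y = transition_jacobian a b (chart_inv a y).
    rewrite (trans_jac (img_dom Vy) by_) chart_invK //.
    apply/matrixP => i j; rewrite !mxE; apply: near_eq_derive.
    apply: (near_eq_on (@open_sqd_lt _ _ p s) _ ys) => z zs.
    by rewrite (G1 z zs).2.
  rewrite cfun_in // uv //; last exact: img_dom.
  by rewrite Gy cfun_in /trans ?chartK //; exact: img_chart.
have -> : cfun a u y = 0.
  have [Vy|Vy] := pselect (img a y); last exact: cfun_out.
  rewrite cfun_in // uK //; first exact: img_dom.
  by move=> /KN[[_ /=]]; rewrite chart_invK // ltNge sy.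
have [Vy|Vy] := pselect (img b (G y)); last by rewrite cfun_out // mulr0.
rewrite cfun_in // vK ?mulr0 //; first exact: img_dom.
move=> /KN[_ [_]] /=; rewrite chart_invK // -ball_normE /= distrC ltNge.
by rewrite G2.
Qed.

End ChartIntegrals.

(** * Forms on M and Stokes' theorem *)

Section Forms.
Variables (R : realType) (n : nat) (M : topologicalType) (A : oriented_atlas R n M).
Implicit Types (a b c : chart_index A) (x z : M) (y : 'rV[R]_n) (alpha beta : local_field A (ext R n)).

Definition loc alpha a y : ext R n := alpha a (chart_inv a y).

Lemma smooth_extP alpha : smooth_ext alpha <-> forall a, smooth_form (img a) (loc alpha a).
Proof. by split=> H => [a I|I a]; [exact: H I a|exact: H a I]. Qed.

Lemma smooth_loc alpha a : smooth_ext alpha -> smooth_form (img a) (loc alpha a).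
Proof. by move/smooth_extP. Qed.

Lemma smooth_ext_eq alpha beta : field_eq alpha beta -> smooth_ext alpha -> smooth_ext beta.
Proof.
move=> ab sa; apply/smooth_extP => a; apply: smooth_form_eq (smooth_loc a sa); first exact: img_open.
by move=> y Vy; apply: ab; exact: img_dom.
Qed.

Lemma is_form_eq alpha beta : field_eq alpha beta -> is_form alpha -> is_form beta.
Proof.
move=> ab [sa ta]; split; first exact: smooth_ext_eq ab sa.
by move=> a b x ax bx; rewrite -!ab //; exact: ta.
Qed.

Lemma ext_dE alpha a x : ext_d alpha a x = dext (loc alpha a) (chart a x).
Proof. by apply: eq_bigr => i _; rewrite covector1. Qed.

Lemma loc_ext_d alpha a y : img a y -> loc (ext_d alpha) a y = dext (loc alpha a) y.
Proof. by move=> Vy; rewrite /loc ext_dE chart_invK. Qed.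

Lemma ext_d_eq alpha beta : field_eq alpha beta -> field_eq (ext_d alpha) (ext_d beta).
Proof.
move=> ab a x ax; rewrite !ext_dE; apply: dext_eq (@img_open _ _ _ _ a) _ (img_chart ax).
by move=> y Vy; apply: ab; exact: img_dom.
Qed.

Lemma smooth_ext_d alpha : smooth_ext alpha -> smooth_ext (ext_d alpha).
Proof.
move=> sa; apply/smooth_extP => a.
apply: smooth_form_eq (smooth_dext (@img_open _ _ _ _ a) (smooth_loc a sa)); first exact: img_open.
by move=> y Vy; rewrite loc_ext_d.
Qed.

Lemma loc_pull alpha a b y : is_form alpha -> ov a b y ->
  loc alpha a y = pull (trans a b) (loc alpha b) y.
Proof.
move=> [sa ta] oy; have [Vy dy] := oy; rewrite {1}/loc (ta a b _ (img_dom Vy) dy).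
by rewrite (trans_jac (img_dom Vy) dy) chart_invK // /pull /loc /trans chartK.
Qed.

Lemma is_form_ext_d alpha : is_form alpha -> is_form (ext_d alpha).
Proof.
move=> fa; split; first by apply: smooth_ext_d; case: fa.
move=> a b x ax bx; have oy := ov_chart ax bx; rewrite !ext_dE (trans_jac ax bx).
have UV y : ov a b y -> img b (trans a b y) by move=> [_ /img_chart].
have E1 := dext_eq (@ov_open _ _ _ _ a b) (fun (z : 'rV[R]_n) oz => loc_pull fa oz) oy.
have E2 := dext_pull (@ov_open _ _ _ _ a b) (@img_open _ _ _ _ b) UV (@trans_smooth _ _ _ _ a b)
  (smooth_loc b fa.1) oy.
by rewrite {}E1 {}E2 /pull /trans chartK.
Qed.

Lemma smooth_extD alpha beta : smooth_ext alpha -> smooth_ext beta ->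
  smooth_ext (fun a x => alpha a x + beta a x).
Proof.
move=> sa sb; apply/smooth_extP => a; apply: smooth_formD (@img_open _ _ _ _ a) _ _; exact: smooth_loc.
Qed.

Lemma smooth_ext_scale (f : local_field A R) alpha : smooth_field f -> smooth_ext alpha ->
  smooth_ext (fun a x => f a x *: alpha a x).
Proof.
move=> sf sa; apply/smooth_extP => a.
by apply: (smooth_formZ (@img_open _ _ _ _ a) (sf a)); exact: smooth_loc.
Qed.

Lemma smooth_field_cst k : smooth_field ((fun _ _ => k) : local_field A R).
Proof. by move=> a l; exact: CD_cst. Qed.

Lemma smooth_extZ k alpha : smooth_ext alpha -> smooth_ext (fun a x => k *: alpha a x).
Proof. exact: smooth_ext_scale (smooth_field_cst k). Qed.

Lemma smooth_ext_wedge alpha beta : smooth_ext alpha -> smooth_ext beta ->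
  smooth_ext (fun a x => wedge (alpha a x) (beta a x)).
Proof.
move=> sa sb; apply/smooth_extP => a; apply: (smooth_wedge (@img_open _ _ _ _ a)); exact: smooth_loc.
Qed.

Lemma smooth_ext_dscale h alpha : smooth_ext alpha -> smooth_ext (fun a x => dscale h (alpha a x)).
Proof.
by move=> sa; apply/smooth_extP => a; apply: (smooth_dscale h (@img_open _ _ _ _ a)); exact: smooth_loc.
Qed.

Lemma is_formD alpha beta : is_form alpha -> is_form beta -> is_form (fun a x => alpha a x + beta a x).
Proof.
move=> [sa ta] [sb tb]; split; first exact: smooth_extD.
by move=> a b x ax bx; rewrite ext_mapD -ta // -tb.
Qed.

Lemma is_form_scale (f : M -> R) alpha : smooth_field ((fun _ => f) : local_field A R) ->
  is_form alpha -> is_form (fun a x => f x *: alpha a x).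
Proof.
move=> sf [sa ta]; split; first exact: (smooth_ext_scale sf sa).
by move=> a b x ax bx; rewrite ext_mapZ -ta.
Qed.

Lemma is_formZ k alpha : is_form alpha -> is_form (fun a x => k *: alpha a x).
Proof. exact: (is_form_scale (f := fun=> k) (smooth_field_cst k)). Qed.

Lemma is_form_wedge alpha beta : is_form alpha -> is_form beta ->
  is_form (fun a x => wedge (alpha a x) (beta a x)).
Proof.
move=> [sa ta] [sb tb]; split; first exact: smooth_ext_wedge.
by move=> a b x ax bx; rewrite ext_mapM -ta // -tb.
Qed.

Lemma is_form_dscale h alpha : is_form alpha -> is_form (fun a x => dscale h (alpha a x)).
Proof.
move=> [sa ta]; split; first exact: smooth_ext_dscale.
by move=> a b x ax bx; rewrite ext_map_dscale -ta.
Qed.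

Lemma ext_d_sum m (F : 'I_m -> local_field A (ext R n)) a x :
  (forall j, smooth_ext (F j)) -> chart_dom a x ->
  ext_d (fun a x => \sum_j F j a x) a x = \sum_j ext_d (F j) a x.
Proof.
move=> HF ax; rewrite ext_dE.
rewrite (@dext_sum _ _ (img a) _ _ xpredT (fun j => loc (F j) a)) //; last first.
- exact: img_chart.
- by move=> j _; exact: smooth_loc.
- exact: img_open.
by apply: eq_bigr => j _; rewrite ext_dE.
Qed.

Lemma ext_d_wedge alpha beta a x : smooth_ext alpha -> smooth_ext beta -> chart_dom a x ->
  ext_d (fun a x => wedge (alpha a x) (beta a x)) a x =
  wedge (ext_d alpha a x) (beta a x) + wedge (tilde (alpha a x)) (ext_d beta a x).
Proof.
move=> sa sb ax; rewrite !ext_dE.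
have := dext_wedge (smooth_loc a sa) (smooth_loc a sb) (img_chart ax).
by rewrite /loc chartK.
Qed.

Lemma ext_d_vanish alpha a (K : set M) x : closed K ->
  (forall x, chart_dom a x -> ~ K x -> alpha a x = 0) -> chart_dom a x -> ~ K x ->
  ext_d alpha a x = 0.
Proof.
move=> cK a0 ax Kx; have oW := open_img_pre (a := a) (closed_openC cK).
rewrite ext_dE (dext_eq oW (beta := fun=> 0)) ?dext_cst //.
  by move=> z [Vz Kz]; apply: a0 => //; exact: img_dom.
by split=> /=; [exact: img_chart|rewrite chartK].
Qed.

Lemma top_transition alpha a b x : is_form alpha -> chart_dom a x -> chart_dom b x ->
  alpha a x finset.setT = \det (transition_jacobian a b x) * alpha b x finset.setT.
Proof. by move=> [_ ta] ax bx; rewrite (ta a b) // top_map. Qed.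

Lemma csm_top alpha a : smooth_ext alpha -> csm a (fun x => alpha a x finset.setT).
Proof. by move=> sa; exact: smooth_loc a sa finset.setT. Qed.

Lemma csm_mul a (u v : M -> R) : csm a u -> csm a v -> csm a (fun x => u x * v x).
Proof. by move=> su sv k; exact: (CDM (@img_open _ _ _ _ a) (su k) (sv k)). Qed.

Hypotheses (hM : hausdorff_space M) (cM : compact [set: M]).

(** In a chart the top component of d alpha is a sum of signed partial derivatives of the
    coefficients, which have compact support. *)
Lemma chart_stokes alpha a (K : set M) : smooth_ext alpha -> closed K -> K `<=` chart_dom a ->
  (forall x, chart_dom a x -> ~ K x -> alpha a x = 0) ->
  cint a (fun x => ext_d alpha a x finset.setT) = 0.
Proof.
move=> sa cK Ka a0; have clK := closed_chart_image cM cK Ka.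
pose al I x := alpha a x I.
have van I : vanish_off a K (al I) by move=> x ax Kx; rewrite /al a0 // ext0.
have cs I : csmooth (cfun a (al I)).
  apply: (cfun_csmooth cM cK Ka _ (van I)); exact: smooth_loc a sa I.
have E y : cfun a (fun x => ext_d alpha a x finset.setT) y =
    \sum_i shuffle_sign R [set i]%SET (~: [set i])%SET * partial i (cfun a (al (~: [set i])%SET)) y.
  have [Vy|Vy] := pselect (img a y).
    rewrite cfun_in // -[LHS]/(loc (ext_d alpha) a y finset.setT) loc_ext_d // dext_top.
    apply: eq_bigr => i _; congr (_ * _); apply: near_eq_derive.
    by apply: (near_eq_on (@img_open _ _ _ _ a) _ Vy) => z Vz; rewrite cfun_in.
  rewrite cfun_out // big1 // => i _.
  have Ky : (~` (chart a @` K)) y by move=> [x Kx xy]; apply: Vy; exists x => //; exact: Ka.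
  rewrite (_ : partial i _ y = 0) ?mulr0 // -(@derive_cst R 'rV[R]_n R^o 0 y (delta_mx 0 i)).
  apply: near_eq_derive; apply: (near_eq_on (closed_openC clK) _ Ky) => z Kz.
  exact: cfun_off (van _) Kz.
have cp i : csmooth (fun y => shuffle_sign R [set i]%SET (~: [set i])%SET * partial i (cfun a (al (~: [set i])%SET)) y).
  by apply: csmoothZ; have [S fS] := cs (~: [set i])%SET; exists S; exact: Csm_partial.
rewrite /cint (eq_int E) csmooth_int_sum // big1 // => i _.
have [S fS] := cs (~: [set i])%SET.
by rewrite (intZ _ (Csm_Cc (Csm_partial i fS))) (int_partial i fS) mulr0.
Qed.

Local Notation pchart P := (@pou_chart R n M A P).
Local Notation pfun P := (@pou_fun R n M A P).

Lemma pou_integralE (P : partition_of_unity A) alpha : pou_integral P alpha =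
  \sum_k cint (pchart P k) (fun x => pfun P k x * alpha (pchart P k) x finset.setT).
Proof. by []. Qed.

Lemma pou_csmooth (P : partition_of_unity A) k (u : M -> R) : csm (pchart P k) u ->
  csmooth (cfun (pchart P k) (fun x => pfun P k x * u x)).
Proof.
move=> su; apply: (cfun_csmooth cM (@closed_closure _ _) (@pou_support _ _ _ _ P k)).
  exact: csm_mul (@pou_smooth _ _ _ _ P k (pchart P k)) su.
move=> x _ Kx; rewrite (_ : pfun P k x = 0) ?mul0r //; apply/eqP; apply: contrapT => /negP H.
by apply: Kx; apply: subset_closure.
Qed.

Lemma pou_integral_eq (P : partition_of_unity A) alpha beta :
  (forall a x, chart_dom a x -> alpha a x finset.setT = beta a x finset.setT) ->
  pou_integral P alpha = pou_integral P beta.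
Proof.
by move=> ab; rewrite !pou_integralE; apply: eq_bigr => k _; apply: eq_cint => x ax; rewrite ab.
Qed.

Lemma pou_integralD (P : partition_of_unity A) alpha beta : smooth_ext alpha -> smooth_ext beta ->
  pou_integral P (fun a x => alpha a x + beta a x) = pou_integral P alpha + pou_integral P beta.
Proof.
move=> sa sb; rewrite !pou_integralE -big_split /=; apply: eq_bigr => k _.
rewrite /cint -csmooth_intD; try by apply: pou_csmooth; exact: csm_top.
apply: eq_int => y; have [Vy|Vy] := pselect (img (pchart P k) y).
  by rewrite !cfun_in // extD mulrDr.
by rewrite !cfun_out // addr0.
Qed.

Lemma pou_integralZ (P : partition_of_unity A) (r : R) alpha : smooth_ext alpha ->
  pou_integral P (fun a x => r *: alpha a x) = r * pou_integral P alpha.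
Proof.
move=> sa; rewrite !pou_integralE mulr_sumr; apply: eq_bigr => k _.
rewrite /cint -csmooth_intZ; last by apply: pou_csmooth; exact: csm_top.
apply: eq_int => y; have [Vy|Vy] := pselect (img (pchart P k) y).
  by rewrite !cfun_in // extZ mulrCA.
by rewrite !cfun_out // mulr0.
Qed.

(** The terms of the partition are nonnegative, so each integral vanishes and with it each
    continuous integrand. At a given x some function of [P] is nonzero, and the top component
    changes between charts only by a factor. *)
Lemma pou_integral_pos (P : partition_of_unity A) alpha : is_form alpha ->
  (forall a x, chart_dom a x -> 0 <= alpha a x finset.setT) -> pou_integral P alpha = 0 ->
  forall a x, chart_dom a x -> alpha a x finset.setT = 0.
Proof.
move=> fa a0 I0 a x ax.
pose u k x := pfun P k x * alpha (pchart P k) x finset.setT.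
have u0 k y : 0 <= cfun (pchart P k) (u k) y.
  have [Vy|Vy] := pselect (img (pchart P k) y); last by rewrite cfun_out.
  by rewrite cfun_in // mulr_ge0 ?pou_ge0 // a0 //; exact: img_dom.
have Ik k : cint (pchart P k) (u k) = 0.
  have I1 l : 0 <= cint (pchart P l) (u l) by apply: intN_ge0 => y; exact: u0.
  apply/eqP; move: I0; rewrite pou_integralE => /eqP; rewrite psumr_eq0 => [|l _]; last exact: I1.
  by move=> /allP/(_ k); apply; rewrite mem_index_enum.
have [k pk] : exists k, pfun P k x != 0.
  apply: contrapT => H; have /eqP := @pou_sum _ _ _ _ P x; rewrite big1 ?(eq_sym 0) ?oner_eq0 // => k _.
  by apply/eqP; apply: contrapT => /negP pk; apply: H; exists k.
have kx : chart_dom (pchart P k) x by apply: (@pou_support _ _ _ _ P k); apply: subset_closure.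
have [S fS] := pou_csmooth (P := P) (k := k) (csm_top (pchart P k) fa.1).
have := intN_eq0 (Csm_Cc fS) (u0 k) (Ik k) (chart (pchart P k) x).
rewrite cfun_in ?chartK //; last exact: img_chart.
by move=> /eqP; rewrite /u mulf_eq0 (negbTE pk) /= (top_transition fa ax kx) => /eqP->; rewrite mulr0.
Qed.

Lemma cint0 a (u : M -> R) : (forall x, chart_dom a x -> u x = 0) -> cint a u = 0.
Proof.
move=> u0; rewrite -[RHS](int0 R n); apply: eq_int => y.
have [Vy|Vy] := pselect (img a y); last by rewrite cfun_out.
by rewrite cfun_in // u0 //; exact: img_dom.
Qed.

(** There are finitely many k, so the neighbourhoods found for each can be intersected. If x0 lies
    in the k-th chart, the local change of variables applies; otherwise the neighbourhood avoids the
    support of the k-th function and both integrals are 0. *)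
Lemma common_chart (P : partition_of_unity A) x0 : exists b (N : set M), 
  [/\ open N, N x0, N `<=` chart_dom b &
  forall k (K : set M) alpha, closed K -> K `<=` N -> is_form alpha ->
   (forall a x, chart_dom a x -> ~ K x -> alpha a x = 0) ->
   cint (pchart P k) (fun x => pfun P k x * alpha (pchart P k) x finset.setT) =
   cint b (fun x => pfun P k x * alpha b x finset.setT)].
Proof.
have [b bx0] := chart_dom_cover A x0.
have loc1 k : exists N : set M, [/\ open N, N x0, N `<=` chart_dom b &
    forall (K : set M) alpha, closed K -> K `<=` N -> is_form alpha ->
     (forall a x, chart_dom a x -> ~ K x -> alpha a x = 0) ->
   cint (pchart P k) (fun x => pfun P k x * alpha (pchart P k) x finset.setT) =
   cint b (fun x => pfun P k x * alpha b x finset.setT)].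
  have [kx0|kx0] := pselect (chart_dom (pchart P k) x0).
    have [N [oN Nx0 Nk Nb HN]] := local_change_of_variables cM kx0 bx0.
    exists N; split=> // K alpha cK KN fa aK; apply: (HN K) => //.
    - exact: csm_mul (@pou_smooth _ _ _ _ P k _) (csm_top _ fa.1).
    - exact: csm_mul (@pou_smooth _ _ _ _ P k _) (csm_top _ fa.1).
    - by move=> x kx Kx; rewrite aK // ext0 mulr0.
    - by move=> x kx Kx; rewrite aK // ext0 mulr0.
    - by move=> x kx bx; rewrite (top_transition fa kx bx) mulrCA.
  exists (chart_dom b `&` ~` closure [set x | pfun P k x != 0]); split.
  - apply: openI; [exact: chart_dom_open|exact: closed_openC (@closed_closure _ _)].
  - by split=> // /(@pou_support _ _ _ _ P k).
  - by move=> x [].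
  move=> K alpha cK KN fa aK.
  have z a x : chart_dom a x -> pfun P k x * alpha a x finset.setT = 0.
    move=> ax; have [Kx|Kx] := pselect (K x); last by rewrite aK // ext0 mulr0.
    have [_ /= H] := KN x Kx; rewrite (_ : pfun P k x = 0) ?mul0r //.
    by apply/eqP; apply: contrapT => /negP pk; apply: H; exact: subset_closure.
  by rewrite !cint0 //; exact: z.
have [N HN] := choice loc1.
pose N' := chart_dom b `&` [set x | forall k, N k x].
have nN : nbhs x0 N'.
  apply: filterI; first by apply: open_nbhs_nbhs; split=> //; exact: chart_dom_open.
  apply: filter_forall => k; have [oN Nx _ _] := HN k; exact: open_nbhs_nbhs.
have sN : N'° `<=` N' by exact: interior_subset.
exists b, (N'°); split=> //; first exact: open_interior.
  by move=> x /sN[].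
move=> k K alpha cK KN; have [_ _ _ H] := HN k; apply: (H K) => //.
by move=> x /KN/sN[_]; apply.
Qed.

(** The partition [Q] is subordinate to the neighbourhoods that [common_chart] provides for [P], so
    each piece of alpha can be treated in a single chart. *)
Lemma stokes (P : partition_of_unity A) alpha : is_form alpha -> pou_integral P (ext_d alpha) = 0.
Proof.
move=> fa; have [b Hb] := choice (common_chart P); have [N HN] := choice Hb.
have oN x : open (N x) /\ N x x by case: (HN x).
have [Q [pt Hpt]] := @pou_exists R n M A hM cM N oN.
pose be j a x := pfun Q j x *: alpha a x.
have fbe j : is_form (be j).
  by apply: is_form_scale fa => a; exact: (@pou_smooth _ _ _ _ Q j).
have fdbe j := is_form_ext_d (fbe j).
pose K j := closure [set x | pfun Q j x != 0].
have cK j : closed (K j) by exact: closed_closure.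
have be0 j a x : chart_dom a x -> ~ K j x -> be j a x = 0.
  move=> _ Kx; rewrite /be (_ : pfun Q j x = 0) ?scale0r //.
  by apply/eqP; apply: contrapT => /negP H; apply: Kx; exact: subset_closure.
have dbe0 j a x : chart_dom a x -> ~ K j x -> ext_d (be j) a x = 0.
  by apply: (ext_d_vanish (cK j)) => z; exact: be0.
have E : pou_integral P (ext_d alpha) = pou_integral P (fun a x => \sum_j ext_d (be j) a x).
  apply: pou_integral_eq => a x ax; congr (fun_of_fin _ _).
  rewrite -(ext_d_sum (fun j => (fbe j).1) ax); apply: ext_d_eq ax => b' z _.
  by rewrite /be -scaler_suml pou_sum scale1r.
rewrite E pou_integralE.
(* The j-th piece is moved from the k-th chart of [P] to a chart depending on j alone, after which
   the sums can be exchanged. *)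
transitivity (\sum_k \sum_j cint (b (pt j)) (fun x => pfun P k x * ext_d (be j) (b (pt j)) x finset.setT)).
  apply: eq_bigr => k _; set a := pchart P k.
  transitivity (\sum_j cint a (fun x => pfun P k x * ext_d (be j) a x finset.setT)).
    rewrite /cint -csmooth_int_sum => [|j]; last by apply: pou_csmooth; exact: csm_top (fdbe j).1.
    apply: eq_int => y; have [Vy|Vy] := pselect (img a y).
      rewrite !cfun_in // ext_sum mulr_sumr; apply: eq_bigr => j _; by rewrite cfun_in.
    by rewrite cfun_out // big1 // => j _; rewrite cfun_out.
  apply: eq_bigr => j _; have [_ _ _ H] := HN (pt j).
  exact: (H k (K j) (ext_d (be j)) (cK j) (Hpt j) (fdbe j) (dbe0 j)).
rewrite exchange_big /= big1 // => j _; set a := b (pt j).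
have Ka : K j `<=` chart_dom a.
  by have [_ _ + _] := HN (pt j); apply: subset_trans; exact: Hpt.
(* All integrals over k now take place in the same chart, so the functions of [P] add up to 1 under
   the integral. *)
rewrite -[RHS](chart_stokes (fbe j).1 (cK j) Ka (be0 j a)) /cint -csmooth_int_sum; last first.
  move=> k; apply: (cfun_csmooth cM (cK j) Ka).
    exact: csm_mul (@pou_smooth _ _ _ _ P k _) (csm_top _ (fdbe j).1).
  by move=> x ax Kx; rewrite dbe0 // ext0 mulr0.
apply: eq_int => y; have [Vy|Vy] := pselect (img a y).
  rewrite cfun_in // -[RHS]mul1r -(@pou_sum _ _ _ _ P (chart_inv a y)) mulr_suml.
  by apply: eq_bigr => k _; rewrite cfun_in.
by rewrite cfun_out // big1 // => k _; rewrite cfun_out.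
Qed.

(** The whole proof works with this one partition, the one that [integral_M] selects; different
    partitions are never compared for whole integrals. *)
Lemma integral_ME : exists P : partition_of_unity A, forall alpha, integral_M alpha = pou_integral P alpha.
Proof.
have [Q _] := @pou_exists R n M A hM cM (fun=> setT) (fun x => conj (@openT M) I).
rewrite /integral_M; case: pselect => [exP|[]]; last by exists Q.
by exists (projT1 (cid exP)).
Qed.

End Forms.

(** * Spinor fields and the first variations *)

Section Spinors.
Variables (R : realType) (n : nat) (M : topologicalType) (A : oriented_atlas R n M).
Variable E : generalised_riemannian A.
Implicit Types (a b : chart_index A) (x : M) (y : 'rV[R]_n).
Implicit Types (alpha beta theta s rho sigma : local_field A (ext R n)).

Lemma gmetric_posdef a x : chart_dom a x -> posdef (gmetric E a x).
Proof. by move=> ax v v0; exact: gmetric_pos. Qed.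

Lemma gmetric_det a x : chart_dom a x -> 0 < \det (gmetric E a x).
Proof. by move=> ax; apply: posdef_det; [exact: gmetric_sym|exact: gmetric_posdef]. Qed.

Lemma sqrt_nu_gt0 a x : chart_dom a x -> 0 < Num.sqrt (nu E a x).
Proof. by move=> ax; rewrite sqrtr_gt0; exact: nu_gt0. Qed.

Lemma to_formK alpha : field_eq (to_form E (of_form E alpha)) alpha.
Proof.
move=> a x ax; rewrite /to_form /of_form wedgeZr scalerA wedgeA.
by rewrite mulVf ?gt_eqF ?sqrt_nu_gt0 // scale1r wedge_expNl ?wedge1l //; exact: bpot_degree.
Qed.

Lemma to_form_eq rho sigma : field_eq rho sigma -> field_eq (to_form E rho) (to_form E sigma).
Proof. by move=> rs a x ax; rewrite /to_form rs. Qed.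

Lemma of_form_eq alpha beta : field_eq alpha beta -> field_eq (of_form E alpha) (of_form E beta).
Proof. by move=> ab a x ax; rewrite /of_form ab. Qed.

Lemma smooth_field_sqrt_nu : smooth_field ((fun a x => Num.sqrt (nu E a x)) : local_field A R).
Proof.
move=> a k; apply: (CD_sqrt (@img_open _ _ _ _ a) _ (nu_smooth E a k)) => y Vy.
by apply: nu_gt0; exact: img_dom.
Qed.

Lemma smooth_ext_exp alpha : smooth_ext alpha -> smooth_ext (fun a x => wedge_exp (alpha a x)).
Proof.
move=> sa; apply/smooth_extP => a; apply: (smooth_wedge_exp (@img_open _ _ _ _ a)); exact: smooth_loc.
Qed.

Lemma smooth_to_form rho : smooth_ext rho -> smooth_ext (to_form E rho).
Proof.
move=> sr; apply: (smooth_ext_scale (f := fun a x => (Num.sqrt (nu E a x))^-1)).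
  move=> a k; apply: (CDV (@img_open _ _ _ _ a) _ (smooth_field_sqrt_nu a k)) => y Vy.
  by rewrite gt_eqF // sqrt_nu_gt0 //; exact: img_dom.
apply: (smooth_ext_wedge _ sr); apply: smooth_ext_exp.
apply: smooth_ext_eq (smooth_extZ (-1) (bpot_smooth E)) => a x _; by rewrite scaleN1r.
Qed.

Lemma smooth_of_form alpha : smooth_ext alpha -> smooth_ext (of_form E alpha).
Proof.
move=> sa; apply: (smooth_ext_scale smooth_field_sqrt_nu); apply: (smooth_ext_wedge _ sa).
exact: smooth_ext_exp (bpot_smooth E).
Qed.

Section Transition.
Variables (a b : chart_index A) (x : M) (ax : chart_dom a x) (bx : chart_dom b x).
Let J := transition_jacobian a b x.

Lemma transition_det_gt0 : 0 < \det J.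
Proof. exact: transition_oriented. Qed.

Lemma sqrt_nu_transition : Num.sqrt (nu E b x) = Num.sqrt (\det J) * Num.sqrt (nu E a x).
Proof. by rewrite (nu_transition E ax bx) sqrtrM // ltW // transition_det_gt0. Qed.

Lemma bpot_map_degree : has_degree 2 (ext_map J (bpot E b x)).
Proof. by apply: degree_map; exact: bpot_degree. Qed.

End Transition.

(** In the product of e^(-B_a) with the twist e^(B_a - J^* B_b) the potential of the chart a
    cancels, and the factor (det J)^(-1/2) is absorbed by the transition rule of nu. *)
Lemma is_form_to_form rho : is_spinor_field E rho -> is_form (to_form E rho).
Proof.
move=> [sr tr]; split; first exact: smooth_to_form.
move=> a b x ax bx; rewrite /to_form (tr a b) // ext_mapZ ext_mapM ext_map_exp ext_mapN.
have Ba := bpot_degree E ax; have Bb := bpot_map_degree a bx.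
rewrite wedgeZr scalerA -invfM mulrC -(sqrt_nu_transition ax bx); congr (_ *: _).
by rewrite wedgeA -wedge_expD ?addKr //; [exact: degreeN|apply: degreeD => //; exact: degreeN].
Qed.

Lemma is_spinor_of_form alpha : is_form alpha -> is_spinor_field E (of_form E alpha).
Proof.
move=> [sa ta]; split; first exact: smooth_of_form.
move=> a b x ax bx J; rewrite /of_form (ta a b) // ext_mapZ ext_mapM ext_map_exp.
have Ba := bpot_degree E ax; have Bb := bpot_map_degree a bx.
rewrite wedgeZr scalerA (sqrt_nu_transition ax bx) mulKf ?gt_eqF ?sqrtr_gt0 ?transition_det_gt0 //.
congr (_ *: _); rewrite wedgeA -wedge_expD ?subrK //; apply: degreeD => //; exact: degreeN.
Qed.

Lemma is_form_hodge alpha : is_form alpha -> is_form (fun a x => hodge (gmetric E a x) (alpha a x)).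
Proof.
move=> [sa ta]; split.
  apply/smooth_extP => a; apply: (smooth_hodge (@img_open _ _ _ _ a)).
  - by move=> i j; exact: gmetric_smooth.
  - by move=> y Vy; apply: gmetric_det; exact: img_dom.
  - exact: smooth_loc.
move=> a b x ax bx; rewrite (ta a b) //; apply: hodge_map.
- exact: transition_det_gt0.
- by rewrite unitmxE unitfE gt_eqF // gmetric_det.
- exact: gmetric_transition.
Qed.

Lemma is_form_hat alpha : is_form alpha -> is_form (fun a x => hat (alpha a x)).
Proof.
by move=> /(is_form_dscale (fun p => (-1) ^+ (p * p.+1)./2)); apply: is_form_eq => a x _; rewrite hatE.
Qed.

Lemma is_form_tilde alpha : is_form alpha -> is_form (fun a x => tilde (alpha a x)).
Proof.
by move=> /(is_form_dscale (fun p => (-1) ^+ p)); apply: is_form_eq => a x _; rewrite tildeE.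
Qed.

Lemma is_form_d_flux alpha : is_form alpha -> is_form (d_flux E alpha).
Proof.
by move=> fa; apply: is_formD; [exact: is_form_ext_d|apply: is_form_wedge => //; exact: flux_form].
Qed.

Lemma d_flux_eq alpha beta : field_eq alpha beta -> field_eq (d_flux E alpha) (d_flux E beta).
Proof. by move=> ab a x ax; rewrite /d_flux (ext_d_eq ab) // ab. Qed.

(* (gtilde rho)^nu in terms of rho^nu. *)
Definition gform alpha : local_field A (ext R n) :=
  fun a x => hodge (gmetric E a x) (dscale (gsign R n) (alpha a x)).

Lemma is_form_gform alpha : is_form alpha -> is_form (gform alpha).
Proof. by move=> fa; apply: is_form_hodge; exact: is_form_dscale. Qed.

Lemma to_form_gtilde rho : field_eq (to_form E (gtilde E rho)) (gform (to_form E rho)).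
Proof. by move=> a x ax; rewrite to_formK // /gform -hat_tilde_gsign. Qed.

Lemma to_form_d_nu rho : field_eq (to_form E (d_nu E rho)) (d_flux E (to_form E rho)).
Proof. exact: to_formK. Qed.

Definition parity_on c alpha := forall a x, chart_dom a x -> has_parity c (alpha a x).

Lemma parity_to_form c rho : has_chirality c rho -> parity_on c (to_form E rho).
Proof.
move=> cr a x ax; apply: parityZ; rewrite -[c]addFb; apply: parity_wedge; last exact: cr.
by apply: parity_exp; apply: degreeN; exact: bpot_degree.
Qed.

Lemma parity_of_form c alpha : parity_on c alpha -> parity_on c (of_form E alpha).
Proof.
move=> ca a x ax; apply: parityZ; rewrite -[c]addFb; apply: parity_wedge; last exact: ca.
by apply: parity_exp; exact: bpot_degree.
Qed.

Lemma parity_d_flux c alpha : parity_on c alpha -> parity_on (~~ c) (d_flux E alpha).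
Proof.
move=> ca a x ax; apply: parityD.
  rewrite ext_dE; apply: parity_sum => i _; rewrite -[~~ c]addTb; apply: parity_wedge.
    by apply: (@parity_degree _ _ 1); rewrite -(finset.cards1 i); exact: degree_ebase.
  move=> I Ic; rewrite pdiffE /partial -(@derive_cst R 'rV[R]_n R^o 0 (chart a x) (delta_mx 0 i)).
  apply: near_eq_derive; apply: (near_eq_on (@img_open _ _ _ _ a) _ (img_chart ax)) => y Vy.
  by apply: ca => //; exact: img_dom.
rewrite -[~~ c]addTb; apply: parity_wedge; last exact: ca.
by apply: (@parity_degree _ _ 3); exact: flux_degree.
Qed.

End Spinors.

Section Variation.
Variable R : realType.

(** Along tau + t d_nu sigma both functionals are polynomials in t of degree at most 2, the
    constraint being affine. The first variation is the linear coefficient. *)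
Lemma quadratic_variation (f : R -> R) (a b c : R) : (forall t, f t = a + t * b + t ^+ 2 * c) ->
  is_derive (0 : R) (1 : R) f (0 : R) <-> b = 0.
Proof.
move=> fE; have D : is_derive (0 : R) (1 : R) f b.
  apply: is_deriveP1 => eps eps0.
  have [e1 e10 eE] := eps_bound (normr_ge0 c) eps0; exists e1 => // h h0 he.
  rewrite !fE addr0 mul0r expr0n /= mul0r !addr0.
  have -> : b - h^-1 * (a + h * b + h ^+ 2 * c - a) = - (c * h) by field.
  by rewrite normrN normrM (le_trans _ eE) // ler_wpM2l // ltW.
split=> [D0|b0]; last by rewrite b0 in D.
by have [_ <-] := D; have [_ ->] := D0.
Qed.

End Variation.

(** * Integration by parts, first variations and the equivalence *)

Section Main.
Variables (R : realType) (n : nat) (M : topologicalType) (A : oriented_atlas R n M).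
Hypotheses (hM : hausdorff_space M) (cM : compact [set: M]).
Variable E : generalised_riemannian A.
Implicit Types (a b : chart_index A) (x : M) (y : 'rV[R]_n).
Implicit Types (alpha beta theta s t w X Y Z rho sigma : local_field A (ext R n)).

Lemma pdiff_dscale (U : set 'rV[R]_n) h i (al : 'rV[R]_n -> ext R n) y : smooth_form U al -> U y ->
  pdiff i (fun z => dscale h (al z)) y = dscale h (pdiff i al y).
Proof.
move=> sal Uy; apply/ffunP => I; rewrite dscaleE !pdiffE.
rewrite (_ : (fun z => _) = fun z => h #|I| * al z I); last by apply/funext => z; rewrite dscaleE.
exact: (deriveZ _ (smooth_derivable (sal I) Uy)).
Qed.

Lemma hat_ext_d_hat theta a x : smooth_ext theta -> chart_dom a x ->
  hat (ext_d (fun a x => hat (theta a x)) a x) = - ext_d (fun a x => tilde (theta a x)) a x.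
Proof.
move=> st ax; rewrite !ext_dE.
have HU h i : pdiff i (loc (fun a x => dscale h (theta a x)) a) (chart a x) =
    dscale h (pdiff i (loc theta a) (chart a x)).
  exact: (pdiff_dscale h i (smooth_loc a st) (img_chart ax)).
rewrite hatE dscale_sum -sumrN; apply: eq_bigr => i _; rewrite -hatE.
have d1 : has_degree 1 (ebase R [set i]%SET) by rewrite -(finset.cards1 i); exact: degree_ebase.
have -> : pdiff i (loc (fun a x => hat (theta a x)) a) (chart a x) = hat (pdiff i (loc theta a) (chart a x)).
  rewrite hatE -HU; congr (pdiff i _ _); apply/funext => y; by rewrite /loc hatE.
rewrite hat_wedge1 //; congr (- wedge _ _).
rewrite tildeE -HU; congr (pdiff i _ _); apply/funext => y; by rewrite /loc tildeE.
Qed.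

Variable P : partition_of_unity A.
Local Notation Int := (pou_integral P).

(* Stokes' theorem for tilde theta /\ s. *)
Lemma integral_d_flux theta s : is_form theta -> is_form s ->
  Int (fun a x => wedge (theta a x) (d_flux E s a x)) =
  Int (fun a x => wedge (hat (d_flux E (fun a x => hat (theta a x)) a x)) (s a x)).
Proof.
move=> ft fs; have ftt := is_form_tilde ft.
pose om a x := wedge (tilde (theta a x)) (s a x).
have fom : is_form om by exact: is_form_wedge.
have fr : is_form (fun a x => wedge (hat (d_flux E (fun a x => hat (theta a x)) a x)) (s a x)).
  by apply: is_form_wedge fs; apply: is_form_hat; apply: is_form_d_flux; exact: is_form_hat.
rewrite -[RHS]add0r -(stokes hM cM P fom) -pou_integralD //; last first.
- by case: fr.
- by case: (is_form_ext_d fom).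
apply: pou_integral_eq => a x ax; congr (fun_of_fin _ _).
have H3 := flux_degree E ax.
have -> : ext_d om a x = wedge (ext_d (fun a x => tilde (theta a x)) a x) (s a x) +
    wedge (theta a x) (ext_d s a x).
  by rewrite (ext_d_wedge ftt.1 fs.1 ax) tildeK.
have -> : hat (d_flux E (fun a x => hat (theta a x)) a x) =
    - ext_d (fun a x => tilde (theta a x)) a x + wedge (flux E a x) (tilde (theta a x)).
  rewrite -(hat_ext_d_hat ft.1 ax) -(hat_wedge3 _ H3) /d_flux.
  by rewrite hatE dscaleD -!hatE.
rewrite wedgeDl wedgeNl addrACA addrN add0r /d_flux wedgeDr; congr (_ + _).
by rewrite wedgeA (wedge_degree3 _ H3).
Qed.

(** The hat absorbs the outer one of hat o d_H o hat, so that both first variations become pairings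
    with a d_H. *)
Definition pairing Z s : R := Int (fun a x => wedge (hat (Z a x)) (s a x)).

Lemma pairing_eq Z Z' s s' : field_eq Z Z' -> field_eq s s' -> pairing Z s = pairing Z' s'.
Proof. by move=> ZZ ss; apply: pou_integral_eq => a x ax; rewrite ZZ // ss. Qed.

Lemma pairingDl Z Z' s : is_form Z -> is_form Z' -> is_form s ->
  pairing (fun a x => Z a x + Z' a x) s = pairing Z s + pairing Z' s.
Proof.
move=> fZ fZ' fs; rewrite -(pou_integralD cM P); last first.
- by case: (is_form_wedge (is_form_hat fZ') fs).
- by case: (is_form_wedge (is_form_hat fZ) fs).
by apply: pou_integral_eq => a x ax; rewrite !hatE dscaleD wedgeDl.
Qed.

Lemma pairingZl k Z s : is_form Z -> is_form s -> pairing (fun a x => k *: Z a x) s = k * pairing Z s.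
Proof.
move=> fZ fs; rewrite -(pou_integralZ cM P); last by case: (is_form_wedge (is_form_hat fZ) fs).
by apply: pou_integral_eq => a x ax; rewrite !hatE dscaleZ wedgeZl.
Qed.

Lemma pairing0l Z s : is_form Z -> is_form s -> field_eq Z (fun _ _ => 0) -> pairing Z s = 0.
Proof.
move=> fZ fs Z0; rewrite -[RHS](mul0r (pairing Z s)) -(pairingZl 0 fZ fs).
by apply: pairing_eq => // a x ax; rewrite Z0 // scaler0.
Qed.

Lemma pairingDr Z s s' : is_form Z -> is_form s -> is_form s' ->
  pairing Z (fun a x => s a x + s' a x) = pairing Z s + pairing Z s'.
Proof.
move=> fZ fs fs'; rewrite -(pou_integralD cM P); last first.
- by case: (is_form_wedge (is_form_hat fZ) fs').
- by case: (is_form_wedge (is_form_hat fZ) fs).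
by apply: pou_integral_eq => a x ax; rewrite wedgeDr.
Qed.

Lemma pairingZr k Z s : is_form Z -> is_form s -> pairing Z (fun a x => k *: s a x) = k * pairing Z s.
Proof.
move=> fZ fs; rewrite -(pou_integralZ cM P); last by case: (is_form_wedge (is_form_hat fZ) fs).
by apply: pou_integral_eq => a x ax; rewrite wedgeZr.
Qed.

(* pairing Z (dual Z) is the squared L^2 norm of Z. *)
Definition dual Z : local_field A (ext R n) := fun a x => hodge (gmetric E a x) (hat (Z a x)).

Lemma is_form_dual Z : is_form Z -> is_form (dual Z).
Proof. by move=> fZ; apply: is_form_hodge; exact: is_form_hat. Qed.

Lemma dualD Z Z' a x : dual (fun a x => Z a x + Z' a x) a x = dual Z a x + dual Z' a x.
Proof. by rewrite /dual hatE dscaleD hodgeD -!hatE. Qed.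

Lemma dualZ k Z a x : dual (fun a x => k *: Z a x) a x = k *: dual Z a x.
Proof. by rewrite /dual hatE dscaleZ hodgeZ -!hatE. Qed.

Lemma hat0 : hat (0 : ext R n) = 0.
Proof. by apply/ffunP => I; rewrite hatE dscaleE !ext0 mulr0. Qed.

Lemma hodge0 (g : 'M[R]_n) : hodge g 0 = 0.
Proof. by rewrite -[X in hodge _ X](scale0r (0 : ext R n)) hodgeZ scale0r. Qed.

Lemma to_formZ k rho a x : to_form E (fun a x => k *: rho a x) a x = k *: to_form E rho a x.
Proof. by rewrite /to_form wedgeZr !scalerA mulrC. Qed.

Lemma of_formZ k rho a x : of_form E (fun a x => k *: rho a x) a x = k *: of_form E rho a x.
Proof. by rewrite /of_form wedgeZr !scalerA mulrC. Qed.

Lemma pairing_dual_eq0 Z : is_form Z -> pairing Z (dual Z) = 0 -> field_eq Z (fun _ _ => 0).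
Proof.
move=> fZ I0 a x ax.
have H a' x' (ax' : chart_dom a' x') := wedge_hodge_ge0 (gmetric_sym E ax') (gmetric_posdef E ax') (hat (Z a' x')).
have F := is_form_wedge (is_form_hat fZ) (is_form_dual fZ).
have := pou_integral_pos cM F H I0 ax.
move=> /(wedge_hodge_eq0 (gmetric_sym E ax) (gmetric_posdef E ax)) /(congr1 (@hat R n)).
by rewrite hatK hat0.
Qed.

Lemma to_form_shift tau r sigma a x : to_form E (shift_field tau r sigma) a x =
  to_form E tau a x + r *: to_form E sigma a x.
Proof.
by rewrite /to_form /shift_field wedgeDr wedgeZr scalerDr !scalerA mulrC.
Qed.

Lemma hodge_square_top (g : 'M[R]_n) (t w : ext R n) r : g^T = g ->
  wedge (hodge g (t + r *: w)) (t + r *: w) finset.setT =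
  (wedge (hodge g t) t + (2 * r) *: wedge (hodge g t) w + r ^+ 2 *: wedge (hodge g w) w) finset.setT.
Proof.
move=> gT; have := hodge_wedge_sym w t gT; rewrite hodgeD hodgeZ.
move: (hodge g t) (hodge g w) => ht hw hwt.
rewrite !wedgeDl !wedgeDr !wedgeZl !wedgeZr !extD !extZ hwt.
have ring4 (u v z : R) : u + r * v + (r * v + r * (r * z)) = u + (2 * r) * v + r ^+ 2 * z by ring.
exact: ring4.
Qed.

Lemma wedge_affine (e r : R) (u t w : ext R n) :
  wedge (e *: u) (t + r *: w) = e *: (wedge u t + r *: wedge u w).
Proof. by rewrite wedgeZl wedgeDr wedgeZr. Qed.

Hypothesis integral_P : forall alpha, integral_M alpha = Int alpha.

(** By symmetry the linear coefficient is the integral of star t /\ d_H s. On forms of parity c,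
    star t = e hat (G t), and the two inner hats met in integration by parts cancel. *)
Lemma Q_variation c tau sigma : is_spinor_field E tau -> has_chirality c tau ->
  is_spinor_field E sigma ->
  first_variation_vanishes (Q_functional E) tau (d_nu E sigma) <->
  pairing (d_flux E (gform E (to_form E tau))) (to_form E sigma) = 0.
Proof.
move=> stau ctau ssig; set t := to_form E tau; set s := to_form E sigma.
have ft : is_form t by exact: is_form_to_form.
have fs : is_form s by exact: is_form_to_form.
pose w := d_flux E s; have fw : is_form w by exact: is_form_d_flux.
pose h alpha a x := hodge (gmetric E a x) (alpha a x).
have fh alpha : is_form alpha -> is_form (h alpha) by exact: is_form_hodge.
pose W alpha beta a x := wedge (h alpha a x) (beta a x).
have fW alpha beta : is_form alpha -> is_form beta -> is_form (W alpha beta).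
  by move=> fa fb; apply: is_form_wedge fb; exact: fh.
have [e e2 He] := hodge_gsign R n c.
have e0 : e != 0 by apply/eqP => e0; move: e2; rewrite e0 mul0r => /eqP; rewrite eq_sym oner_eq0.
have Itw : Int (W t w) = e * pairing (d_flux E (gform E t)) s.
  have fG : is_form (gform E t) by exact: is_form_gform.
  have fhG := is_form_hat fG.
  transitivity (Int (fun a x => e *: wedge (hat (gform E t a x)) (w a x))).
    apply: pou_integral_eq => a x ax; rewrite /W /h /gform (He _ _ (parity_to_form E ctau ax)).
    by rewrite !hatE dscaleZ -!hatE hatK wedgeZl scalerA e2 scale1r.
  rewrite (pou_integralZ cM P) ?(integral_d_flux fhG fs); last by case: (is_form_wedge fhG fw).
  congr (_ * _); apply: pou_integral_eq => a x ax; congr (wedge (hat _) _ _).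
  by apply: d_flux_eq ax => a' x' _; rewrite hatK.
rewrite /first_variation_vanishes.
have -> : pairing (d_flux E (gform E t)) s = 0 <-> Int (W t w) = 0.
  rewrite Itw; split=> [->|/eqP]; first by rewrite mulr0.
  by rewrite mulf_eq0 (negbTE e0) => /eqP.
apply: (quadratic_variation (a := 2^-1 * Int (W t t)) (c := 2^-1 * Int (W w w))) => r.
rewrite /Q_functional /spinor_inner integral_P.
transitivity (2^-1 * Int (fun a x => (W t t a x + (2 * r) *: W t w a x) + (r ^+ 2) *: W w w a x)).
  congr (_ * _); apply: pou_integral_eq => a x ax; rewrite !to_form_shift (@to_form_d_nu _ _ _ _ E sigma a x ax).
  exact: (hodge_square_top (t a x) (w a x) r (gmetric_sym E ax)).
have S1 := (fW t t ft ft).1; have S2 := (fW t w ft fw).1; have S3 := (fW w w fw fw).1.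
rewrite (pou_integralD cM P (smooth_extD S1 (smooth_extZ (2 * r) S2)) (smooth_extZ (r ^+ 2) S3)).
rewrite (pou_integralD cM P S1 (smooth_extZ (2 * r) S2)) !(pou_integralZ cM P) //.
have field3 (u v z : R) : 2^-1 * (u + 2 * r * v + r ^+ 2 * z) = 2^-1 * u + r * v + r ^+ 2 * (2^-1 * z) by field.
exact: field3.
Qed.

(** The Hodge operator in G~ meets that of the inner product, so the metric drops out and hat k
    remains up to the sign e. *)
Lemma C_variation c' gamma tau sigma : is_spinor_field E tau -> is_spinor_field E gamma ->
  has_chirality c' gamma -> is_spinor_field E sigma ->
  first_variation_vanishes (C_functional E gamma) tau (d_nu E sigma) <->
  pairing (d_flux E (to_form E gamma)) (to_form E sigma) = 0.
Proof.
move=> stau sgam cgam ssig; set t := to_form E tau; set s := to_form E sigma; set k := to_form E gamma.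
have ft : is_form t by exact: is_form_to_form.
have fs : is_form s by exact: is_form_to_form.
have fk : is_form k by exact: is_form_to_form.
pose w := d_flux E s; have fw : is_form w by exact: is_form_d_flux.
have [e e2 He] := star_sign_gsign R n c'.
have e0 : e != 0 by apply/eqP => e0; move: e2; rewrite e0 mul0r => /eqP; rewrite eq_sym oner_eq0.
pose W beta a x := wedge (hat (k a x)) (beta a x).
have fW beta : is_form beta -> is_form (W beta) by move=> fb; apply: is_form_wedge fb; exact: is_form_hat.
have Iw : Int (W w) = pairing (d_flux E k) s.
  rewrite (integral_d_flux (is_form_hat fk) fs).
  apply: pou_integral_eq => a x ax; congr (wedge (hat _) _ _).
  by apply: d_flux_eq ax => a' x' _; rewrite hatK.
have -> : pairing (d_flux E k) s = 0 <-> 2^-1 * e * Int (W w) = 0.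
  rewrite Iw; split=> [->|/eqP]; first by rewrite mulr0.
  by rewrite mulf_eq0 (negbTE (mulf_neq0 _ e0)) ?invr_eq0 ?pnatr_eq0 // => /eqP.
apply: (quadratic_variation (a := 2^-1 * e * Int (W t)) (c := 0)) => r.
rewrite /C_functional /spinor_inner integral_P mulr0 addr0.
transitivity (2^-1 * Int (fun a x => e *: (W t a x + r *: W w a x))).
  congr (_ * _); apply: pou_integral_eq => a x ax; rewrite to_form_shift (@to_form_d_nu _ _ _ _ E sigma a x ax).
  rewrite (@to_form_gtilde _ _ _ _ E gamma a x ax) /gform hodgeK ?gmetric_sym ?gmetric_det //.
  by rewrite (He _ (parity_to_form E cgam ax)) (wedge_affine e r (hat (k a x)) (t a x) (w a x)).
have S1 := (fW t ft).1; have S2 := (fW w fw).1.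
rewrite (pou_integralZ cM P e (smooth_extD S1 (smooth_extZ r S2))).
rewrite (pou_integralD cM P S1 (smooth_extZ r S2)) (pou_integralZ cM P r S2).
by ring.
Qed.

(** This turns [dual Z] into an admissible direction. [hodge] shifts the parity by n; for Z of the
    parity of d_H (G t) the result has the chirality opposite to tau. *)
Lemma test_spinor c Z : is_form Z -> parity_on c Z -> exists sigma, 
  chiral_spinor_field E (c (+) odd n) sigma /\ field_eq (to_form E sigma) (dual Z).
Proof.
move=> fZ cZ; pose sg := of_form E (dual Z).
(* has_chirality also constrains the values outside the chart domains. *)
pose sigma a x := if `[< chart_dom a x >] then sg a x else 0.
have es : field_eq sg sigma by move=> a x ax; rewrite /sigma asboolT.
have [ss ts] := is_spinor_of_form E (is_form_dual fZ).
exists sigma; split.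
  2: by move=> a x ax; rewrite -(to_form_eq E es ax) to_formK.
split; first split.
- exact: smooth_ext_eq es ss.
- by move=> a b x ax bx J; rewrite -!es //; exact: ts.
move=> a x; have [ax|ax] := pselect (chart_dom a x); last first.
  by rewrite /sigma asboolF // => J _; rewrite ext0.
have cD : parity_on (c (+) odd n) (dual Z).
  by move=> a' x' ax'; apply: parity_hodge; rewrite hatE; apply: parity_dscale; exact: cZ.
have <- : of_form E (dual Z) a x = sigma a x := es a x ax.
have cS := parity_of_form E cD; exact: cS.
Qed.

Theorem constrained_critical_iff (c : bool) (tau gamma : local_field A (ext R n))
    (tau_chiral : chiral_spinor_field E c tau)
    (gamma_chiral : exists c' : bool, chiral_spinor_field E c' gamma)
    (same_chirality : has_chirality c (gtilde E gamma)) :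
  constrained_critical E c gamma tau <->
  exists lambda : R,
    field_eq (d_nu E (gtilde E tau)) (fun a x => lambda *: d_nu E gamma a x).
Proof.
have [stau ctau] := tau_chiral; have [c' [sgam cgam]] := gamma_chiral.
pose X := d_flux E (gform E (to_form E tau)); pose Y := d_flux E (to_form E gamma).
have ft := is_form_to_form stau; have fk := is_form_to_form sgam.
have fX : is_form X by apply: is_form_d_flux; exact: is_form_gform.
have fY : is_form Y by exact: is_form_d_flux.
have cX : parity_on (~~ (c (+) odd n)) X.
  apply: parity_d_flux => a x ax; apply: parity_hodge; apply: parity_dscale; exact: parity_to_form ctau _ _ ax.
have gform_gamma a x : chart_dom a x -> has_parity (c' (+) odd n) (gform E (to_form E gamma) a x).
  by move=> ax; apply: parity_hodge; apply: parity_dscale; exact: parity_to_form cgam _ _ ax.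
(* G~ gamma has parity c' + n. If this is not c, then by hypothesis G~ gamma has both parities and
   is zero; since the operator is invertible, gamma is zero at the point as well, and zero has every
   parity. *)
have cY : parity_on (~~ (c (+) odd n)) Y.
  apply: parity_d_flux => a x ax; have Pk := parity_to_form E cgam ax.
  have [<-|cc] := eqVneq (c' (+) odd n) c; first by rewrite addbK.
  have Pg : has_parity c (gform E (to_form E gamma) a x).
    rewrite -(@to_form_gtilde _ _ _ _ E gamma a x ax); exact: parity_to_form same_chirality _ _ ax.
  have g0 : gform E (to_form E gamma) a x = 0.
    apply: parity_both Pg _; have := gform_gamma a x ax.
    by rewrite (_ : c' (+) odd n = ~~ c) //; move: cc; case: (_ (+) _); case: (c).
  have [e e2 He] := star_sign_gsign R n c'.
  have k0 : to_form E gamma a x = 0.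
    have := congr1 (hodge (gmetric E a x)) g0.
    rewrite /gform hodgeK ?gmetric_sym ?gmetric_det // (He _ Pk) hodge0 => /(congr1 (fun u => e *: u)).
    by rewrite scalerA e2 scale1r scaler0 => /(congr1 (@hat R n)); rewrite hatK hat0.
  by rewrite k0 => J _; rewrite ext0.
have eqv lambda : field_eq (d_nu E (gtilde E tau)) (fun a x => lambda *: d_nu E gamma a x) <->
    field_eq X (fun a x => lambda *: Y a x).
  have XE : field_eq (to_form E (d_nu E (gtilde E tau))) X.
    move=> a x ax; rewrite (@to_form_d_nu _ _ _ _ E _ a x ax).
    exact: (d_flux_eq E (@to_form_gtilde _ _ _ _ E tau) ax).
  have YE := @to_form_d_nu _ _ _ _ E gamma.
  split=> H a x ax.
    have YEa : to_form E (d_nu E gamma) a x = Y a x := YE a x ax.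
    exact: etrans (esym (XE a x ax)) (etrans (to_form_eq E H ax) (etrans (to_formZ lambda (d_nu E gamma) a x) (congr1 (fun u => lambda *: u) YEa))).
  have H' : field_eq (d_flux E (to_form E (gtilde E tau))) (fun a x => lambda *: Y a x).
    by move=> b z bz; rewrite (d_flux_eq E (@to_form_gtilde _ _ _ _ E tau) bz); exact: H.
  exact: etrans (of_form_eq E H' ax) (of_formZ lambda Y a x).
split=> [crit|[lambda /eqv XY] sigma [ssig csig]]; last first.
  move=> /(C_variation stau sgam cgam ssig) Y0; apply/(Q_variation stau ctau ssig).
  have fs := is_form_to_form ssig.
  rewrite (pairing_eq (Z' := fun a x => lambda *: Y a x) (s' := to_form E sigma) XY) //.
  by rewrite (pairingZl _ fY fs) Y0 mulr0.
have fdX := is_form_dual fX; have fdY := is_form_dual fY.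
have test lambda : pairing Y (dual X) = lambda * pairing Y (dual Y) -> field_eq X (fun a x => lambda *: Y a x).
  (* The assumption on lambda says that Z is orthogonal to Y, hence that the direction [dual Z]
     leaves the constraint stationary. *)
  move=> HY; pose Z a x := X a x + (- lambda) *: Y a x.
  have flY := is_formZ (- lambda) fY; have fldY := is_formZ (- lambda) fdY.
  have fZ : is_form Z by exact: is_formD.
  have cZ : parity_on (~~ (c (+) odd n)) Z.
    by move=> a x ax; apply: parityD; [exact: cX|apply: parityZ; exact: cY].
  have [sigma [[ssig csig] sE]] := test_spinor fZ cZ.
  have sE' : field_eq (to_form E sigma) (fun a x => dual X a x + (- lambda) *: dual Y a x).
    by move=> a x ax; rewrite sE // dualD dualZ.
  have csig' : has_chirality (~~ c) sigma by move: csig; rewrite addNb addbK.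
  have Ys : pairing Y (to_form E sigma) = 0.
    rewrite (pairing_eq (Z' := Y) _ sE') // (pairingDr fY fdX fldY) (pairingZr _ fY fdY) HY.
    by rewrite mulNr subrr.
  have Xs : pairing X (to_form E sigma) = 0.
    apply/(Q_variation stau ctau ssig); apply: crit => //.
    exact/(C_variation stau sgam cgam ssig).
  have Z0 : field_eq Z (fun _ _ => 0).
    have fs := is_form_to_form ssig.
    apply: (pairing_dual_eq0 fZ); rewrite (pairing_eq (Z' := Z) (s' := to_form E sigma)) //.
      by rewrite (pairingDl fX flY fs) (pairingZl _ fY fs) Xs Ys mulr0 addr0.
    by move=> a x ax; rewrite sE.
  by move=> a x ax; have /eqP := Z0 a x ax; rewrite /Z scaleNr subr_eq0 => /eqP.
(* If Y has norm 0 it vanishes, the constraint excludes no direction, and lambda = 0 works;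
   otherwise lambda is the projection coefficient. *)
have [YY0|YY0] := eqVneq (pairing Y (dual Y)) 0.
  exists 0; apply/eqv; apply: test; rewrite mul0r.
  have Y0 := pairing_dual_eq0 fY YY0.
  exact: pairing0l fY fdX Y0.
exists (pairing Y (dual X) / pairing Y (dual Y)); apply/eqv; apply: test.
by rewrite mulfVK.
Qed.

End Main.

Unset Implicit Arguments.

Theorem proposition5p2 (R : realType) (n : nat) (M : topologicalType)
    (hausM : hausdorff_space M) (compactM : compact [set: M])
    (A : oriented_atlas R n M) (E : generalised_riemannian A)
    (c : bool) (tau gamma : local_field A (ext R n))
    (tau_chiral : chiral_spinor_field E c tau)
    (tau_closed : field_eq (d_nu E tau) (fun _ _ => 0))
    (gamma_chiral : exists c' : bool, chiral_spinor_field E c' gamma)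
    (same_chirality : has_chirality c (gtilde E gamma)) :
  constrained_critical E c gamma tau <->
  exists lambda : R,
    field_eq (d_nu E (gtilde E tau)) (fun a x => lambda *: d_nu E gamma a x).
Proof.
have [P HP] := integral_ME A hausM compactM.
exact: (constrained_critical_iff hausM compactM HP tau_chiral gamma_chiral same_chirality).
Qed.
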